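(* Let $n\geq1$, $p,q>0$, $\alpha\in(0,n)$, $\beta\in(0,2]$, and consider the Cauchy problem $$u_t+(-\Delta)^{\frac{\beta}{2}}u=I_\alpha(|u|^p)|u|^q\quad (x\in\mathbb{R}^n,\ t>0),\qquad u(x,0)=u_0(x)\quad (x\in\mathbb{R}^n),\qquad (P)$$ where $I_\alpha$ is the Riesz potential. (i) Assume that $\alpha+\beta>n$ and let $u_0\in L^1(\mathbb{R}^n)$ be such that $\int_{\mathbb{R}^n}u_0(x)\,dx>0$. If $$2<p+q<1+\frac{\beta+\alpha}{n},$$ then problem (P) has no global weak solutions. (ii) Let $\gamma\in(0,\alpha+\beta)$ and $u_0\in L^1_{\mathrm{loc}}(\mathbb{R}^n)$. If $$u_0(x)\geq\varepsilon(1+|x|^2)^{-\gamma/2}\quad(x\in\mathbb{R}^n)\qquad\text{and}\qquad 2<p+q<1+\frac{\beta+\alpha}{\gamma}$$ for some constant $\varepsilon>0$, then problem (P) has no global weak solutions.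
   Context: Riesz potential: $I_\alpha(v)(x)=A_\alpha\int_{\mathbb{R}^n}\frac{v(y)}{|x-y|^{n-\alpha}}\,dy$, with $A_\alpha=\dfrac{\Gamma(\frac{n-\alpha}{2})}{\Gamma(\frac\alpha2)\,\pi^{n/2}\,2^\alpha}$, acting in the space variable. Fractional Laplacian: for $\beta=2$, $(-\Delta)^{\beta/2}=-\Delta$. For $\beta\in(0,2)$, with $s=\beta/2\in(0,1)$, $$(-\Delta)^s v(x)=C_{n,s}\,\mathrm{p.v.}\int_{\mathbb{R}^n}\frac{v(x)-v(y)}{|x-y|^{n+2s}}\,dy,\qquad C_{n,s}=\frac{4^s\,\Gamma(\frac n2+s)}{\pi^{n/2}|\Gamma(-s)|}.$$ Weak solution: let $u_0\in L^1_{\mathrm{loc}}(\mathbb{R}^n)$ and $T>0$. A (real-valued) function $u\in L^1_{\mathrm{loc}}((0,T)\times\mathbb{R}^n)$ is a weak solution of (P) on $[0,T)\times\mathbb{R}^n$ if $I_\alpha(|u|^p)|u|^q\in L^1_{\mathrm{loc}}((0,T)\times\mathbb{R}^n)$ and $$\int_{\mathbb{R}^n}u(\tau,x)\psi(\tau,x)\,dx-\int_{\mathbb{R}^n}u_0(x)\psi(0,x)\,dx=\int_0^\tau\!\!\int_{\mathbb{R}^n}I_\alpha(|u|^p)|u|^q\psi\,dx\,dt-\int_0^\tau\!\!\int_{\mathbb{R}^n}u\,(-\Delta)^{\frac\beta2}\psi\,dx\,dt+\int_0^\tau\!\!\int_{\mathbb{R}^n}u\,\psi_t\,dx\,dt$$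 holds (in particular, all the integrals are meaningful) for all compactly supported test functions $\psi\in C^{1,2}_{t,x}([0,T)\times\mathbb{R}^n)$ and all $0\leq\tau<T$. If $T=\infty$, $u$ is called a global (in time) weak solution. *)

(* Defs.v *)
From HB Require Import structures.
From mathcomp Require Import all_boot all_order all_algebra.
From mathcomp Require Import all_classical all_reals all_analysis.
From mathcomp Require Import measurable_realfun.

Set Implicit Arguments.
Unset Strict Implicit.
Unset Printing Implicit Defensive.
Import Order.TTheory GRing.Theory Num.Theory.
Import numFieldNormedType.Exports.

Local Open Scope classical_set_scope.
Local Open Scope ring_scope.

(* R^n is 'rV[R]_n, with its library topology and normed module structure.
   Caution: the library norm `|x| on 'rV[R]_n is the sup norm; the Euclidean
   norm of the statement is enorm. *)
Definition enorm (R : realType) (n : nat) (x : 'rV[R]_n) : R :=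
  Num.sqrt (\sum_(i < n) x 0 i ^+ 2).

Section measurable_rV.
Context {R : realType} {n : nat}.

Let coor (i : 'I_n) (x : 'rV[R]_n) : measurableTypeR R := x 0 i.

Let rV_set0 : g_sigma_preimage coor set0.
Proof. exact: sigma_algebra0. Qed.

Let rV_setC A : g_sigma_preimage coor A -> g_sigma_preimage coor (~` A).
Proof. exact: sigma_algebraC. Qed.

Let rV_bigcup (F : (set 'rV[R]_n)^nat) :
  (forall i, g_sigma_preimage coor (F i)) ->
  g_sigma_preimage coor (\bigcup_i (F i)).
Proof. exact: sigma_algebra_bigcup. Qed.

(* The sigma-algebra generated by the coordinates, i.e. the Borel sets. *)
HB.instance Definition _ := @isMeasurable.Build default_measure_display
  'rV[R]_n (g_sigma_preimage coor) rV_set0 rV_setC rV_bigcup.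

Lemma measurable_coor (i : 'I_n) :
  measurable_fun [set: 'rV[R]_n] (fun x => x 0 i : measurableTypeR R).
Proof.
move=> _ Y mY; rewrite setTI; apply: sub_sigma_algebra => /=.
rewrite -bigcup_seq/=; exists i => /=; first by rewrite mem_index_enum.
by exists Y => //; rewrite setTI.
Qed.

Lemma measurable_fun_coorP d (T : measurableType d) (f : T -> 'rV[R]_n) :
  (forall i, measurable_fun setT (fun x => f x 0 i : measurableTypeR R)) ->
  measurable_fun setT f.
Proof.
move=> mf _ A; rewrite setTI => mA.
suff : g_sigma_preimage coor `<=` [set A | measurable (f @^-1` A)] by exact.
apply: smallest_sub => /=.
  split => //=.
  - by rewrite preimage_set0.
  - by move=> B mB; rewrite setTD preimage_setC; exact: measurableC.
  - by move=> B mB; rewrite preimage_bigcup; exact: bigcupT_measurable.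
move=> B; rewrite -bigcup_seq/= => -[i _] [C mC <-] /=.
by rewrite setTI; have := mf i measurableT C mC; rewrite setTI.
Qed.

End measurable_rV.

Definition consrV (R : realType) (n : nat) (p : measurableTypeR R * 'rV[R]_n) :
    'rV[R]_n.+1 :=
  \row_(i < n.+1) if unlift ord0 i is Some j then p.2 0 j else p.1.


Definition unconsrV (R : realType) (n : nat) (x : 'rV[R]_n.+1) :
    measurableTypeR R * 'rV[R]_n :=
  (x 0 ord0, \row_(j < n) x 0 (lift ord0 j)).

Lemma consrVK (R : realType) (n : nat) : cancel (@consrV R n) (@unconsrV R n).
Proof.
move=> [a x]; rewrite /unconsrV /consrV mxE unlift_none; congr pair.
by apply/rowP => j; rewrite !mxE liftK.
Qed.

Lemma measurable_consrV (R : realType) (n : nat) :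
  measurable_fun setT (@consrV R n).
Proof.
apply: measurable_fun_coorP => i.
have [j ->|->] := unliftP ord0 i.
- rewrite (_ : (fun _ => _) = (fun x : 'rV[R]_n => x 0 j) \o snd).
    exact: (measurableT_comp (measurable_coor j) measurable_snd).
  by apply/funext => p /=; rewrite mxE liftK.
- rewrite (_ : (fun _ => _) = fst); first exact: measurable_fst.
  by apply/funext => p /=; rewrite mxE unlift_none.
Qed.

Lemma measurable_unconsrV (R : realType) (n : nat) :
  measurable_fun setT (@unconsrV R n).
Proof.
apply: measurable_fun_pair; first exact: measurable_coor.
apply: measurable_fun_coorP => j.
rewrite (_ : (fun _ => _) = (fun x : 'rV[R]_n.+1 => x 0 (lift ord0 j))).
  exact: measurable_coor.
by apply/funext => x; rewrite mxE.
Qed.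

Section pushforward_consrV.
Context {R : realType} {n : nat}.
Variable m : {sigma_finite_measure set 'rV[R]_n -> \bar R}.

Definition push_consrV : set 'rV[R]_n.+1 -> \bar R :=
  pushforward (@lebesgue_measure R \x m)%E (@consrV R n).

Let push_consrV0 : push_consrV set0 = 0%E.
Proof. by rewrite /push_consrV /pushforward preimage_set0 measure0. Qed.

Let push_consrV_ge0 A : (0 <= push_consrV A)%E.
Proof. by apply: integral_ge0 => /= x _; exact: measure_ge0. Qed.

Let push_consrV_sigma_additive : semi_sigma_additive push_consrV.
Proof.
have mE A : measurable A -> measurable (@consrV R n @^-1` A).
  by move=> mA; rewrite -[X in measurable X]setTI; exact: measurable_consrV.
move=> F mF tF mUF; rewrite /push_consrV /pushforward preimage_bigcup.
apply: measure_semi_sigma_additive => //.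
- by move=> k; exact: mE.
- apply/trivIsetP => /= i j _ _ ij; rewrite -preimage_setI.
  by move/trivIsetP : tF => /(_ _ _ _ _ ij) ->//; rewrite preimage_set0.
- by rewrite -preimage_bigcup; exact: mE.
Qed.

HB.instance Definition _ := isMeasure.Build _ _ _ push_consrV
  push_consrV0 push_consrV_ge0 push_consrV_sigma_additive.

Let push_consrV_sigma_finite : sigma_finite setT push_consrV.
Proof.
have /sigma_finiteP[F [FT ndF mF]] := sigma_finiteT (@lebesgue_measure R).
have /sigma_finiteP[G [GT ndG mG]] := sigma_finiteT m.
exists (fun k => @unconsrV R n @^-1` (F k `*` G k)).
  rewrite -preimage_bigcup -(preimage_setT (@unconsrV R n)); congr preimage.
  rewrite -setXTT FT GT predeqE => -[x y]; split.
    move=> [/= [i _ Fx] [k _ Gy]]; exists (maxn i k) => //; split.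
    - by move: x Fx; exact/subsetPset/ndF/leq_maxl.
    - by move: y Gy; exact/subsetPset/ndG/leq_maxr.
  by move=> [i _ []/= ? ?]; split; exists i.
move=> k; have [mFk Fk] := mF k; have [mGk Gk] := mG k; split.
  rewrite -[X in measurable X]setTI; apply: measurable_unconsrV => //.
  exact: measurableX.
rewrite /push_consrV /pushforward -comp_preimage.
rewrite (_ : _ \o _ = id); last by rewrite funeqE => x /=; rewrite consrVK.
by rewrite preimage_id product_measure1E// lte_mul_pinfty// ge0_fin_numE.
Qed.

HB.instance Definition _ :=
  Measure_isSigmaFinite.Build _ _ _ push_consrV push_consrV_sigma_finite.

End pushforward_consrV.

(* Lebesgue measure on R^n, as iterated product of the one-dimensional one. *)
Fixpoint lebesgue_rV (R : realType) (n : nat) :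
    {sigma_finite_measure set 'rV[R]_n -> \bar R} :=
  match n return {sigma_finite_measure set 'rV[R]_n -> \bar R} with
  | 0 => dirac (0 : 'rV[R]_0)
  | n'.+1 => push_consrV (lebesgue_rV R n')
  end.

Lemma lebesgue_rV_box (R : realType) (n : nat) (a b : 'rV[R]_n) :
  (forall i, a 0 i <= b 0 i) ->
  lebesgue_rV R n [set x : 'rV[R]_n | forall i, a 0 i <= x 0 i <= b 0 i] =
  (\prod_(i < n) (b 0 i - a 0 i))%:E.
Proof.
elim: n a b => [|n IHn] a b ab.
  rewrite big_ord0 /= diracE (_ : _ \in _ = true)//.
  by apply/mem_set => -[].
pose tl (x : 'rV[R]_n.+1) : 'rV[R]_n := \row_j x 0 (lift ord0 j).
have IH : lebesgue_rV R n
    [set y : 'rV[R]_n | forall j, tl a 0 j <= y 0 j <= tl b 0 j] =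
    (\prod_(j < n) (tl b 0 j - tl a 0 j))%:E.
  by apply: IHn => j; rewrite !mxE.
set D := [set y : 'rV[R]_n | forall j, tl a 0 j <= y 0 j <= tl b 0 j] in IH.
transitivity ((@lebesgue_measure R \x lebesgue_rV R n)%E
    (`[a 0 ord0, b 0 ord0]%classic `*` D)).
  rewrite /= /push_consrV /pushforward; congr product_measure1.
  apply/seteqP; split => -[t y] /=.
  - move=> H; split.
      by have := H ord0; rewrite mxE unlift_none in_itv.
    by move=> j; have := H (lift ord0 j); rewrite !mxE liftK.
  - move=> [t01 H] i; rewrite mxE; have [j ->|->] := unliftP ord0 i.
      by have := H j; rewrite !mxE ?liftK.
    by move: t01; rewrite in_itv /= ?unlift_none.
rewrite product_measure1E//; last first.
  rewrite (_ : D = \bigcap_(j in [set: 'I_n])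
      ((fun y : 'rV[R]_n => y 0 j : measurableTypeR R) @^-1`
       `[tl a 0 j, tl b 0 j]%classic)); last first.
    by apply/seteqP; split => y /= H j => [_|]; have := H j; rewrite /= in_itv//; apply.
  apply: fin_bigcap_measurable => // j _.
  by rewrite -[X in measurable X]setTI; apply: measurable_coor.
have LE : @lebesgue_measure R `[a 0 ord0, b 0 ord0]%classic =
    (b 0 ord0 - a 0 ord0)%:E.
  rewrite lebesgue_measure_itv/= lte_fin.
  have := ab ord0; rewrite le_eqVlt => /orP[/eqP ->|->//].
  by rewrite ltxx subrr.
rewrite [X in (X * _)%E]LE [X in (_ * X)%E]IH -EFinM big_ord_recl.
by congr (_ * _)%:E; apply: eq_bigr => j _; rewrite !mxE.
Qed.

Local Open Scope ereal_scope.

(* Lebesgue integrability. The measures above live on the Borel sets, whereas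
   a function in L^1 is only a.e. equal to a Borel function. The library
   integral does not see null sets, even for non-measurable functions
   (integral_ae_eq below), so \int[mu]_(x in D) f x is the Lebesgue integral
   of f whenever Lintegrable mu D f. *)
Definition Lintegrable d (T : measurableType d) (R : realType)
    (mu : {measure set T -> \bar R}) (D : set T) (f : T -> \bar R) : Prop :=
  exists2 g : T -> \bar R, mu.-integrable D g & f = g %[ae mu in D].

Section integral_ae_eq.
Context d (T : measurableType d) (R : realType).
Variable mu : {measure set T -> \bar R}.
Import HBNNSimple.

Let ge0_integral_ae_le (f g : T -> \bar R) :
  (forall x, 0 <= f x) -> (forall x, 0 <= g x) ->
  f = g %[ae mu] -> \int[mu]_x f x <= \int[mu]_x g x.
Proof.
move=> f0 g0 [N [mN N0 subN]]; rewrite ge0_integralTE// ge0_integralTE//.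
apply: ge_ereal_sup => _ [h /= hf <-].
apply: ereal_sup_ubound.
have mNC := measurableC mN.
pose h' := mul_nnsfun h (indic_nnsfun R mNC).
have h'E x : h' x = (h x * \1_(~` N) x)%R by [].
have h'N x : ~ N x -> h' x = h x by move=> Nx; rewrite h'E indicE mem_set// mulr1.
exists h' => /=.
  move=> x; suff : (h' x)%:E <= g x by [].
  have [Nx|Nx] := pselect (N x).
    by rewrite h'E indicE memNset ?mulr0//; apply.
  rewrite h'N//; have <- : f x = g x.
    by apply: contrapT => fgx; apply: Nx; apply: subN => /= /(_ Logic.I).
  exact: hf.
have mE (k : {nnsfun T >-> R}) : measurable_fun setT (fun x => (k x)%:E).
  by apply/measurable_EFinP; exact: measurable_funPT.
rewrite -!integralT_nnsfun; apply: ge0_ae_eq_integral => //.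
- by move=> x _; rewrite lee_fin.
- by move=> x _; rewrite lee_fin.
- exists N; split=> // x /= xh; apply: contrapT => Nx; apply: xh => _.
  by congr EFin; exact: h'N.
Qed.

Let ge0_integral_ae_eq (f g : T -> \bar R) :
  (forall x, 0 <= f x) -> (forall x, 0 <= g x) ->
  f = g %[ae mu] -> \int[mu]_x f x = \int[mu]_x g x.
Proof.
move=> f0 g0 fg; apply/eqP; rewrite eq_le !ge0_integral_ae_le//.
by apply: filterS fg => x + _ => ->.
Qed.

Lemma integral_ae_eq (D : set T) (f g : T -> \bar R) :
  f = g %[ae mu in D] -> \int[mu]_(x in D) f x = \int[mu]_(x in D) g x.
Proof.
move=> fg; rewrite integral_mkcond [RHS]integral_mkcond.
rewrite integralE [RHS]integralE.
have DD : f \_ D = g \_ D %[ae mu].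
  apply: filterS fg => x fgx _; rewrite !patchE; case: ifPn => //.
  by rewrite inE => /fgx.
by congr (_ - _); apply: ge0_integral_ae_eq => //;
  apply: filterS DD => x /(_ Logic.I); rewrite ?funeposE ?funenegE => ->.
Qed.

End integral_ae_eq.

Local Close Scope ereal_scope.

(* Lebesgue measure on R x R^n (time x space). *)
Definition lebesgue_tx (R : realType) (n : nat) :
    {measure set (measurableTypeR R * 'rV[R]_n)%type -> \bar R} :=
  (@lebesgue_measure R \x lebesgue_rV R n)%E.

(* (0,T) x R^n and [0,T) x R^n, for T in (0,+oo]. *)
Definition strip_open (R : realType) (n : nat) (T : \bar R) :
    set (R * 'rV[R]_n)%type :=
  [set z | 0 < z.1 /\ (z.1%:E < T)%E].
Definition strip (R : realType) (n : nat) (T : \bar R) :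
    set (R * 'rV[R]_n)%type :=
  [set z | 0 <= z.1 /\ (z.1%:E < T)%E].

Definition L1loc_space (R : realType) (n : nat) (f : 'rV[R]_n -> R) : Prop :=
  forall K : set 'rV[R]_n, compact K ->
    Lintegrable (lebesgue_rV R n) K (EFin \o f).

Definition L1loc_strip (R : realType) (n : nat) (T : \bar R)
    (f : R * 'rV[R]_n -> \bar R) : Prop :=
  forall K : set (R * 'rV[R]_n)%type, compact K -> K `<=` strip_open T ->
    Lintegrable (lebesgue_tx R n) K f.

(* The Gamma function, for x not in {0, -1, -2, ...}: Euler's integral for
   x > 0, extended by Gamma(x) = Gamma(x + k) / (x (x + 1) ... (x + k - 1)),
   where k is the least natural number such that x + k > 0. *)
Definition Gamma (R : realType) (x : R) : R :=
  let k := absz (Num.min 0 (Num.floor x)) in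
  (\int[@lebesgue_measure R]_(t in `]0, +oo[)
     (t `^ (x + k%:R - 1) * expR (- t))) / \prod_(j < k) (x + j%:R).

Definition riesz_const (R : realType) (n : nat) (alpha : R) : R :=
  Gamma ((n%:R - alpha) / 2) /
  (Gamma (alpha / 2) * pi `^ (n%:R / 2) * 2 `^ alpha).

(* Extended-valued: for v >= 0 the integral may be +oo. The kernel gets the
   value 0 on the null set y = x. *)
Definition riesz_potential (R : realType) (n : nat) (alpha : R)
    (v : 'rV[R]_n -> R) (x : 'rV[R]_n) : \bar R :=
  ((riesz_const n alpha)%:E *
   \int[lebesgue_rV R n]_y (v y / enorm (x - y) `^ (n%:R - alpha))%:E)%E.

Definition basis_vec (R : realType) (n : nat) (i : 'I_n) : 'rV[R]_n :=
  delta_mx 0 i.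

Definition laplacian (R : realType) (n : nat) (v : 'rV[R]_n -> R)
    (x : 'rV[R]_n) : R :=
  \sum_(i < n) 'D_(basis_vec R i) ('D_(basis_vec R i) v) x.

Definition fraclap_const (R : realType) (n : nat) (s : R) : R :=
  4 `^ s * Gamma (n%:R / 2 + s) / (pi `^ (n%:R / 2) * `|Gamma (- s)|).

(* (-Delta)^(beta/2) for 0 < beta <= 2; the principal value is the limit as
   e -> 0+ of the integrals over |x - y| > e. *)
Definition fraclap (R : realType) (n : nat) (beta : R) (v : 'rV[R]_n -> R)
    (x : 'rV[R]_n) : R :=
  if beta == 2 then - laplacian v x else
  let s := beta / 2 in
  fraclap_const n s *
  lim ((\int[lebesgue_rV R n]_(y in [set y : 'rV[R]_n | e < enorm (x - y)])
          ((v x - v y) / enorm (x - y) `^ (n%:R + 2 * s))) @[e --> 0^'+]).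

(* Time derivative on [0,+oo), one-sided at t = 0. *)
Definition time_quot (R : realType) (n : nat) (psi : R -> 'rV[R]_n -> R)
    (t : R) (x : 'rV[R]_n) (h : R) : R :=
  h^-1 * (psi (t + h) x - psi t x).
Definition time_nbhs (R : realType) (t : R) : set_system R :=
  within [set h | 0 <= t + h] (0 : R)^'.
Definition time_deriv (R : realType) (n : nat) (psi : R -> 'rV[R]_n -> R)
    (t : R) (x : 'rV[R]_n) : R :=
  lim (time_quot psi t x h @[h --> time_nbhs t]).

Record C12 (R : realType) (n : nat) (T : \bar R) (psi : R -> 'rV[R]_n -> R) :
    Prop := {
  C12_cont : {within strip T, continuous (fun z => psi z.1 z.2)};
  C12_derivable_t : forall z, strip T z ->
    cvg (time_quot psi z.1 z.2 h @[h --> time_nbhs z.1]);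
  C12_cont_t : {within strip T, continuous (fun z => time_deriv psi z.1 z.2)};
  C12_derivable_x : forall i z, strip T z ->
    derivable (psi z.1) z.2 (basis_vec R i);
  C12_cont_x : forall i, {within strip T, continuous (fun z =>
    'D_(basis_vec R i) (psi z.1) z.2)};
  C12_derivable_xx : forall i j z, strip T z ->
    derivable ('D_(basis_vec R i) (psi z.1)) z.2 (basis_vec R j);
  C12_cont_xx : forall i j, {within strip T, continuous (fun z =>
    'D_(basis_vec R j) ('D_(basis_vec R i) (psi z.1)) z.2)} }.

Definition test_function (R : realType) (n : nat) (T : \bar R)
    (psi : R -> 'rV[R]_n -> R) : Prop :=
  C12 T psi /\
  exists K : set (R * 'rV[R]_n)%type, [/\ compact K, K `<=` strip T &
    forall z, strip T z -> ~ K z -> psi z.1 z.2 = 0].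

(* I_alpha(|u|^p) |u|^q, with the library convention +oo * 0 = 0 where the
   potential is infinite and u vanishes. *)
Definition source (R : realType) (n : nat) (p q alpha : R)
    (u : R -> 'rV[R]_n -> R) (z : R * 'rV[R]_n) : \bar R :=
  (riesz_potential alpha (fun y => `|u z.1 y| `^ p)%R z.2 *
   (`|u z.1 z.2| `^ q)%:E)%E.

(* The integrals over time and space are Lebesgue integrals over the product
   (0,tau) x R^n. *)
Definition weak_identity (R : realType) (n : nat) (p q alpha beta : R)
    (u0 : 'rV[R]_n -> R) (u psi : R -> 'rV[R]_n -> R) (tau : R) : Prop :=
  let mu := lebesgue_rV R n in
  let Q : set (R * 'rV[R]_n)%type := [set z | 0 < z.1 < tau] in
  let f1 x := (u tau x * psi tau x)%:E in
  let f2 x := (u0 x * psi 0 x)%:E in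
  let f3 z := (source p q alpha u z * (psi z.1 z.2)%:E)%E in
  let f4 z := (u z.1 z.2 * fraclap beta (psi z.1) z.2)%:E in
  let f5 z := (u z.1 z.2 * time_deriv psi z.1 z.2)%:E in
  [/\ Lintegrable mu setT f1, Lintegrable mu setT f2,
      [/\ Lintegrable (lebesgue_tx R n) Q f3,
          Lintegrable (lebesgue_tx R n) Q f4 &
          Lintegrable (lebesgue_tx R n) Q f5] &
      (\int[mu]_x f1 x - \int[mu]_x f2 x =
       \int[lebesgue_tx R n]_(z in Q) f3 z
       - \int[lebesgue_tx R n]_(z in Q) f4 z
       + \int[lebesgue_tx R n]_(z in Q) f5 z)%E].

Definition weak_solution (R : realType) (n : nat) (p q alpha beta : R)
    (u0 : 'rV[R]_n -> R) (T : \bar R) (u : R -> 'rV[R]_n -> R) : Prop :=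
  [/\ L1loc_strip T (fun z => (u z.1 z.2)%:E),
      L1loc_strip T (source p q alpha u) &
      forall (psi : R -> 'rV[R]_n -> R) (tau : R),
        test_function T psi -> 0 <= tau -> (tau%:E < T)%E ->
        weak_identity p q alpha beta u0 u psi tau].

Definition global_weak_solution (R : realType) (n : nat) (p q alpha beta : R)
    (u0 : 'rV[R]_n -> R) (u : R -> 'rV[R]_n -> R) : Prop :=
  weak_solution p q alpha beta u0 +oo%E u.

(* Main.v *)
(** Test functions are psi = (1 - t/tau)_+^4 Phi(x) with tau = rho^beta and Phi close
    to (1 + |x|/rho)^-(n+beta) (for beta = 2, a single bump of radius rho). Put
    r = p + q > 2. On a dyadic shell A of diameter d, (-Delta)^(beta/2) psi and psi_t
    are at most b psi^(1/r), while I_alpha(|u|^p) >= A_alpha d^(alpha-n) int_A |u|^p.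
    By Cauchy-Schwarz and Young, b int_A |u| psi^(1/r) is at most a constant plus half
    of int_A I_alpha(|u|^p) |u|^q psi, and the latter is absorbed by the source term.
    The constants form a geometric series over the shells; what lies beyond finitely
    many shells is small, since testing with a bump shows that
    |u| |x|^-(n+beta) is integrable at infinity over bounded times. Hence
      int u0 phi <= C rho^(n - (alpha+beta)/(r-1)) + delta
    for all rho, delta > 0 and some phi with bump_rho <= phi <= 1. Letting rho tend to
    infinity, the right-hand side vanishes under the hypotheses of (i), whereas the
    left-hand side tends to int u0 > 0; in (ii) it is at least c rho^(n-gamma), which
    eventually exceeds the right-hand side. *)

Require Import Defs.
From mathcomp Require Import all_boot all_order all_algebra.
From mathcomp Require Import all_classical all_reals all_analysis.
From mathcomp Require Import measurable_realfun ring lra.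
Set Implicit Arguments.
Unset Strict Implicit.
Unset Printing Implicit Defensive.
Import Order.TTheory GRing.Theory Num.Theory.
Import numFieldNormedType.Exports.
Local Open Scope classical_set_scope.
Local Open Scope ring_scope.

(** * The nonlinear inequality on one shell *)

(** The definition of weak solution admits only compactly supported test functions, while for beta <
    2 [fraclap] of such a function does not vanish outside its support, so a bound by a multiple of
    psi^(1/r) fails there. The test functions are therefore long sums of bumps: the bound holds on
    all but the outermost region, with constants independent of the number of summands, and the rest
    is a tail. Its smallness comes with no rate, which forces the order of choices: rho and delta
    first, then the number of bumps. Only r = p + q matters, because Cauchy-Schwarz is applied to
    |u|^(p/2) and |u|^(q/2) psi^(1/2), whose product is the power r/2 of |u| psi^(1/r); r > 2 puts
    this power above the first. The choice tau = rho^beta makes the two linear terms scale alike.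
    Absorbing half of the source term requires its integral to be finite, which is part of the weak
    formulation. The solution is only a.e. equal to a Borel function, so the estimates are made for
    a Borel representative [v]; as the potential is nonlocal, this replacement is justified slice by
    slice. *)

Section cauchy_schwarz.
Context d (T : measurableType d) (R : realType) (mu : {measure set T -> \bar R}).
Local Open Scope ereal_scope.

(* Symmetrising the double integral of [h x * h y] reduces this to AM-GM. *)
Lemma ge0_cauchy_schwarz (A : set T) (f g h : T -> R) :
  measurable A ->
  measurable_fun A f -> measurable_fun A g -> measurable_fun A h ->
  (forall x, (0 <= f x)%R) -> (forall x, (0 <= g x)%R) ->
  (forall x, (0 <= h x)%R) -> (forall x, (h x ^+ 2 = f x * g x)%R) ->
  (\int[mu]_(x in A) (h x)%:E) * (\int[mu]_(x in A) (h x)%:E) <=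
  (\int[mu]_(x in A) (f x)%:E) * (\int[mu]_(x in A) (g x)%:E).
Proof.
move=> mA mf mg mh f0 g0 h0 hfg.
have ZlD (k l : \bar R) (u v : T -> R) : 0 <= k -> 0 <= l ->
    measurable_fun A u -> measurable_fun A v ->
    (forall x, (0 <= u x)%R) -> (forall x, (0 <= v x)%R) ->
    k * (\int[mu]_(x in A) (u x)%:E) + l * (\int[mu]_(x in A) (v x)%:E) =
    \int[mu]_(x in A) (k * (u x)%:E + l * (v x)%:E).
  move=> k0 l0 mu' mv u0 v0.
  rewrite ge0_integralD//; last 4 first.
  - by move=> x _; rewrite mule_ge0// lee_fin.
  - by apply: emeasurable_funM => //; exact/measurable_EFinP.
  - by move=> x _; rewrite mule_ge0// lee_fin.
  - by apply: emeasurable_funM => //; exact/measurable_EFinP.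
  by rewrite !ge0_integralZl//;
    try (exact/measurable_EFinP); move=> x _; rewrite lee_fin.
set P := \int[mu]_(x in A) (f x)%:E; set Q := \int[mu]_(x in A) (g x)%:E.
set X := \int[mu]_(x in A) (h x)%:E.
have P0 : 0 <= P by apply: integral_ge0 => x _; rewrite lee_fin.
have Q0 : 0 <= Q by apply: integral_ge0 => x _; rewrite lee_fin.
have X0 : 0 <= X by apply: integral_ge0 => x _; rewrite lee_fin.
have half0 : 0 <= (2^-1 : R)%:E by rewrite lee_fin.
have amgm x y : ((h x * h y) <= 2^-1 * f x * g y + 2^-1 * g x * f y)%R.
  rewrite -!mulrA -mulrDr ler_pdivlMl// -ler_sqr ?nnegrE; last 2 first.
  - by rewrite !mulr_ge0.
  - by rewrite addr_ge0// mulr_ge0.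
  rewrite exprMn exprMn !hfg -subr_ge0.
  rewrite (_ : _ - _ = (f x * g y - g x * f y) ^+ 2)%R ?sqr_ge0//; ring.
have inner x : (h x)%:E * X <= (2^-1 * f x)%:E * Q + (2^-1 * g x)%:E * P.
  rewrite -[leLHS]adde0 -(mul0e X) !ZlD//; rewrite ?lee_fin ?mulr_ge0//.
  apply: ge0_le_integral => //.
  - by move=> y _; rewrite mul0e adde0 -EFinM lee_fin mulr_ge0.
  - by apply: emeasurable_funD; apply: emeasurable_funM => //; exact/measurable_EFinP.
  - by apply: emeasurable_funD; apply: emeasurable_funM => //; exact/measurable_EFinP.
  - by move=> y _; rewrite mul0e adde0 -!EFinM -EFinD lee_fin.
have -> : P * Q = ((2^-1 : R)%:E * Q) * P + ((2^-1 : R)%:E * P) * Q.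
  rewrite -!muleA (muleC Q P) -ge0_muleDl//.
  by rewrite -EFinD (_ : 2^-1 + 2^-1 = 1 :> R)%R ?mul1e//; lra.
rewrite -[leLHS]adde0 -(mul0e X) !ZlD// ?mule_ge0//.
apply: ge0_le_integral => //.
- by move=> y _; rewrite mul0e adde0 mule_ge0// lee_fin.
- by apply: emeasurable_funD; apply: emeasurable_funM => //; exact/measurable_EFinP.
- by apply: emeasurable_funD; apply: emeasurable_funM => //; exact/measurable_EFinP.
move=> y _; rewrite mul0e adde0 muleC; apply: le_trans (inner y) _.
by rewrite !EFinM -!muleA (muleC Q) (muleC P).
Qed.

End cauchy_schwarz.

Section shell_inequality.
Context d (T : measurableType d) (R : realType) (mu : {measure set T -> \bar R}).
Variables (p q : R) (p0 : 0 < p) (q0 : 0 < q) (pq : 2 < p + q).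

Let powR_interp (s a : R) : 0 < s -> 0 <= a ->
  a <= s + s `^ (1 - (p + q) / 2) * a `^ ((p + q) / 2).
Proof.
move=> s0 a0; have [as_|sa] := leP a s.
  by rewrite (le_trans as_)// lerDl mulr_ge0// powR_ge0.
have a0' : 0 < a by exact: lt_trans sa.
rewrite (@le_trans _ _ (s `^ (1 - (p + q) / 2) * a `^ ((p + q) / 2)))//; last first.
  by rewrite lerDr ltW.
have -> : a `^ ((p + q) / 2) = a * a `^ ((p + q) / 2 - 1).
  by rewrite -[X in X * powR _ _](powRr1 a0) -powRD ?(gt_eqF a0') ?implybT//; congr (_ `^ _); lra.
rewrite mulrCA ler_peMr//.
have -> : 1 - (p + q) / 2 = - ((p + q) / 2 - 1) by ring.
rewrite powRN mulrC ler_pdivlMr ?powR_gt0// mul1r.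
by have r2 := pq; apply: ge0_ler_powR; rewrite ?nnegrE; lra.
Qed.

(* With r = p + q, write [a <= s + s^(1 - r/2) a^(r/2)] and bound the integral of
   a^(r/2) by Cauchy-Schwarz; [s^(r-1) = b / (c m)] makes AM-GM absorb the
   product term with the factor [1/2] below. *)
Definition shell_const (b c m : R) :=
  3 / 2 * b * m * (b / (c * m)) `^ (p + q - 1)^-1.

Local Open Scope ereal_scope.

(** In use, [v] is a time slice of the solution, [W] the test function, [M] a majorant of the linear
    terms, [m] a bound for the measure of the shell and [c] a lower bound for the Riesz kernel on
    it. The last term is then at most half of the source integral over [A]. *)
Lemma shell_inequality (A : set T) (v W M : T -> R) (b c m : R) :
  measurable A -> measurable_fun A v -> measurable_fun A W ->
  measurable_fun A M ->
  (forall x, (0 <= W x)%R) -> (forall x, (0 <= M x)%R) ->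
  (0 < b)%R -> (0 < c)%R -> (0 < m)%R -> mu A <= m%:E ->
  (forall x, A x -> (M x <= b * W x `^ (p + q)^-1)%R) ->
  \int[mu]_(x in A) (`|v x| * M x)%:E <=
  (shell_const b c m)%:E + (2^-1 : R)%:E * (c%:E *
   (\int[mu]_(x in A) (`|v x| `^ p)%:E *
    \int[mu]_(x in A) (`|v x| `^ q * W x)%:E)).
Proof.
move=> mA mv mW mM W0 M0 b0 c0 m0 Am MW.
pose s := ((b / (c * m)) `^ (p + q - 1)^-1)%R.
have s0 : (0 < s)%R by rewrite powR_gt0// divr_gt0// mulr_gt0.
have r0 : (0 < p + q)%R by rewrite addr_gt0.
pose a x := (`|v x| * W x `^ (p + q)^-1)%R.
have a0 x : (0 <= a x)%R by rewrite mulr_ge0// powR_ge0.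
have mpow (f : T -> R) (e : R) : measurable_fun A f ->
    measurable_fun A (fun x => (f x `^ e)%R).
  by move=> mf; exact: (measurableT_comp (measurable_powR e)).
have mnv : measurable_fun A (fun x => `|v x|%R) by exact: measurableT_comp.
have ma : measurable_fun A a by apply: measurable_funM => //; exact: mpow.
pose h x := (a x `^ ((p + q) / 2))%R.
have h0 x : (0 <= h x)%R by exact: powR_ge0.
have mh : measurable_fun A h by exact: mpow.
set P := \int[mu]_(x in A) (`|v x| `^ p)%:E.
set Q := \int[mu]_(x in A) (`|v x| `^ q * W x)%:E.
have CS := @ge0_cauchy_schwarz _ _ _ mu A (fun x => `|v x| `^ p)%R
  (fun x => `|v x| `^ q * W x)%R h mA.
set X := \int[mu]_(x in A) (h x)%:E.
have {}CS : X * X <= P * Q.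
  apply: CS => //.
  - exact: mpow.
  - by apply: measurable_funM => //; exact: mpow.
  - by move=> x; rewrite mulr_ge0// powR_ge0.
  - move=> x; rewrite /h -powR_mulrn ?powR_ge0// -powRrM.
    rewrite (_ : (p + q) / 2 * 2%:R = p + q)%R; last by field.
    rewrite /a powRM// ?powR_ge0// -powRrM mulVf ?gt_eqF// powRr1//.
    by rewrite powRD ?mulrA//; apply/implyP; rewrite gt_eqF.
have X0 : 0 <= X by apply: integral_ge0 => x _; rewrite lee_fin.
have step1 : \int[mu]_(x in A) (`|v x| * M x)%:E <=
    (b * s * m)%:E + (b * s `^ (1 - (p + q) / 2))%:E * X.
  apply: (@le_trans _ _ (\int[mu]_(x in A)
    ((b * s)%:E + (b * s `^ (1 - (p + q) / 2))%:E * (h x)%:E))).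
    apply: ge0_le_integral => //.
    - by move=> x _; rewrite lee_fin mulr_ge0.
    - by apply/measurable_EFinP; apply: measurable_funM.
    - apply: emeasurable_funD; first exact: measurable_cst.
      apply: emeasurable_funM; first exact: measurable_cst.
      exact/measurable_EFinP.
    - move=> x Ax; rewrite -EFinM -EFinD lee_fin.
      apply: (@le_trans _ _ (b * a x)%R).
        by rewrite /a mulrCA ler_wpM2l// MW.
      by rewrite -mulrA -mulrDr ler_pM2l// powR_interp.
  rewrite ge0_integralD//; last 3 first.
  - by move=> x _; rewrite lee_fin mulr_ge0// ltW.
  - by move=> x _; rewrite -EFinM lee_fin !mulr_ge0 ?powR_ge0// ltW.
  - apply: emeasurable_funM; first exact: measurable_cst.
    exact/measurable_EFinP.
  rewrite ge0_integralZl//; last 3 first.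
  - exact/measurable_EFinP.
  - by move=> x _; rewrite lee_fin.
  - by rewrite lee_fin mulr_ge0 ?powR_ge0// ltW.
  rewrite leeD2r// integral_cst// [leRHS]EFinM lee_wpmul2l//.
  by rewrite lee_fin mulr_ge0// ltW.
apply: (le_trans step1).
(* If [X] is infinite, Cauchy-Schwarz makes the right-hand side infinite as well. *)
have [Xfin|] := boolP (X \is a fin_num); last first.
  rewrite ge0_fin_numE// -leNgt leye_eq => /eqP XE.
  have -> : P * Q = +oo.
    by apply/eqP; rewrite -leye_eq (le_trans _ CS)// XE mulyy.
  by rewrite gt0_muley ?lte_fin// gt0_muley ?lte_fin// addey// leey.
apply: (@le_trans _ _ ((shell_const b c m)%:E + (2^-1 : R)%:E * (c%:E * (X * X)))); last first.
  rewrite leeD2l// lee_wpmul2l ?lee_fin// lee_wpmul2l ?lee_fin//.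
  exact: ltW.
rewrite -(fineK Xfin) -!EFinM -!EFinD lee_fin.
set Y := fine X.
have r2 := pq.
rewrite /shell_const -/s.
have key : (s `^ (1 - (p + q) / 2) ^+ 2 = s * (c * m / b))%R.
  rewrite -powR_mulrn ?powR_ge0// -powRrM.
  rewrite (_ : (1 - (p + q) / 2) * 2%:R = 1 + - (p + q - 1))%R; last by field.
  rewrite powRD; last by rewrite (gt_eqF s0) implybT.
  rewrite powRr1 ?ltW// powRN /s -powRrM mulVf; last by lra.
  by rewrite powRr1 ?invf_div// divr_ge0 ?mulr_ge0// ltW.
set t := (s `^ (1 - (p + q) / 2))%R in key *.
(* AM-GM in the form b t Y <= b^2 t^2 / (2 c) + c Y^2 / 2. By [key] the first summand is b s m / 2;
   added to the b s m of [step1] it explains the factor 3/2 in [shell_const]. *)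
have : (0 <= (b * t - c * Y) ^+ 2 / (2 * c))%R.
  by rewrite divr_ge0 ?sqr_ge0// mulr_ge0// ltW.
have -> : ((b * t - c * Y) ^+ 2 / (2 * c) =
   b ^+ 2 * t ^+ 2 / (2 * c) - b * t * Y + 2^-1 * (c * (Y * Y)))%R.
  by field; rewrite gt_eqF.
rewrite key.
have -> : (b ^+ 2 * (s * (c * m / b)) / (2 * c) = b * s * m / 2)%R.
  by field; rewrite !gt_eqF.
lra.
Qed.

End shell_inequality.

(** * Integrals of powers of a norm near the origin and near infinity *)

Section integral_of_powers.
Context d (T : measurableType d) (R : realType) (mu : {measure set T -> \bar R}).
Variables (N : T -> R) (mN : measurable_fun setT N).
Variables (n K : R) (K0 : 0 <= K).
Hypothesis growth : forall s, 0 < s ->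
  (mu [set x | (N x <= s)%R] <= (K * s `^ n)%:E)%E.

Let powR_shell (e s t : R) : 0 < s -> s / 2 < t <= s ->
  t `^ e <= 2 `^ `|e| * s `^ e.
Proof.
move=> s0 /andP[st ts]; have t0 : 0 < t by rewrite (lt_trans _ st)// divr_gt0.
have ln0 : 0 < ln (2 : R) by rewrite ln_gt0 ?ltr1n.
rewrite /powR !gt_eqF// -expRD ler_expR.
have : ln t <= ln s by rewrite ler_ln ?posrE.
have : ln s - ln 2 <= ln t.
  by rewrite -ln_div ?posrE// ler_ln ?posrE ?divr_gt0// ltW.
case: (lerP 0 e) => e0 l1 l2.
  by rewrite (le_trans (ler_wpM2l e0 l2))// lerDr mulr_ge0// ltW.
have := ler_wnM2l (ltW e0) l1; rewrite mulrBr => /le_trans; apply.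
by rewrite ltr0_norm// mulNr addrC.
Qed.

Let mshell (s : R) : measurable [set x | (s / 2 < N x <= s)%R].
Proof.
have -> : [set x | s / 2 < N x <= s] = N @^-1` `]s / 2, s]%classic.
  by apply/seteqP; split => x /=; rewrite in_itv.
by rewrite -[X in measurable X]setTI; exact: mN.
Qed.

(** On the shell of outer radius rho l^k the integrand is at most 2^|e| (rho l^k)^e and the measure
    at most K (rho l^k)^n, so the contributions are geometric with ratio l^(e+n). Taking l = 1/2
    treats a neighbourhood of the origin, l = 2 one of infinity. *)
Let shell_sum (rho l e : R) (D : set T) : 0 < rho -> 0 < l ->
  l `^ (e + n) < 1 -> measurable D ->
  (forall x, D x -> exists k, rho * l ^+ k / 2 < N x <= rho * l ^+ k) ->
  (\int[mu]_(x in D) (N x `^ e)%:E <=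
   (2 `^ `|e| * K * rho `^ (e + n) / (1 - l `^ (e + n)))%:E)%E.
Proof.
move=> rho0 l0 l1 mD cover.
pose S k := [set x | (rho * l ^+ k / 2 < N x <= rho * l ^+ k)%R].
have sk0 k : 0 < rho * l ^+ k by rewrite mulr_gt0// exprn_gt0.
pose c k := 2 `^ `|e| * (rho * l ^+ k) `^ e.
have c0 k : 0 <= c k by rewrite mulr_ge0// powR_ge0.
have mNe : measurable_fun D (fun x => (N x `^ e)%:E).
  apply/measurable_EFinP; apply: (measurableT_comp (measurable_powR e)).
  exact: measurable_funS mN.
apply: (@le_trans _ _ (\int[mu]_(x in D) \sum_(0 <= k <oo) (c k * \1_(S k) x)%:E)%E).
  apply: ge0_le_integral => //.
  - by move=> x _; rewrite lee_fin powR_ge0.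
  - apply: ge0_emeasurable_sum => [k x _ _|k _].
      by rewrite lee_fin mulr_ge0.
    apply/measurable_EFinP/measurable_funM => //.
    exact/measurable_indic/mshell.
  - move=> x Dx; have [k Skx] := cover x Dx.
    apply: (@le_trans _ _ (\sum_(0 <= i < k.+1) (c i * \1_(S i) x)%:E)%E).
      rewrite big_nat_recr//= (@le_trans _ _ (c k * \1_(S k) x)%:E)//.
        by rewrite indicE mem_set// mulr1 lee_fin powR_shell.
      by rewrite leeDr//; apply: sume_ge0 => i _; rewrite lee_fin mulr_ge0.
    by apply: nneseries_lim_ge => i _ _; rewrite lee_fin mulr_ge0.
rewrite integral_nneseries//; last 2 first.
- move=> k; apply/measurable_EFinP/measurable_funM => //.
  exact/measurable_indic/mshell.
- by move=> k x _; rewrite lee_fin mulr_ge0.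
pose a := 2 `^ `|e| * K * rho `^ (e + n).
have a0 : 0 <= a by rewrite !mulr_ge0// powR_ge0.
have term k : (\int[mu]_(x in D) (c k * \1_(S k) x)%:E <=
    (geometric a (l `^ (e + n)) k)%:E)%E.
  under eq_integral do rewrite EFinM.
  rewrite ge0_integralZl//; last 2 first.
  - by apply/measurable_EFinP/measurable_indic/mshell.
  - by rewrite lee_fin.
  rewrite integral_indic//; last exact: mshell.
  apply: (@le_trans _ _ ((c k)%:E * (K * (rho * l ^+ k) `^ n)%:E)%E).
    rewrite lee_wpmul2l ?lee_fin//.
    apply: le_trans (growth (sk0 k)); apply: le_measure; rewrite ?inE.
    - by apply: measurableI => //; exact: mshell.
    - rewrite (_ : [set x | _] = N @^-1` `]-oo, (rho * l ^+ k)]%classic); last first.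
        by apply/seteqP; split => x /=; rewrite in_itv.
      by rewrite -[X in measurable X]setTI; exact: mN.
    - by move=> x [/= /andP[]].
  rewrite -EFinM lee_fin /c /geometric/= /a.
  rewrite [leLHS](_ : _ = 2 `^ `|e| * K * ((rho * l ^+ k) `^ e * (rho * l ^+ k) `^ n)); last by ring.
  rewrite -powRD; last by rewrite (gt_eqF (sk0 k)) implybT.
  rewrite powRM ?exprn_ge0 ?(ltW l0) ?(ltW rho0)// -!mulrA.
  rewrite -(powR_mulrn _ (ltW l0)) -powRrM (mulrC k%:R) powRrM.
  by rewrite powR_mulrn ?powR_ge0.
apply: lime_le.
  by apply: is_cvg_nneseries => k _ _; apply: integral_ge0 => x _; rewrite lee_fin mulr_ge0.
near=> m.
apply: (@le_trans _ _ (\sum_(0 <= k < m) (geometric a (l `^ (e + n)) k)%:E)%E).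
  by apply: lee_sum => k _; exact: term.
rewrite sumEFin lee_fin; apply: geometric_le_lim => //; first by rewrite powR_gt0.
by rewrite ger0_norm ?powR_ge0.
Unshelve. all: by end_near. Qed.

Lemma integral_norm_powR_near (e rho : R) : 0 < rho -> 0 < e + n ->
  (\int[mu]_(x in [set x | (0 < N x <= rho)%R]) (N x `^ e)%:E <=
   (2 `^ `|e| * K / (1 - 2^-1 `^ (e + n)) * rho `^ (e + n))%:E)%E.
Proof.
move=> rho0 en0.
rewrite [X in X%:E](_ : _ =
  2 `^ `|e| * K * rho `^ (e + n) / (1 - 2^-1 `^ (e + n))); last by rewrite mulrAC.
apply: shell_sum => //.
- rewrite /powR gt_eqF// -[ltRHS]expR0 ltr_expR pmulr_rlt0// lnV ?posrE//.
  by rewrite oppr_lt0 ln_gt0// ltr1n.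
- have -> : [set x | 0 < N x <= rho] = N @^-1` `]0, rho]%classic.
    by apply/seteqP; split => x /=; rewrite in_itv.
  by rewrite -[X in measurable X]setTI; exact: mN.
- move=> x /= /andP[N0 Nrho].
  (* The least such [k] is taken: its minimality gives the upper bound N x <= rho 2^-k, which for k
     = 0 is the hypothesis. *)
  have ex : exists k, rho * 2^-1 ^+ k / 2 < N x.
    exists (Num.bound (rho / N x)).
    rewrite exprVn -!mulrA -invfM ltr_pdivrMr ?mulr_gt0 ?exprn_gt0//.
    rewrite mulrC -ltr_pdivrMr// (lt_trans (archi_boundP _)) ?divr_ge0 ?ltW//.
    by rewrite -exprSr -natrX ltr_nat (leq_trans (ltn_expl _ (ltnSn 1)))// leq_exp2l.
  case: (ex_minnP ex) => k Hk kmin; exists k; rewrite Hk/=.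
  case: k Hk kmin => [|k] Hk kmin; first by rewrite expr0 mulr1.
  rewrite leNgt; apply/negP => lt; have := kmin k; rewrite ltnn.
  by rewrite exprSr mulrA in lt; move=> /(_ lt).
Qed.

Lemma integral_norm_powR_far (e rho : R) : 0 < rho -> e + n < 0 ->
  (\int[mu]_(x in [set x | (rho < N x)%R]) (N x `^ e)%:E <=
   (2 `^ `|e| * K * 2 `^ (e + n) / (1 - 2 `^ (e + n)) * rho `^ (e + n))%:E)%E.
Proof.
move=> rho0 en0.
rewrite [X in X%:E](_ : _ =
  2 `^ `|e| * K * (rho * 2) `^ (e + n) / (1 - 2 `^ (e + n))); last first.
  by rewrite powRM// 1?ltW//; ring.
apply: shell_sum => //.
- by rewrite mulr_gt0.
- by rewrite /powR gt_eqF// -[ltRHS]expR0 ltr_expR nmulr_rlt0// ln_gt0// ltr1n.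
- have -> : [set x | rho < N x] = N @^-1` `]rho, +oo[%classic.
    by apply/seteqP; split => x /=; rewrite in_itv/= andbT.
  by rewrite -[X in measurable X]setTI; exact: mN.
- move=> x /= Nrho.
  have ex : exists k, N x <= rho * 2 * 2 ^+ k.
    exists (Num.bound (N x / rho)).
    have Nx0 : 0 <= N x by rewrite (le_trans (ltW rho0))// ltW.
    rewrite -mulrA -ler_pdivrMl// mulrC.
    rewrite (le_trans (ltW (archi_boundP _)))// ?divr_ge0// ?(ltW rho0)//.
    by rewrite -exprS -natrX ler_nat (leq_trans (ltnW (ltn_expl _ (ltnSn 1))))// leq_exp2l.
  case: (ex_minnP ex) => k Hk kmin; exists k; rewrite Hk/= andbT.
  case: k Hk kmin => [|k] Hk kmin; first by rewrite expr0 mulr1 mulfK.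
  rewrite ltNge; apply/negP => le; have := kmin k; rewrite ltnn.
  by rewrite exprSr mulrA mulfK// in le; move=> /(_ le).
Qed.

End integral_of_powers.

(** The real-valued integral turns an infinite value into 0, so finiteness has to be proved along
    with a positive lower bound. *)
Lemma Gamma_gt0 (R : realType) (x : R) : 0 < x -> 0 < Gamma x.
Proof.
move=> x0; rewrite /Gamma.
have -> : Num.min 0 (Num.floor x) = 0.
  by apply/min_idPl; rewrite floor_ge0 ltW.
rewrite big_ord0 divr1 addr0.
pose f (t : R) := t `^ (x - 1) * expR (- t).
have f0 t : 0 <= f t by rewrite mulr_ge0 ?powR_ge0 ?expR_ge0.
have mf : measurable_fun setT f.
  apply: measurable_funM; first exact: measurable_powR.
  by apply: measurableT_comp; [exact: measurable_expR|exact: measurable_funN].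
have mfE D : measurable D -> measurable_fun D (EFin \o f).
  by move=> mD; apply/measurable_EFinP; exact: measurable_funTS.
have growth (s : R) : 0 < s ->
    (@lebesgue_measure R [set t : R | (`|t| <= s)%R] <= (2 * s `^ 1)%:E)%E.
  move=> s0; rewrite powRr1 ?(ltW s0)//.
  have -> : [set t : R | `|t| <= s] = `[- s, s]%classic.
    by apply/seteqP; split => t /=; rewrite in_itv/= ler_norml.
  by rewrite lebesgue_measure_itv/= lte_fin gtrN// -EFinD lee_fin; lra.
have mN : measurable_fun setT (fun t : R => `|t|) by exact: normr_measurable.
have near1 e := integral_norm_powR_near (mu := @lebesgue_measure R) (e := e) mN (ler0n _ 2) growth ltr01.
have far1 e := integral_norm_powR_far (mu := @lebesgue_measure R) (e := e) mN (ler0n _ 2) growth ltr01.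
have itv_setU : `]0%R, +oo[%classic = [set t : R | 0 < `|t| <= 1] `&` `]0%R, +oo[%classic
    `|` [set t : R | 1 < `|t|] `&` `]0%R, +oo[%classic :> set R.
  apply/seteqP; split => t /=.
    by rewrite in_itv/= andbT => t0; rewrite gtr0_norm// t0/=; case: (leP t 1); [left|right].
  by case=> -[].
have mA : measurable ([set t : R | 0 < `|t| <= 1]).
  rewrite (_ : [set t | _] = (fun t : R => `|t|) @^-1` `]0, 1]%classic).
    by rewrite -[X in measurable X]setTI; exact: mN.
  by apply/seteqP; split => t /=; rewrite in_itv.
have mB : measurable ([set t : R | 1 < `|t|]).
  rewrite (_ : [set t | _] = (fun t : R => `|t|) @^-1` `]1, +oo[%classic).
    by rewrite -[X in measurable X]setTI; exact: mN.
  by apply/seteqP; split => t /=; rewrite in_itv/= andbT.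
have fin : (\int[@lebesgue_measure R]_(t in `]0%R, +oo[) (f t)%:E < +oo)%E.
  rewrite itv_setU ge0_integral_setU//=; last 5 first.
  - exact: measurableI.
  - exact: measurableI.
  - by apply: mfE; apply: measurableU; exact: measurableI.
  - by move=> t _; rewrite lee_fin.
  - apply/disj_setPS => t [[/= /andP[_ t1] _] [/= t2 _]].
    by move: t2; rewrite ltNge t1.
  rewrite lte_add_pinfty//.
    apply: (@le_lt_trans _ _ (\int[@lebesgue_measure R]_(t in [set t : R | (0 < `|t| <= 1)%R])
        (`|t| `^ (x - 1))%:E)%E); last first.
      by apply: le_lt_trans (near1 (x - 1) _) _; rewrite ?ltry// subrK.
    apply: (@le_trans _ _ (\int[@lebesgue_measure R]_(t in [set t : R | (0 < `|t| <= 1)%R] `&` `]0%R, +oo[%classic)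
        (`|t| `^ (x - 1))%:E)%E).
      apply: ge0_le_integral => //.
      - exact: measurableI.
      - by move=> t _; rewrite lee_fin.
      - by apply: mfE; exact: measurableI.
      - apply/measurable_EFinP; apply: (measurableT_comp (measurable_powR _)).
        exact: measurable_funTS.
      - move=> t [_ /=]; rewrite in_itv/= andbT => t0.
        rewrite lee_fin gtr0_norm// /f ler_piMr ?powR_ge0//.
        by rewrite -expR0 ler_expR oppr_le0 ltW.
    apply: ge0_subset_integral => //.
    - exact: measurableI.
    - apply/measurable_EFinP; apply: (measurableT_comp (measurable_powR _)).
      exact: measurable_funTS.
  (* Since exp t >= t^(k+1) / (k+1)! and x < k, the integrand is at most (k+1)! t^-2 for t > 1. *)
  pose k := Num.bound x.
  apply: (@le_lt_trans _ _ (\int[@lebesgue_measure R]_(t in [set t : R | (1 < `|t|)%R])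
      (((k.+1)`!%:R)%:E * (`|t| `^ (- 2))%:E))%E); last first.
    rewrite ge0_integralZl//; last first.
      apply/measurable_EFinP; apply: (measurableT_comp (measurable_powR _)).
      exact: measurable_funTS.
    rewrite lte_mul_pinfty//.
    by apply: le_lt_trans (far1 (- 2) _) _; rewrite ?ltry//; lra.
  apply: (@le_trans _ _ (\int[@lebesgue_measure R]_(t in [set t : R | (1 < `|t|)%R] `&` `]0%R, +oo[%classic)
      (((k.+1)`!%:R)%:E * (`|t| `^ (- 2))%:E))%E).
    apply: ge0_le_integral => //.
    - exact: measurableI.
    - by move=> t _; rewrite lee_fin.
    - by apply: mfE; exact: measurableI.
    - apply: emeasurable_funM => //.
      apply/measurable_EFinP; apply: (measurableT_comp (measurable_powR _)).
      exact: measurable_funTS.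
    - move=> t [/= t1]; rewrite in_itv/= andbT => t0.
      rewrite -EFinM lee_fin; rewrite gtr0_norm// in t1 *.
      rewrite /f expRN ler_pdivrMr ?expR_gt0// mulrAC.
      have e1 : t ^+ k.+1 / (k.+1)`!%:R <= expR t.
        by apply: le_trans (expR_ge1Dxn k (ltW t0)); rewrite lerDr.
      rewrite ler_pdivrMr ?ltr0n ?fact_gt0// in e1.
      rewrite mulrC in e1.
      apply: le_trans (ler_wpM2r (powR_ge0 _ _) e1).
      rewrite -powR_mulrn ?(ltW t0)// -powRD; last by rewrite (gt_eqF t0) implybT.
      rewrite ler_powR ?(ltW t1)//.
      have := archi_boundP (ltW x0); rewrite -/k -natr1; lra.
  apply: ge0_subset_integral => //.
  - exact: measurableI.
  - apply: emeasurable_funM => //.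
    apply/measurable_EFinP; apply: (measurableT_comp (measurable_powR _)).
    exact: measurable_funTS.
rewrite /Rintegral fine_gt0// fin andbT.
(* On [1, 2] the power is monotone, increasing or decreasing according to the sign of x - 1; the
   minimum covers both cases. *)
apply: (@lt_le_trans _ _ (\int[@lebesgue_measure R]_(t in `[1%R, 2%R]) (expR (- 2) * Num.min 1 (2 `^ (x - 1)))%:E)%E).
  rewrite integral_cst//= lebesgue_measure_itv/= lte_fin ltr1n -EFinD.
  by rewrite mule_gt0 ?lte_fin ?subr_gt0 ?ltr1n//.
apply: (@le_trans _ _ (\int[@lebesgue_measure R]_(t in `[1%R, 2%R]) (f t)%:E)%E).
  apply: ge0_le_integral => //.
  - exact: mfE.
  - move=> t /=; rewrite in_itv/= => /andP[t1 t2]; rewrite lee_fin /f mulrC.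
    apply: ler_pM; rewrite ?expR_ge0//.
    + have [x1|x1] := lerP 1 x.
        rewrite ge_min; apply/orP; left.
        by rewrite -[leLHS](powRr0 t) ler_powR// subr_ge0.
      rewrite ge_min; apply/orP; right.
      rewrite -(opprB 1 x) !powRN lef_pV2 ?posrE ?powR_gt0//; last by lra.
      by apply: ge0_ler_powR; rewrite ?nnegrE; lra.
    + by rewrite ler_expR lerN2.
apply: ge0_subset_integral => //.
- exact: mfE.
- by move=> t _; rewrite lee_fin.
- by move=> t /=; rewrite !in_itv/= andbT => /andP[t1 _]; rewrite (lt_le_trans _ t1).
Qed.

(** * Lebesgue measure and the Euclidean norm *)

Section euclidean_norm.
Context {R : realType} {n : nat}.
Implicit Types x y z : 'rV[R]_n.

Lemma enorm_ge0 x : 0 <= enorm x. Proof. exact: sqrtr_ge0. Qed.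

Lemma enorm_sqr x : enorm x ^+ 2 = \sum_i x 0 i ^+ 2.
Proof. by rewrite sqr_sqrtr// sumr_ge0// => i _; exact: sqr_ge0. Qed.

Lemma enormN x : enorm (- x) = enorm x.
Proof. by rewrite /enorm; under eq_bigr do rewrite mxE sqrrN. Qed.

Lemma enormC x y : enorm (x - y) = enorm (y - x).
Proof. by rewrite -enormN opprB. Qed.

Lemma coord_le_enorm x i : `|x 0 i| <= enorm x.
Proof.
rewrite -ler_sqr ?nnegrE ?enorm_ge0// enorm_sqr real_normK ?num_real//.
by rewrite (bigD1 i)//= lerDl sumr_ge0// => j _; exact: sqr_ge0.
Qed.

Lemma enorm_eq0 x : enorm x = 0 -> x = 0.
Proof.
move=> x0; apply/rowP => i; rewrite mxE.
by apply/eqP; rewrite -normr_le0 -x0 coord_le_enorm.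
Qed.

Lemma enorm_gt0 x : x != 0 -> 0 < enorm x.
Proof.
move=> x0; rewrite lt_def enorm_ge0 andbT.
by apply: contra x0 => /eqP/enorm_eq0 ->.
Qed.

Lemma enorm_le_coord x s : 0 <= s -> (forall i, `|x 0 i| <= s) ->
  enorm x <= n%:R * s.
Proof.
move=> s0 xs; rewrite -ler_sqr ?nnegrE ?enorm_ge0 ?mulr_ge0// enorm_sqr.
apply: (@le_trans _ _ (\sum_(i < n) s ^+ 2)).
  apply: ler_sum => i _; rewrite -real_normK ?num_real//.
  by rewrite ler_sqr ?nnegrE.
rewrite sumr_const card_ord -[leLHS]mulr_natl exprMn ler_wpM2r ?sqr_ge0//.
by rewrite expr2 -natrM ler_nat; case: n => // k; rewrite leq_pmulr.
Qed.

(** The difference of the two sides is |x + y|^2. This serves in place of the triangle inequality;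
    the loss only affects constants. *)
Lemma enormB_sqr_le x y : enorm (x - y) ^+ 2 <= 2 * enorm x ^+ 2 + 2 * enorm y ^+ 2.
Proof.
rewrite !enorm_sqr !mulr_sumr -big_split/=; apply: ler_sum => i _.
rewrite !mxE -subr_ge0.
rewrite (_ : _ - _ = (x 0 i + y 0 i) ^+ 2) ?sqr_ge0//; ring.
Qed.

Lemma enormB_le2 x y r : enorm x <= r -> enorm y <= r -> enorm (x - y) <= 2 * r.
Proof.
move=> xr yr; have r0 := le_trans (enorm_ge0 x) xr.
rewrite -ler_sqr ?nnegrE ?enorm_ge0 ?mulr_ge0//.
apply: le_trans (enormB_sqr_le x y) _.
have x2 : enorm x ^+ 2 <= r ^+ 2 by rewrite lerXn2r ?nnegrE ?enorm_ge0.
have y2 : enorm y ^+ 2 <= r ^+ 2 by rewrite lerXn2r ?nnegrE ?enorm_ge0.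
by rewrite exprMn; lra.
Qed.

Lemma dot_le_enorm x y : `|\sum_i x 0 i * y 0 i| <= n%:R * (enorm x * enorm y).
Proof.
apply: le_trans (ler_norm_sum _ _ _) _.
apply: (@le_trans _ _ (\sum_(i < n) enorm x * enorm y)).
  by apply: ler_sum => i _; rewrite normrM ler_pM ?coord_le_enorm.
by rewrite sumr_const card_ord -[leLHS]mulr_natl.
Qed.

Lemma enormD_sqr x z :
  enorm (x + z) ^+ 2 = enorm x ^+ 2 + 2 * \sum_i x 0 i * z 0 i + enorm z ^+ 2.
Proof.
rewrite !enorm_sqr !mulr_sumr -!big_split/=; apply: eq_bigr => i _.
by rewrite !mxE; ring.
Qed.

End euclidean_norm.

Section measure_rV.
Context {R : realType} {n : nat}.

Lemma measurable_fun_enorm d (T : measurableType d) (D : set T) (f : T -> 'rV[R]_n) :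
  measurable_fun D f -> measurable_fun D (fun x => enorm (f x)).
Proof.
move=> mf.
apply: (measurableT_comp (continuous_measurable_fun (@sqrt_continuous R))).
apply: measurable_sum => i; apply: measurable_funX.
exact: (measurableT_comp (measurable_coor i)).
Qed.

Lemma measurable_fun_rVB d (T : measurableType d) (f g : T -> 'rV[R]_n) :
  measurable_fun setT f -> measurable_fun setT g ->
  measurable_fun setT (fun x => f x - g x).
Proof.
move=> mf mg; apply: measurable_fun_coorP => i.
rewrite (_ : (fun _ => _) = (fun x => f x 0 i - g x 0 i)); last first.
  by apply/funext => x; rewrite !mxE.
by apply: measurable_funB; exact: (measurableT_comp (measurable_coor i)).
Qed.

Lemma measurable_fun_enormB (x : 'rV[R]_n) :
  measurable_fun setT (fun y : 'rV[R]_n => enorm (x - y)).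
Proof.
exact/measurable_fun_enorm/measurable_fun_rVB.
Qed.

Lemma measurable_enorm : measurable_fun setT (@enorm R n).
Proof. exact: measurable_fun_enorm. Qed.

Lemma measurable_box (a b : 'rV[R]_n) :
  measurable [set y : 'rV[R]_n | forall i, a 0 i <= y 0 i <= b 0 i].
Proof.
rewrite (_ : [set y | _] = \bigcap_(i in [set: 'I_n])
    ((fun y : 'rV[R]_n => y 0 i : measurableTypeR R) @^-1`
     `[a 0 i, b 0 i]%classic)); last first.
  by apply/seteqP; split => y /= H j => [_|]; have := H j; rewrite /= in_itv//; apply.
apply: fin_bigcap_measurable => // j _.
by rewrite -[X in measurable X]setTI; exact: measurable_coor.
Qed.

Lemma measurable_enorm_le (x : 'rV[R]_n) (s : R) :
  measurable [set y : 'rV[R]_n | enorm (x - y) <= s].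
Proof.
rewrite (_ : [set _ | _] = (fun y : 'rV[R]_n => enorm (x - y)) @^-1` `]-oo, s]%classic).
  by rewrite -[X in measurable X]setTI; exact: measurable_fun_enormB.
by apply/seteqP; split => y /=; rewrite in_itv.
Qed.

Lemma measurable_enorm_gt (x : 'rV[R]_n) (s : R) :
  measurable [set y : 'rV[R]_n | s < enorm (x - y)].
Proof.
rewrite (_ : [set _ | _] = ~` [set y : 'rV[R]_n | enorm (x - y) <= s]).
  by apply: measurableC; exact: measurable_enorm_le.
by apply/seteqP; split => y /=; rewrite ltNge => /negP.
Qed.

Lemma lebesgue_rV_ball_le (x : 'rV[R]_n) (s : R) : 0 < s ->
  (lebesgue_rV R n [set y : 'rV[R]_n | (enorm (x - y) <= s)%R] <=
   (2 ^+ n * s `^ n%:R)%:E)%E.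
Proof.
move=> s0; pose e : 'rV[R]_n := const_mx s.
apply: (@le_trans _ _ (lebesgue_rV R n [set y : 'rV[R]_n |
    forall i, ((x - e) 0 i <= y 0 i <= (x + e) 0 i)%R])).
  apply: le_measure; rewrite ?inE.
  - exact: measurable_enorm_le.
  - exact: measurable_box.
  - move=> y /= xys i; have := le_trans (coord_le_enorm (x - y) i) xys.
    by rewrite !mxE ler_norml; lra.
rewrite lebesgue_rV_box; last by move=> i; rewrite !mxE; lra.
rewrite lee_fin (eq_bigr (fun=> 2 * s)); last by move=> i _; rewrite !mxE; ring.
by rewrite prodr_const card_ord exprMn powR_mulrn// ltW.
Qed.

Lemma lebesgue_rV_set1 (x : 'rV[R]_n) : (0 < n)%N -> lebesgue_rV R n [set x] = 0%E.
Proof.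
move=> n0; rewrite (_ : [set x] = [set y : 'rV[R]_n | forall i, x 0 i <= y 0 i <= x 0 i]).
  rewrite lebesgue_rV_box// (bigD1 (Ordinal n0))//= subrr mul0r.
  by [].
apply/seteqP; split => y /= => [-> i|H]; first by rewrite lexx.
by apply/rowP => i; apply/esym/eqP; rewrite eq_le.
Qed.

End measure_rV.

Lemma lebesgue_rV_ball_ge (R : realType) (n : nat) (s : R) : (0 < n)%N -> 0 < s ->
  (((2 * s / n%:R) ^+ n)%:E <=
   lebesgue_rV R n [set y : 'rV[R]_n | (enorm (0 - y) <= s)%R])%E.
Proof.
move=> n0 s0; have nR0 : 0 < n%:R :> R by rewrite ltr0n.
have h0 : 0 < s / n%:R by rewrite divr_gt0.
pose e : 'rV[R]_n := const_mx (s / n%:R).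
have <- : lebesgue_rV R n [set y | forall i, (- e) 0 i <= y 0 i <= e 0 i] =
    ((2 * s / n%:R) ^+ n)%:E.
  rewrite lebesgue_rV_box; last by move=> i; rewrite !mxE; lra.
  rewrite (eq_bigr (fun=> 2 * s / n%:R)) ?prodr_const ?card_ord// => i _.
  by rewrite !mxE; ring.
apply: le_measure; rewrite ?inE; [exact: measurable_box|exact: measurable_enorm_le|].
move=> y /= ye; rewrite sub0r enormN (_ : s = n%:R * (s / n%:R)); last by rewrite mulrC divfK// gt_eqF.
apply: enorm_le_coord; first exact: ltW.
by move=> i; have := ye i; rewrite !mxE ler_norml.
Qed.

(** * Invariance of Lebesgue measure under point reflections *)

Section reflection.
Context {R : realType}.

Lemma measurable_reflect (n : nat) (c : 'rV[R]_n) :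
  measurable_fun setT (fun y : 'rV[R]_n => c - y).
Proof. exact: measurable_fun_rVB. Qed.

Let lebesgue_measure_reflect (c : R) (A : set (measurableTypeR R)) : measurable A ->
  pushforward (@lebesgue_measure R)
    ((fun t => c - t) : measurableTypeR R -> measurableTypeR R) A = lebesgue_measure A.
Proof.
have mf : measurable_fun setT
  ((fun t => c - t) : measurableTypeR R -> measurableTypeR R).
  exact: measurable_funB.
move=> mA; apply/esym; apply: (lebesgue_measure_unique
  (mu := measure_function_pushforward__canonical__measure_function_Measure
     (@lebesgue_measure R) mf)) => //= _ [[a b]] _ <-.
rewrite /pushforward (_ : _ @^-1` _ = `[c - b, c - a[%classic); last first.
  by apply/seteqP; split => t /=; rewrite !in_itv/= => /andP[? ?]; apply/andP; split; lra.
rewrite !lebesgue_measure_itv/= !lte_fin ltrD2l ltrN2; case: ifPn => // _.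
by rewrite -!EFinD; congr EFin; ring.
Qed.

(** By induction on the dimension: the reflection acts separately on the first coordinate and on the
    others, and a measure with the right values on rectangles is the product measure. *)
Lemma lebesgue_rV_reflect (n : nat) (c : 'rV[R]_n) (A : set 'rV[R]_n) :
  measurable A ->
  pushforward (lebesgue_rV R n) (fun y => c - y) A = lebesgue_rV R n A.
Proof.
elim: n c A => [|n IHn] c A mA.
  rewrite /pushforward (_ : _ @^-1` A = A)//.
  by apply/seteqP; split => x /=; rewrite (_ : c - x = x)//; apply/rowP => -[].
pose f (z : measurableTypeR R * 'rV[R]_n) : measurableTypeR R * 'rV[R]_n :=
  (c 0 0 - z.1, (\row_j c 0 (lift ord0 j)) - z.2).
have mf : measurable_fun setT f.
  apply: measurable_fun_pair.
    by apply: measurable_funB => //; exact: measurable_fst.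
  exact: (measurableT_comp (measurable_reflect _) measurable_snd).
have consE z : c - consrV z = consrV (f z).
  apply/rowP => i; rewrite !mxE; case: unliftP => [j ->|->].
    by rewrite !mxE.
  by [].
rewrite /= /push_consrV /pushforward.
rewrite (_ : _ @^-1` (_ @^-1` A) = f @^-1` (@consrV R n @^-1` A)); last first.
  by apply/seteqP; split => z /=; rewrite consE.
have mX : measurable (@consrV R n @^-1` A).
  by rewrite -[X in measurable X]setTI; exact: measurable_consrV.
apply/esym; apply: (product_measure_unique
  (m' := measure_function_pushforward__canonical__measure_function_Measure
     (@lebesgue_measure R \x lebesgue_rV R n)%E mf)) => //= B D mB mD.
rewrite /pushforward (_ : f @^-1` _ =
  ((fun t => c 0 0 - t) @^-1` B) `*` ((fun y => (\row_j c 0 (lift ord0 j)) - y) @^-1` D))//.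
rewrite product_measure1E//.
- by congr (_ * _)%E; [exact: lebesgue_measure_reflect|exact: IHn].
- by rewrite -[X in measurable X]setTI; exact: measurable_funB.
- by rewrite -[X in measurable X]setTI; exact: measurable_reflect.
Qed.

Lemma integral_reflect (n : nat) (c : 'rV[R]_n) (D : set 'rV[R]_n)
    (f : 'rV[R]_n -> \bar R) :
  measurable D -> measurable_fun setT f ->
  (\int[lebesgue_rV R n]_(y in [set y | D (c - y)%R]) f (c - y)%R =
   \int[lebesgue_rV R n]_(y in D) f y)%E.
Proof.
move=> mD.
have ge0 (g : 'rV[R]_n -> \bar R) : measurable_fun setT g ->
    (forall x, (0 <= g x)%E) ->
    (\int[lebesgue_rV R n]_(y in [set y | D (c - y)%R]) g (c - y)%R =
     \int[lebesgue_rV R n]_(y in D) g y)%E.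
  move=> mg g0.
  rewrite (_ : [set y | _] = (fun y => c - y)%R @^-1` D)//.
  rewrite -[LHS](ge0_integral_pushforward (measurable_reflect c) _ mD)//; last first.
    exact: measurable_funTS.
  apply: eq_measure_integral; first exact: measurable_reflect.
  by move=> ? A mA _; exact: lebesgue_rV_reflect.
move=> mf; rewrite integralE [RHS]integralE; congr (_ - _)%E.
  rewrite -[RHS](ge0 (f^\+)%E); first by apply: eq_integral => y _; rewrite !funeposE.
    exact: measurable_funepos.
  by move=> x.
rewrite -[RHS](ge0 (f^\-)%E); first by apply: eq_integral => y _; rewrite !funenegE.
  exact: measurable_funeneg.
by move=> x.
Qed.

End reflection.

(** * Bumps and their fractional Laplacian *)

Section qbump.
Context {R : realType} {n : nat}.
Implicit Types (x y z : 'rV[R]_n) (rho : R).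

(* The fourth power makes the derivatives of [qbump] up to order two smaller than
   a multiple of [qbump^(1/r)] for every r > 2. *)
Definition bump_base rho x : R := Num.max 0 (1 - enorm x ^+ 2 / rho ^+ 2).

Definition qbump rho x : R := bump_base rho x ^+ 4.

Lemma bump_base_ge0 rho x : 0 <= bump_base rho x.
Proof. by rewrite /bump_base le_max lexx. Qed.

Lemma bump_base_le1 rho x : bump_base rho x <= 1.
Proof. by rewrite ge_max ler01/= gerBl divr_ge0 ?sqr_ge0. Qed.

Lemma bump_ge0 rho x : 0 <= qbump rho x.
Proof. by rewrite exprn_ge0// bump_base_ge0. Qed.

Lemma bump_le1 rho x : qbump rho x <= 1.
Proof. by rewrite exprn_ile1 ?bump_base_ge0 ?bump_base_le1. Qed.

Lemma bump_base_far rho x : 0 < rho -> rho <= enorm x -> bump_base rho x = 0.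
Proof.
move=> rho0 xrho; apply/max_idPl; rewrite subr_le0 ler_pdivlMr ?exprn_gt0// mul1r.
by rewrite ler_sqr ?nnegrE ?enorm_ge0// ltW.
Qed.

Lemma bump_far rho x : 0 < rho -> rho <= enorm x -> qbump rho x = 0.
Proof. by move=> *; rewrite /qbump bump_base_far// expr0n. Qed.

Lemma bump_near rho x : 0 < rho -> enorm x <= rho / 2 -> (3 / 4) ^+ 4 <= qbump rho x.
Proof.
move=> rho0 xrho; rewrite /qbump lerXn2r ?nnegrE ?bump_base_ge0//.
rewrite le_max; apply/orP; right.
rewrite lerBrDl -lerBrDr ler_pdivrMr ?exprn_gt0//.
apply: (@le_trans _ _ ((rho / 2) ^+ 2)); last by rewrite exprMn; lra.
by rewrite ler_sqr ?nnegrE ?enorm_ge0// divr_ge0// ltW.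
Qed.

Lemma le_bump rho rho' x : 0 < rho -> rho <= rho' -> qbump rho x <= qbump rho' x.
Proof.
move=> rho0 rr; rewrite /qbump lerXn2r ?nnegrE ?bump_base_ge0//.
rewrite /bump_base ge_max !le_max lexx/=; apply/orP; right.
rewrite lerD2l lerN2 ler_wpM2l ?sqr_ge0// lef_pV2 ?posrE ?exprn_gt0//; last first.
  exact: lt_le_trans rr.
by rewrite lerXn2r ?nnegrE// ltW// (lt_le_trans rho0).
Qed.

Lemma measurable_bump rho : measurable_fun setT (qbump rho).
Proof.
apply: measurable_funX; apply: measurable_maxr => //.
apply: measurable_funB => //; apply: measurable_funM => //.
by apply: measurable_funX; exact: measurable_enorm.
Qed.

(** Second-order Taylor remainder of max(0, s)^4, whose second derivative 12 max(0, s)^2 is at most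
    12 for s <= 1. The four sign cases avoid any calculus. *)
Let quartic_taylor (a b : R) : a <= 1 -> b <= 1 ->
  `|Num.max 0 b ^+ 4 - Num.max 0 a ^+ 4 - 4 * Num.max 0 a ^+ 3 * (b - a)|
  <= 6 * (b - a) ^+ 2.
Proof.
move=> a1 b1.
have [a0|a0] := leP a 0; have [b0|b0] := leP b 0.
- by rewrite !expr0n/= mulr0 mul0r !subrr normr0 mulr_ge0// sqr_ge0.
- rewrite !expr0n/= mulr0 mul0r !subr0 ger0_norm ?exprn_ge0 ?(ltW b0)//.
  have b4 : b ^+ 4 <= b ^+ 2 by rewrite -[4%N]/(2 + 2)%N exprD ler_piMr ?sqr_ge0// exprn_ile1// ltW.
  by have ab : 0 <= (- a) * b by [rewrite mulr_ge0 ?oppr_ge0// ltW]; nra.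
- rewrite expr0n/= sub0r.
  rewrite (_ : _ - _ = a ^+ 2 * (3 * a ^+ 2 + 4 * a * (- b))); last by ring.
  have ab : 0 <= a * (- b) by rewrite mulr_ge0 ?oppr_ge0// ltW.
  have a2 : a ^+ 2 <= 1 by rewrite exprn_ile1// ltW.
  have := sqr_ge0 a; have := sqr_ge0 b => b2 a20.
  rewrite ger0_norm; last by rewrite mulr_ge0//; nra.
  have : a ^+ 2 * (3 * a ^+ 2 + 4 * a * (- b)) <= 1 * (3 * a ^+ 2 + 4 * a * (- b)).
    by rewrite ler_wpM2r//; nra.
  by nra.
rewrite (_ : _ - _ = (b - a) ^+ 2 * (b ^+ 2 + 2 * a * b + 3 * a ^+ 2)); last by ring.
rewrite normrM ger0_norm ?sqr_ge0// mulrC ler_wpM2r ?sqr_ge0//.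
by rewrite ger0_norm; nra.
Qed.

(** With t = |z|/rho <= 1 and |x| <= 4 rho, the base 1 - |x|^2/rho^2 changes by at most (8 n + 1) t
    when x moves by z or -z. The two Taylor remainders give 12 (8 n + 1)^2 t^2; the first-order
    terms cancel up to 8 t^2. *)
Definition diff2_const : R := 12 * (8 * n%:R + 1) ^+ 2 + 8.

Lemma bump_diff2_le2 rho x y z : `|2 * qbump rho x - qbump rho y - qbump rho z| <= 2.
Proof.
have := bump_ge0 rho x; have := bump_ge0 rho y; have := bump_ge0 rho z.
have := bump_le1 rho x; have := bump_le1 rho y; have := bump_le1 rho z.
by rewrite ler_norml; lra.
Qed.

Lemma bump_diff2_le rho x z : 0 < rho ->
  `|2 * qbump rho x - qbump rho (x + z) - qbump rho (x - z)| <=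
  diff2_const * (enorm z ^+ 2 / rho ^+ 2).
Proof.
move=> rho0; have C0 : 2 <= diff2_const.
  by rewrite /diff2_const; have := sqr_ge0 (8 * n%:R + 1 : R); lra.
have rho2 : 0 < rho ^+ 2 by rewrite exprn_gt0.
have [zr|rz] := leP (enorm z) rho; last first.
  apply: le_trans (bump_diff2_le2 _ _ _ _) _.
  rewrite (le_trans C0)// ler_peMr ?(le_trans _ C0)//.
  by rewrite ler_pdivlMr// mul1r ler_sqr ?nnegrE ?enorm_ge0// ltW.
(* If |x| > 4 rho and |z| <= rho, then x, x + z and x - z all lie outside the support of the
   bump. *)
have [xr|rx] := leP (enorm x) (4 * rho); last first.
  have z2 : enorm z ^+ 2 <= rho ^+ 2 by rewrite ler_sqr ?nnegrE ?enorm_ge0// ltW.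
  have x2 : 16 * rho ^+ 2 <= enorm x ^+ 2.
    rewrite (_ : 16 * rho ^+ 2 = (4 * rho) ^+ 2); last by rewrite exprMn; congr (_ * _); ring.
    by rewrite ler_sqr ?nnegrE ?enorm_ge0// ?(ltW rx)// mulr_ge0// ltW.
  have far y : enorm x ^+ 2 <= 2 * enorm y ^+ 2 + 2 * enorm z ^+ 2 -> qbump rho y = 0.
    move=> h; apply: bump_far => //.
    by rewrite -ler_sqr ?nnegrE ?enorm_ge0 ?(ltW rho0)//; lra.
  rewrite (far (x + z)); last by have := enormB_sqr_le (x + z) z; rewrite addrK.
  rewrite (far (x - z)); last first.
    by have := enormB_sqr_le (x - z) (- z); rewrite opprK subrK enormN.
  rewrite (far x); last first.
    by have := sqr_ge0 (enorm x); have := sqr_ge0 (enorm z); lra.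
  by rewrite mulr0 !subr0 normr0 mulr_ge0 ?(le_trans _ C0)// divr_ge0 ?sqr_ge0.
set D := \sum_i x 0 i * z 0 i.
have DN : \sum_i x 0 i * (- z) 0 i = - D.
  by rewrite /D -sumrN; apply: eq_bigr => i _; rewrite mxE mulrN.
pose w y := 1 - enorm y ^+ 2 / rho ^+ 2.
have w1 y : w y <= 1 by rewrite gerBl divr_ge0 ?sqr_ge0.
have wp : w (x + z) - w x = - ((2 * D + enorm z ^+ 2) / rho ^+ 2).
  by rewrite /w enormD_sqr -/D; field; rewrite gt_eqF.
have wm : w (x - z) - w x = - ((- (2 * D) + enorm z ^+ 2) / rho ^+ 2).
  by rewrite /w enormD_sqr DN enormN; field; rewrite gt_eqF.
pose t := enorm z / rho.
have t0 : 0 <= t by rewrite divr_ge0 ?enorm_ge0 ?(ltW rho0).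
have t1 : t <= 1 by rewrite ler_pdivrMr// mul1r.
have tE : enorm z ^+ 2 / rho ^+ 2 = t ^+ 2 by rewrite expr_div_n.
have Db : `|2 * D / rho ^+ 2| <= 8 * n%:R * t.
  rewrite normrM [X in _ * X]ger0_norm ?invr_ge0 ?(ltW rho2)// ler_pdivrMr// normrM [X in X * _]ger0_norm//.
  apply: le_trans (ler_wpM2l _ (dot_le_enorm x z)) _ => //.
  have -> : 8 * n%:R * t * rho ^+ 2 = 2 * (n%:R * (4 * rho * enorm z)).
    by rewrite /t; field; rewrite gt_eqF.
  by rewrite ler_wpM2l// ler_wpM2l// ler_wpM2r ?enorm_ge0.
have bound (s : R) : `|s| <= 8 * n%:R * t -> (s + t ^+ 2) ^+ 2 <= (8 * n%:R + 1) ^+ 2 * t ^+ 2.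
  move=> sb; rewrite -exprMn -[leLHS]real_normK ?num_real// ler_sqr ?nnegrE; last 2 first.
  - by [].
  - by rewrite mulr_ge0// addr_ge0// mulr_ge0.
  apply: le_trans (ler_normD _ _) _; rewrite mulrDl lerD// ger0_norm ?sqr_ge0//.
  by rewrite mul1r expr2 ler_piMr.
have Tp := quartic_taylor (w1 x) (w1 (x + z)).
have Tm := quartic_taylor (w1 x) (w1 (x - z)).
have Bp := bound _ Db.
have Bm : (- (2 * D / rho ^+ 2) + t ^+ 2) ^+ 2 <= (8 * n%:R + 1) ^+ 2 * t ^+ 2.
  by apply: bound; rewrite normrN.
rewrite mulrDl tE in wp; rewrite mulrDl mulNr tE in wm.
rewrite wp in Tp; rewrite wm in Tm.
rewrite sqrrN in Tp; rewrite sqrrN in Tm.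
rewrite -/(bump_base rho x) -/(bump_base rho (x + z)) -/(qbump rho x) -/(qbump rho (x + z)) in Tp.
rewrite -/(bump_base rho x) -/(bump_base rho (x - z)) -/(qbump rho x) -/(qbump rho (x - z)) in Tm.
have W1 : bump_base rho x ^+ 3 <= 1 by rewrite exprn_ile1 ?bump_base_ge0 ?bump_base_le1.
have W0 : 0 <= bump_base rho x ^+ 3 by rewrite exprn_ge0 ?bump_base_ge0.
have Wt : bump_base rho x ^+ 3 * t ^+ 2 <= t ^+ 2 by rewrite ler_piMl ?sqr_ge0.
have Wt0 : 0 <= bump_base rho x ^+ 3 * t ^+ 2 by rewrite mulr_ge0 ?sqr_ge0.
rewrite tE /diff2_const.
move: Tp Tm; rewrite !ler_norml.
move: (2 * D / rho ^+ 2) Bp Bm => E Bp Bm.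
move: (bump_base rho x ^+ 3) W1 W0 Wt Wt0 => W W1 W0 Wt Wt0.
move: (qbump rho x) (qbump rho (x + z)) (qbump rho (x - z)) => p0 p1 p2.
move: (t ^+ 2) Bp Bm Wt Wt0 => T Bp Bm Wt Wt0.
move: ((8 * n%:R + 1) ^+ 2) Bp Bm => K Bp Bm.
move: ((E + T) ^+ 2) ((- E + T) ^+ 2) Bp Bm => Q1 Q2 Bp Bm.
by move=> /andP[? ?] /andP[? ?]; apply/andP; split; nra.
Qed.

End qbump.

Section euclidean_kernel.
Context {R : realType} {n : nat}.
Implicit Types (x y : 'rV[R]_n) (e rho : R).

Lemma enorm_kernel_near x e rho : 0 < rho -> 0 < e + n%:R ->
  (\int[lebesgue_rV R n]_(y in [set y | (0 < enorm (x - y) <= rho)%R])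
     (enorm (x - y) `^ e)%:E <=
   (2 `^ `|e| * 2 ^+ n / (1 - 2^-1 `^ (e + n%:R)) * rho `^ (e + n%:R))%:E)%E.
Proof.
move=> rho0 en0; apply: integral_norm_powR_near => //.
- exact: measurable_fun_enormB.
- by move=> s; exact: lebesgue_rV_ball_le.
Qed.

Lemma enorm_kernel_far x e rho : 0 < rho -> e + n%:R < 0 ->
  (\int[lebesgue_rV R n]_(y in [set y | (rho < enorm (x - y))%R])
     (enorm (x - y) `^ e)%:E <=
   (2 `^ `|e| * 2 ^+ n * 2 `^ (e + n%:R) / (1 - 2 `^ (e + n%:R)) *
     rho `^ (e + n%:R))%:E)%E.
Proof.
move=> rho0 en0; apply: integral_norm_powR_far => //.
- exact: measurable_fun_enormB.
- by move=> s; exact: lebesgue_rV_ball_le.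
Qed.

Lemma measurable_enorm_kernel x e :
  measurable_fun setT (fun y => enorm (x - y) `^ e).
Proof.
apply: (measurableT_comp (measurable_powR e)); exact: measurable_fun_enormB.
Qed.

Lemma measurable_inv_enorm_kernel x e :
  measurable_fun setT (fun y => (enorm (x - y) `^ e)^-1).
Proof.
rewrite (_ : (fun y => _) = (fun y => enorm (x - y) `^ (- e))).
  exact: measurable_enorm_kernel.
by apply/funext => y; rewrite powRN.
Qed.

End euclidean_kernel.

(** * The principal value as an absolutely convergent integral *)

Section principal_value.
Context {R : realType} {n : nat}.
Variables (beta : R) (beta0 : 0 < beta).
Implicit Types (x y : 'rV[R]_n).

Let kap := n%:R + 2 * (beta / 2).

Let kapE : kap = n%:R + beta.
Proof. by rewrite /kap mulrCA divff// mulr1. Qed.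

(* Averaging the principal value integrand over [y |-> 2x - y] yields half of this
   quotient, which is absolutely integrable; this also shows that the limit in
   [fraclap] exists, so that [lim] does not return its default value. *)
Definition diff2_quot (Phi : 'rV[R]_n -> R) x y :=
  (2 * Phi x - Phi y - Phi (x + x - y)) / enorm (x - y) `^ (n%:R + 2 * (beta / 2)).

Lemma measurable_diff2_quot (Phi : 'rV[R]_n -> R) x :
  measurable_fun setT Phi -> measurable_fun setT (diff2_quot Phi x).
Proof.
move=> mPhi; apply: measurable_funM; last exact: measurable_inv_enorm_kernel.
apply: measurable_funB; first exact: measurable_funB.
exact: (measurableT_comp mPhi (measurable_reflect _)).
Qed.

Let integrable_far (Phi : 'rV[R]_n -> R) (B : R) x (e : R) : measurable_fun setT Phi ->
  (forall y, `|Phi y| <= B) -> 0 < e ->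
  (lebesgue_rV R n).-integrable [set y | e < enorm (x - y)]
    (fun y => ((Phi x - Phi y) / enorm (x - y) `^ kap)%:E).
Proof.
move=> mPhi PhiB e0; have mD := measurable_enorm_gt x e.
apply: (@le_integrable _ _ _ _ _ mD _ (fun y => (2 * B)%:E * (enorm (x - y) `^ (- kap))%:E)%E).
- apply/measurable_EFinP; apply: measurable_funTS; apply: measurable_funM.
    exact: measurable_funB.
  exact: measurable_inv_enorm_kernel.
- move=> y _; rewrite -EFinM lee_fin powRN !normrM.
  rewrite [X in _ * X <= _]ger0_norm ?invr_ge0 ?powR_ge0//.
  rewrite [X in _ <= _ * X]ger0_norm ?invr_ge0 ?powR_ge0//.
  rewrite ler_wpM2r ?invr_ge0 ?powR_ge0//.
  have B0 : 0 <= B by rewrite (le_trans _ (PhiB x)).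
  rewrite -normrM [leRHS]ger0_norm ?mulr_ge0//.
  by rewrite (le_trans (ler_normB _ _))//; have := PhiB x; have := PhiB y; lra.
- apply: integrableZl => //; apply/integrableP; split.
    by apply/measurable_EFinP; apply: measurable_funTS; exact: measurable_enorm_kernel.
  under eq_integral do rewrite gee0_abs ?lee_fin ?powR_ge0//.
  by apply: le_lt_trans (enorm_kernel_far x e0 _) _; rewrite ?ltry// kapE; have := beta0; lra.
Qed.

Let truncated_integral (Phi : 'rV[R]_n -> R) (B : R) x (e : R) : measurable_fun setT Phi ->
  (forall y, `|Phi y| <= B) -> 0 < e ->
  \int[lebesgue_rV R n]_(y in [set y | e < enorm (x - y)])
    ((Phi x - Phi y) / enorm (x - y) `^ kap) =
  2^-1 * \int[lebesgue_rV R n]_(y in [set y | e < enorm (x - y)]) diff2_quot Phi x y.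
Proof.
move=> mPhi PhiB e0; have mD := measurable_enorm_gt x e.
have refl y : x - (x + x - y) = y - x by apply/rowP => i; rewrite !mxE; ring.
have mg : measurable_fun setT (fun y => (Phi x - Phi y) / enorm (x - y) `^ kap).
  by apply: measurable_funM; [exact: measurable_funB|exact: measurable_inv_enorm_kernel].
have Dr : [set y | e < enorm (x - (x + x - y))] = [set y | e < enorm (x - y)].
  by apply/seteqP; split => y /=; rewrite refl enormC.
have rI : \int[lebesgue_rV R n]_(y in [set y | e < enorm (x - y)])
    ((Phi x - Phi (x + x - y)) / enorm (x - y) `^ kap) =
    \int[lebesgue_rV R n]_(y in [set y | e < enorm (x - y)])
    ((Phi x - Phi y) / enorm (x - y) `^ kap).
  rewrite /Rintegral; congr fine.
  have mgE : measurable_fun setT (fun y => ((Phi x - Phi y) / enorm (x - y) `^ kap)%:E).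
    exact/measurable_EFinP.
  have H := integral_reflect (x + x) mD mgE.
  move: H; rewrite /= Dr; apply: etrans; apply: eq_integral => y _.
  by rewrite refl (enormC y).
have i1 := integrable_far x mPhi PhiB e0.
have i2 : (lebesgue_rV R n).-integrable [set y | e < enorm (x - y)]
    (fun y => ((Phi x - Phi (x + x - y)) / enorm (x - y) `^ kap)%:E).
  have mPhir : measurable_fun setT (fun y => Phi (x + x - y)).
    exact: (measurableT_comp mPhi (measurable_reflect _)).
  have := @integrable_far (fun y => Phi (x + x - y)) B x e mPhir (fun y => PhiB _) e0.
  by rewrite addrK.
have : \int[lebesgue_rV R n]_(y in [set y | e < enorm (x - y)]) diff2_quot Phi x y =
  \int[lebesgue_rV R n]_(y in [set y | e < enorm (x - y)])
    ((Phi x - Phi y) / enorm (x - y) `^ kap) +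
  \int[lebesgue_rV R n]_(y in [set y | e < enorm (x - y)])
    ((Phi x - Phi (x + x - y)) / enorm (x - y) `^ kap).
  rewrite -RintegralD//; apply: eq_Rintegral => y _.
  by rewrite /diff2_quot -/kap -mulrDl; congr (_ / _); ring.
rewrite rI => ->.
set I := Rintegral _ _ _; lra.
Qed.

Lemma principal_value_cvg (Phi : 'rV[R]_n -> R) (B : R) x : measurable_fun setT Phi ->
  (forall y, `|Phi y| <= B) ->
  (\int[lebesgue_rV R n]_y `|diff2_quot Phi x y|%:E < +oo)%E ->
  (\int[lebesgue_rV R n]_(y in [set y | e < enorm (x - y)])
    ((Phi x - Phi y) / enorm (x - y) `^ (n%:R + 2 * (beta / 2))))
    @[e --> 0^'+] -->
  2^-1 * \int[lebesgue_rV R n]_y diff2_quot Phi x y.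
Proof.
move=> mPhi PhiB fin; apply/cvg_at_rightP => u [u0 ucvg].
rewrite (_ : (fun k => _) = (fun k => 2^-1 *
    \int[lebesgue_rV R n]_(y in [set y | u k < enorm (x - y)]) diff2_quot Phi x y)); last first.
  by apply/funext => k; rewrite -/kap (truncated_integral (B := B)).
apply: cvgMr.
have mh := measurable_diff2_quot x mPhi.
have ih : (lebesgue_rV R n).-integrable setT (EFin \o diff2_quot Phi x).
  by apply/integrableP; split; [exact/measurable_EFinP|].
pose f k y := (diff2_quot Phi x y * \1_[set y | u k < enorm (x - y)] y)%:E.
have fE k : \int[lebesgue_rV R n]_(y in [set y | u k < enorm (x - y)]) diff2_quot Phi x y =
    fine (\int[lebesgue_rV R n]_y f k y)%E.
  rewrite /Rintegral integral_mkcond; congr fine; apply: eq_integral => y _.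
  rewrite /f patchE indicE; case: ifPn => /= _; first by rewrite mulr1.
  by rewrite mulr0.
under eq_cvg do rewrite fE.
have mf k : measurable_fun setT (f k).
  apply/measurable_EFinP; apply: measurable_funM => //.
  by apply: measurable_indic; exact: measurable_enorm_gt.
have [] := @dominated_convergence _ _ _ (lebesgue_rV R n) setT measurableT f
  (EFin \o diff2_quot Phi x) (fun y => `|diff2_quot Phi x y|%:E) mf.
- exact/measurable_EFinP.
- apply: aeW => y _ /=; apply: cvg_near_cst.
  (* The point y = x never enters the truncated domains, but there the quotient is 0 by the
     convention 0^-1 = 0, so pointwise convergence holds everywhere. *)
  have [xy0|xy0] := eqVneq (enorm (x - y)) 0.
    near=> k; rewrite /f /diff2_quot xy0 powR0 ?invr0 ?mulr0 ?mul0r//.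
    by rewrite -/kap kapE gt_eqF// ltr_wpDl.
  have xy : 0 < enorm (x - y) by rewrite lt_def xy0 enorm_ge0.
  near=> k; rewrite /f indicE mem_set ?mulr1//=.
  by near: k; exact: (cvgr_lt 0).
- exact: integrable_abse ih.
- apply: aeW => y k _; rewrite /f lee_fin normrM ler_piMr//.
  by rewrite indicE; case: (_ \in _); rewrite ?normr1 ?normr0.
move=> _ _ cvgf; apply: fine_cvg; rewrite fineK//.
exact: integrable_fin_num.
Unshelve. all: by end_near. Qed.

End principal_value.

Lemma ge0_integral_supp_setU d (T : measurableType d) (R : realType)
    (mu : {measure set T -> \bar R}) (A B : set T) (f : T -> \bar R) :
  measurable A -> measurable B -> measurable_fun setT f ->
  (forall x, (0 <= f x)%E) -> [disjoint A & B] ->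
  (forall x, ~ A x -> ~ B x -> f x = 0%E) ->
  (\int[mu]_x f x = \int[mu]_(x in A) f x + \int[mu]_(x in B) f x)%E.
Proof.
move=> mA mB mf f0 AB fAB; rewrite -ge0_integral_setU//; last first.
  by apply: measurable_funTS.
rewrite [RHS]integral_mkcond; apply: eq_integral => x _; rewrite patchE.
case: ifPn => //; rewrite notin_setE => nAB.
by apply: fAB => h; apply: nAB; [left|right].
Qed.

Section fraclap_bound.
Context {R : realType} {n : nat}.
Variables (beta : R) (beta0 : 0 < beta) (beta2 : beta < 2).
Implicit Types (x y : 'rV[R]_n).

Let kap := n%:R + 2 * (beta / 2).

Let kapE : kap = n%:R + beta.
Proof. by rewrite /kap mulrCA divff// mulr1. Qed.

Lemma fraclapE (Phi : 'rV[R]_n -> R) (B : R) x :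
  measurable_fun setT Phi -> (forall y, `|Phi y| <= B) ->
  (\int[lebesgue_rV R n]_y `|diff2_quot beta Phi x y|%:E < +oo)%E ->
  fraclap beta Phi x = fraclap_const n (beta / 2) *
    (2^-1 * \int[lebesgue_rV R n]_y diff2_quot beta Phi x y).
Proof.
move=> mPhi PhiB fin; rewrite /fraclap (lt_eqF beta2).
have cv := principal_value_cvg beta0 mPhi PhiB fin.
by have -> := cvg_lim (@norm_hausdorff _ _) cv.
Qed.

Lemma fraclap_norm_le (Phi : 'rV[R]_n -> R) (B : R) x (J : R) :
  measurable_fun setT Phi -> (forall y, `|Phi y| <= B) ->
  (\int[lebesgue_rV R n]_y `|diff2_quot beta Phi x y|%:E <= J%:E)%E ->
  `|fraclap beta Phi x| <= `|fraclap_const n (beta / 2) : R| * (2^-1 * J).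
Proof.
move=> mPhi PhiB intJ; have fin := le_lt_trans intJ (ltry _).
rewrite (fraclapE mPhi PhiB fin).
rewrite !normrM ler_wpM2l// [X in X * _]ger0_norm// ler_wpM2l//.
have mh := measurable_diff2_quot beta x mPhi.
rewrite -lee_fin; apply: le_trans intJ; rewrite EFin_normr_Rintegral//.
  apply: le_trans (le_abse_integral _ _ _) _ => //.
  exact/measurable_EFinP.
by apply/integrableP; split; [exact/measurable_EFinP|].
Qed.

Let diff2_near_const : R :=
  diff2_const (n := n) *
    (2 `^ `|2 - kap| * 2 ^+ n / (1 - 2^-1 `^ (2 - kap + n%:R))) +
  2 * (2 `^ `|- kap| * 2 ^+ n * 2 `^ (- kap + n%:R) / (1 - 2 `^ (- kap + n%:R))).

(** The integral is split at |x - y| = rho. Inside, the second difference is of order |x -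
    y|^2/rho^2 and leaves the exponent 2 - n - beta, integrable since beta < 2; outside it is at
    most 2 and the kernel is integrable since beta > 0. Both parts scale like rho^-beta. *)
Let diff2_near rho x : 0 < rho ->
  (\int[lebesgue_rV R n]_y `|diff2_quot beta (qbump rho) x y|%:E <=
   (diff2_near_const * rho `^ (- beta))%:E)%E.
Proof.
move=> rho0; have b0 := beta0; have b2 := beta2.
have mN := measurable_fun_enormB x.
have mA : measurable [set y | 0 < enorm (x - y) <= rho].
  rewrite (_ : [set _ | _] = (fun y => enorm (x - y)) @^-1` `]0, rho]%classic).
    by rewrite -[X in measurable X]setTI; exact: mN.
  by apply/seteqP; split => y /=; rewrite in_itv.
have mB := measurable_enorm_gt x rho.
have mh : measurable_fun setT (fun y => `|diff2_quot beta (qbump rho) x y|%:E).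
  apply/measurable_EFinP; apply: measurableT_comp => //.
  by apply: measurable_diff2_quot; exact: measurable_bump.
have D0 : 0 <= diff2_const (R := R) (n := n).
  by rewrite /diff2_const addr_ge0// mulr_ge0// sqr_ge0.
rewrite (@ge0_integral_supp_setU _ _ _ _ [set y | 0 < enorm (x - y) <= rho]
  [set y | rho < enorm (x - y)])//; last 2 first.
- apply/disj_setPS => y [/= /andP[_ yr] ry].
  by move: ry; rewrite ltNge yr.
- move=> y /= nA nB; rewrite /diff2_quot (_ : enorm (x - y) = 0).
    by rewrite powR0 ?invr0 ?mulr0 ?normr0// -/kap kapE gt_eqF// ltr_wpDl.
  apply/eqP; rewrite eq_le enorm_ge0 andbT leNgt; apply/negP => y0.
  by apply: nA; rewrite y0/= leNgt; apply/negP.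
rewrite mulrDl EFinD leeD//.
  apply: (@le_trans _ _ (\int[lebesgue_rV R n]_(y in [set y | (0 < enorm (x - y) <= rho)%R])
     ((diff2_const (n := n) / rho ^+ 2)%:E * (enorm (x - y) `^ (2 - kap))%:E))%E).
    apply: ge0_le_integral => //.
    - exact: measurable_funTS.
    - apply: emeasurable_funM => //; apply/measurable_EFinP/measurable_funTS.
      exact: measurable_enorm_kernel.
    - move=> y /= /andP[y0 _]; rewrite -EFinM lee_fin /diff2_quot -/kap normrM.
      rewrite [X in _ * X <= _]ger0_norm ?invr_ge0 ?powR_ge0//.
      rewrite [X in _ <= _ * X]powRD; last by rewrite (gt_eqF y0) implybT.
      rewrite powRN powR_mulrn ?enorm_ge0// [leRHS]mulrA ler_wpM2r ?invr_ge0 ?powR_ge0//.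
      have := bump_diff2_le x (y - x) rho0.
      rewrite addrCA subrr addr0 opprB addrA => /le_trans; apply.
      by rewrite (enormC y) [leRHS]mulrAC -[leRHS]mulrA.
  rewrite ge0_integralZl//; last 3 first.
  - by apply/measurable_EFinP/measurable_funTS; exact: measurable_enorm_kernel.
  - by move=> y _; rewrite lee_fin powR_ge0.
  - by rewrite lee_fin divr_ge0 ?sqr_ge0.
  apply: (le_trans (lee_wpmul2l _ (enorm_kernel_near x rho0 _))).
  - by rewrite lee_fin divr_ge0 ?sqr_ge0.
  - by rewrite kapE; lra.
  rewrite -EFinM lee_fin.
  have -> : rho `^ (2 - kap + n%:R) = rho ^+ 2 * rho `^ (- beta).
    rewrite -powR_mulrn ?(ltW rho0)// -powRD ?(gt_eqF rho0) ?implybT//.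
    by congr (_ `^ _); rewrite kapE; lra.
  rewrite -subr_ge0 (_ : _ - _ = 0)//; field; rewrite (gt_eqF rho0)//=.
  have : 2^-1 `^ (2 - kap + n%:R) < 1 :> R.
    rewrite /powR gt_eqF// -[ltRHS]expR0 ltr_expR pmulr_rlt0//.
      by rewrite lnV ?posrE// oppr_lt0 ln_gt0// ltr1n.
    by rewrite kapE; lra.
  by move=> h; rewrite gt_eqF// subr_gt0.
apply: (@le_trans _ _ (\int[lebesgue_rV R n]_(y in [set y | (rho < enorm (x - y))%R])
     (2%:E * (enorm (x - y) `^ (- kap))%:E))%E).
  apply: ge0_le_integral => //.
  - exact: measurable_funTS.
  - apply: emeasurable_funM => //; apply/measurable_EFinP/measurable_funTS.
    exact: measurable_enorm_kernel.
  - move=> y /= _; rewrite -EFinM lee_fin /diff2_quot -/kap normrM.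
    rewrite [X in _ * X <= _]ger0_norm ?invr_ge0 ?powR_ge0//.
    by rewrite powRN ler_wpM2r ?invr_ge0 ?powR_ge0// bump_diff2_le2.
rewrite ge0_integralZl//; last 2 first.
- by apply/measurable_EFinP/measurable_funTS; exact: measurable_enorm_kernel.
- by move=> y _; rewrite lee_fin powR_ge0.
apply: (le_trans (lee_wpmul2l _ (enorm_kernel_far x rho0 _))) => //.
- by rewrite kapE; lra.
rewrite -EFinM lee_fin -[leRHS]mulrA.
by rewrite (_ : - beta = - kap + n%:R)//; rewrite kapE; ring.
Qed.

Let bump_kernel_far rho x : 0 < rho -> 4 * rho < enorm x ->
  (\int[lebesgue_rV R n]_y (qbump rho y / enorm (x - y) `^ kap)%:E <=
   (2 ^+ n * 2 `^ kap * (rho `^ n%:R * enorm x `^ (- kap)))%:E)%E.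
Proof.
move=> rho0 rx; have b0 := beta0; have b2 := beta2.
have x0 : 0 < enorm x by rewrite (lt_trans _ rx)// mulr_gt0.
have kap0 : 0 < kap by rewrite kapE ltr_wpDl.
pose a := (enorm x / 2) `^ (- kap).
pose ball0 := [set y : 'rV[R]_n | enorm (0 - y) <= rho].
have mball : measurable ball0 := measurable_enorm_le 0 rho.
apply: (@le_trans _ _ (\int[lebesgue_rV R n]_y (a * \1_ball0 y)%:E)%E).
  apply: ge0_le_integral => //.
  - by move=> y _; rewrite lee_fin divr_ge0 ?bump_ge0 ?powR_ge0.
  - apply/measurable_EFinP; apply: measurable_funM; first exact: measurable_bump.
    exact: measurable_inv_enorm_kernel.
  - by apply/measurable_EFinP; apply: measurable_funM.
  - move=> y _; rewrite lee_fin indicE; case: (boolP (_ \in _)) => [|].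
      rewrite inE/= /ball0/= sub0r enormN => yr; rewrite mulr1.
      rewrite -[leRHS]mul1r ler_pM ?bump_ge0 ?bump_le1 ?invr_ge0 ?powR_ge0//.
      have xy : enorm x / 2 <= enorm (x - y).
        rewrite -ler_sqr ?nnegrE ?enorm_ge0// ?divr_ge0 ?enorm_ge0//.
        have := enormB_sqr_le (x - y) (- y); rewrite opprK subrK enormN.
        have : enorm y ^+ 2 <= (enorm x / 4) ^+ 2.
          by rewrite ler_sqr ?nnegrE ?enorm_ge0 ?divr_ge0 ?enorm_ge0//; lra.
        by rewrite !exprMn; have := sqr_ge0 (enorm x); lra.
      have x20 : 0 < enorm x / 2 by rewrite divr_gt0.
      rewrite /a powRN lef_pV2 ?posrE ?powR_gt0 ?(lt_le_trans x20)//.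
      by apply: ge0_ler_powR; rewrite ?nnegrE ?enorm_ge0// ltW.
    rewrite notin_setE/= /ball0/= sub0r enormN => /negP; rewrite -ltNge => ry.
    by rewrite bump_far ?mul0r ?mulr0// ltW.
under eq_integral do rewrite EFinM.
rewrite ge0_integralZl//; last 2 first.
- by apply/measurable_EFinP; apply: measurable_indic.
- by rewrite lee_fin powR_ge0.
rewrite integral_indic// setIT.
apply: (le_trans (lee_wpmul2l _ (lebesgue_rV_ball_le _ rho0))).
  by rewrite lee_fin powR_ge0.
rewrite -EFinM lee_fin /a powRM ?invr_ge0 ?enorm_ge0//.
rewrite (_ : 2^-1 `^ (- kap) = 2 `^ kap); last by rewrite -(powR_inv1 (ler0n R 2)) -powRrM mulN1r opprK.
by rewrite -subr_ge0 (_ : _ - _ = 0)//; ring.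
Qed.

(** Outside the support the second difference is - (bump(y) + bump(2x - y)), so it has one sign, and
    the reflection gives both summands the same integral. Hence this is an equality, usable for
    upper and lower bounds. *)
Lemma diff2_quot_far rho x : 0 < rho -> 4 * rho < enorm x ->
  (\int[lebesgue_rV R n]_y `|diff2_quot beta (qbump rho) x y|%:E =
   2%:E * \int[lebesgue_rV R n]_y
     (qbump rho y / enorm (x - y) `^ (n%:R + 2 * (beta / 2)))%:E)%E.
Proof.
move=> rho0 rx; have x0 : rho <= enorm x by lra.
pose g y := (qbump rho y / enorm (x - y) `^ kap)%:E.
have g0 y : (0 <= g y)%E by rewrite lee_fin divr_ge0 ?bump_ge0 ?powR_ge0.
have mg : measurable_fun setT g.
  apply/measurable_EFinP; apply: measurable_funM; first exact: measurable_bump.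
  exact: measurable_inv_enorm_kernel.
have rI := integral_reflect (x + x) measurableT mg.
rewrite (_ : [set y | _] = setT) in rI; last by apply/seteqP; split.
transitivity (\int[lebesgue_rV R n]_y (g y + g (x + x - y)%R))%E.
  apply: eq_integral => y _; rewrite /g -EFinD; congr EFin.
  have -> : x - (x + x - y) = y - x by apply/rowP => i; rewrite !mxE; ring.
  rewrite (enormC y x) -[RHS]mulrDl /diff2_quot -/kap.
  have -> : 2 * qbump rho x - qbump rho y - qbump rho (x + x - y) =
            - (qbump rho y + qbump rho (x + x - y)).
    by rewrite (bump_far rho0 x0); ring.
  rewrite mulNr normrN; apply: ger0_norm; apply: divr_ge0; last exact: powR_ge0.
  by apply: addr_ge0; exact: bump_ge0.
have mgr := measurableT_comp mg (measurable_reflect (x + x)).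
rewrite (ge0_integralD _ measurableT (fun y _ => g0 y) mg (fun y _ => g0 _) mgr).
by rewrite [X in (_ + X)%E]rI -mule2n -mule_natl.
Qed.

(** The first bound is sharp near the origin, the second one records the decay |x|^-(n+beta) forced
    by the nonlocality. *)
Lemma bump_diff2_integral : exists2 C : R, 0 < C & forall rho x, 0 < rho ->
  (\int[lebesgue_rV R n]_y `|diff2_quot beta (qbump rho) x y|%:E <=
     (C * rho `^ (- beta))%:E)%E /\
  (x != 0 -> (\int[lebesgue_rV R n]_y `|diff2_quot beta (qbump rho) x y|%:E <=
     (C * (rho `^ n%:R * enorm x `^ (- (n%:R + beta))))%:E)%E).
Proof.
have b0 := beta0; have b2 := beta2.
pose C1 := `|diff2_near_const| + 1.
pose C2 := 2 * (2 ^+ n * 2 `^ kap) : R.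
have C10 : 0 < C1 by rewrite ltr_wpDl.
have C20 : 0 < C2 by rewrite !mulr_gt0 ?exprn_gt0 ?powR_gt0.
pose C := C1 * 4 `^ kap + C1 + C2.
have C0 : 0 < C.
  by apply: addr_gt0 => //; apply: addr_gt0 => //; apply: mulr_gt0 => //; exact: powR_gt0.
exists C => // rho x rho0.
have near : (\int[lebesgue_rV R n]_y `|diff2_quot beta (qbump rho) x y|%:E <=
     (C1 * rho `^ (- beta))%:E)%E.
  apply: le_trans (diff2_near x rho0) _; rewrite lee_fin ler_wpM2r ?powR_ge0//.
  by rewrite /C1; have := ler_norm diff2_near_const; lra.
split.
  apply: le_trans near _; rewrite lee_fin ler_wpM2r ?powR_ge0//.
  by rewrite /C -addrA addrCA lerDl addr_ge0 ?(ltW C20)// mulr_ge0 ?powR_ge0 ?(ltW C10).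
move=> x0; have ex0 := enorm_gt0 x0.
have [xr|rx] := leP (enorm x) (4 * rho); last first.
  rewrite diff2_quot_far//.
  apply: le_trans (lee_wpmul2l _ (bump_kernel_far rho0 rx)) _ => //.
  rewrite -EFinM lee_fin [leLHS]mulrA -/C2 -kapE.
  apply: ler_wpM2r; first by rewrite mulr_ge0 ?powR_ge0.
  by rewrite lerDr; apply: addr_ge0; rewrite ?mulr_ge0 ?powR_ge0 ?(ltW C10).
(* For |x| <= 4 rho the decaying bound follows from the uniform one, at the price of the factor
   4^(n+beta). *)
apply: le_trans near _; rewrite lee_fin.
apply: (@le_trans _ _ (C1 * 4 `^ kap * (rho `^ n%:R * enorm x `^ (- (n%:R + beta))))); last first.
  rewrite ler_wpM2r ?mulr_ge0 ?powR_ge0// /C -addrA lerDl.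
  by rewrite addr_ge0 ?(ltW C20) ?(ltW C10).
rewrite -mulrA ler_wpM2l ?(ltW C10)//.
rewrite (_ : - beta = n%:R + - (n%:R + beta)); last by ring.
rewrite powRD ?(gt_eqF rho0) ?implybT// mulrCA ler_wpM2l ?powR_ge0//.
rewrite kapE !powRN ler_pdivlMr ?powR_gt0// mulrC ler_pdivrMr ?powR_gt0//.
rewrite -powRM ?(ltW rho0)//; apply: ge0_ler_powR => //.
- by rewrite addr_ge0// ltW.
- by rewrite nnegrE enorm_ge0.
- by rewrite nnegrE mulr_ge0// ltW.
Qed.

Lemma bump_kernel_ge rho x : (0 < n)%N -> 0 < rho -> 4 * rho < enorm x ->
  (((3 / 4) ^+ 4 * (rho / n%:R) ^+ n *
    (2 * enorm x) `^ (- (n%:R + 2 * (beta / 2))))%:E <=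
   \int[lebesgue_rV R n]_y
     (qbump rho y / enorm (x - y) `^ (n%:R + 2 * (beta / 2)))%:E)%E.
Proof.
rewrite -/kap.
move=> n0 rho0 rx; have b0 := beta0.
have x0 : 0 < enorm x by rewrite (lt_trans _ rx)// mulr_gt0.
pose B := [set y : 'rV[R]_n | enorm (0 - y) <= rho / 2].
have mB : measurable B by exact: measurable_enorm_le.
pose k : R := (3 / 4) ^+ 4 * (2 * enorm x) `^ (- kap).
have k0 : 0 <= k by rewrite mulr_ge0 ?powR_ge0.
apply: (@le_trans _ _ (\int[lebesgue_rV R n]_y (k%:E * (\1_B y)%:E))%E).
  rewrite ge0_integralZl//; last by apply/measurable_EFinP; exact: measurable_indic.
  rewrite integral_indic// setIT [X in X%:E](_ : _ = k * (2 * (rho / 2) / n%:R) ^+ n); last first.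
    by rewrite /k mulrAC; congr (_ * (_ / _) ^+ n); field.
  by rewrite EFinM lee_wpmul2l// lebesgue_rV_ball_ge// divr_gt0.
apply: ge0_le_integral => //.
- by move=> y _; rewrite mule_ge0.
- by apply: emeasurable_funM => //; apply/measurable_EFinP; exact: measurable_indic.
- apply/measurable_EFinP; apply: measurable_funM; first exact: measurable_bump.
  exact: measurable_inv_enorm_kernel.
move=> y _; rewrite -EFinM lee_fin indicE.
case: (boolP (y \in B)) => [|_]; last first.
  by rewrite mulr0 divr_ge0 ?bump_ge0 ?powR_ge0.
rewrite mulr1 => /set_mem; rewrite /B/= sub0r enormN => yr.
rewrite /k ler_pM ?powR_ge0 ?bump_near//.
have rx4 : rho < enorm x / 4 by rewrite ltr_pdivlMr// mulrC.
have xy2 : enorm (x - y) <= 2 * enorm x.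
  by apply: enormB_le2 => //; lra.
have xy0 : 0 < enorm (x - y).
  apply: enorm_gt0; rewrite subr_eq0; apply/eqP => xy; move: yr; rewrite -xy; lra.
rewrite powRN lef_pV2 ?posrE ?powR_gt0 ?mulr_gt0//.
by apply: ge0_ler_powR; rewrite ?nnegrE ?enorm_ge0 ?mulr_ge0 ?enorm_ge0// kapE addr_ge0// ltW.
Qed.

Lemma diff2_quot_sum (N : nat) (c rho : nat -> R) x y :
  diff2_quot beta (fun y => \sum_(k < N) c k * qbump (rho k) y) x y =
  \sum_(k < N) c k * diff2_quot beta (qbump (rho k)) x y.
Proof.
rewrite /diff2_quot mulr_sumr -!sumrB mulr_suml; apply: eq_bigr => k _; ring.
Qed.

Lemma measurable_bump_sum (N : nat) (c rho : nat -> R) :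
  measurable_fun setT (fun y : 'rV[R]_n => \sum_(k < N) c k * qbump (rho k) y).
Proof.
apply: measurable_sum => k; apply: measurable_funM => //; exact: measurable_bump.
Qed.

Lemma bump_sum_norm_le (N : nat) (c rho : nat -> R) (y : 'rV[R]_n) :
  (forall k, 0 <= c k) ->
  `|\sum_(k < N) c k * qbump (rho k) y| <= \sum_(k < N) c k.
Proof.
move=> c0; rewrite ger0_norm; last by rewrite sumr_ge0// => k _; rewrite mulr_ge0 ?bump_ge0.
by apply: ler_sum => k _; rewrite ler_piMr ?bump_le1.
Qed.

(** The constant depends neither on the number of bumps nor on their heights and radii, which is
    what allows arbitrarily long dyadic sums later. *)
Lemma fraclap_bump_sum : exists2 C : R, 0 < C &
  forall (N : nat) (c rho : nat -> R) x,
  (forall k, 0 <= c k) -> (forall k, 0 < rho k) ->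
  `|fraclap beta (fun y => \sum_(k < N) c k * qbump (rho k) y) x| <=
     C * \sum_(k < N) c k * rho k `^ (- beta) /\
  (x != 0 -> `|fraclap beta (fun y => \sum_(k < N) c k * qbump (rho k) y) x| <=
     C * \sum_(k < N) c k * (rho k `^ n%:R * enorm x `^ (- (n%:R + beta)))).
Proof.
have [C C0 bC] := bump_diff2_integral.
exists ((`|fraclap_const n (beta / 2)| + 1) * (2^-1 * C)).
  by rewrite !mulr_gt0 ?ltr_wpDl.
move=> N c rho x c0 rho0.
have mq k : measurable_fun setT (fun y => (`|diff2_quot beta (qbump (rho k)) x y|)%:E).
  apply/measurable_EFinP; apply: measurableT_comp => //.
  by apply: measurable_diff2_quot; exact: measurable_bump.
have main (J : nat -> R) :
    (forall k, (\int[lebesgue_rV R n]_y `|diff2_quot beta (qbump (rho k)) x y|%:E <= (C * J k)%:E)%E) ->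
    `|fraclap beta (fun y => \sum_(k < N) c k * qbump (rho k) y) x| <=
    (`|fraclap_const n (beta / 2)| + 1) * (2^-1 * C) * \sum_(k < N) c k * J k.
  move=> intJ.
  have J0 k : 0 <= C * J k.
    rewrite -lee_fin; apply: le_trans (intJ k).
    by apply: integral_ge0 => y _; rewrite lee_fin.
  have S0 : 0 <= \sum_(k < N) c k * (C * J k).
    by rewrite sumr_ge0// => k _; rewrite mulr_ge0.
  apply: (@le_trans _ _ (`|fraclap_const n (beta / 2)| * (2^-1 * \sum_(k < N) c k * (C * J k)))).
    apply: (@fraclap_norm_le _ (\sum_(k < N) c k)).
    - exact: measurable_bump_sum.
    - by move=> y; exact: bump_sum_norm_le.
    - apply: (@le_trans _ _ (\int[lebesgue_rV R n]_y
          \sum_(k < N) ((c k)%:E * `|diff2_quot beta (qbump (rho k)) x y|%:E))%E).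
        apply: ge0_le_integral => //.
        + apply/measurable_EFinP; apply: measurableT_comp => //.
          by apply: measurable_diff2_quot; exact: measurable_bump_sum.
        + by apply: emeasurable_sum => k; exact: emeasurable_funM.
        + move=> y _; rewrite diff2_quot_sum sumEFin lee_fin.
          apply: le_trans (ler_norm_sum _ _ _) _.
          by apply: ler_sum => k _; rewrite normrM ger0_norm.
      rewrite ge0_integral_sum//; last 2 first.
      + by move=> k; exact: emeasurable_funM.
      + by move=> k y _; rewrite mule_ge0// lee_fin.
      rewrite -sumEFin; apply: lee_sum => k _.
      rewrite ge0_integralZl ?lee_fin// EFinM lee_wpmul2l ?lee_fin//.
  rewrite -!mulrA (_ : \sum_(k < N) c k * (C * J k) = C * \sum_(k < N) c k * J k); last first.
    by rewrite mulr_sumr; apply: eq_bigr => k _; ring.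
  rewrite (_ : \sum_(k < N) c k * (C * J k) = C * \sum_(k < N) c k * J k) in S0; last first.
    by rewrite mulr_sumr; apply: eq_bigr => k _; ring.
  by apply: ler_wpM2r; [rewrite mulr_ge0 ?invr_ge0|rewrite lerDl].
split; first by apply: (main (fun k => rho k `^ (- beta))) => k; have [] := bC (rho k) x (rho0 k).
by move=> x0; apply: (main (fun k => rho k `^ n%:R * enorm x `^ (- (n%:R + beta)))) => k;
  have [_ ->] := bC (rho k) x (rho0 k).
Qed.

End fraclap_bound.

(** The floor of -s is -1, so the extension of [Gamma] shifts its argument exactly once. *)
Lemma GammaN (R : realType) (s : R) : 0 < s < 1 -> Gamma (- s) = Gamma (1 - s) / (- s).
Proof.
move=> /andP[s0 s1].
have f1 : Num.floor (- s) = - 1 by apply: floor_def; rewrite rmorphN1 rmorph0; lra.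
have f2 : Num.floor (1 - s) = 0 by apply: floor_def; rewrite rmorph0 rmorph1; lra.
rewrite /Gamma f1 f2.
rewrite (_ : absz (Num.min 0 (- 1)) = 1%N)// (_ : absz (Num.min 0 0) = 0%N)//.
rewrite big_ord1 big_ord0 [RHS]mulrC invr1 [X in _ = _ * X]mulr1 [LHS]mulrC addr0.
by congr (_ * _); apply: eq_Rintegral => t _; congr (_ `^ _ * _); ring.
Qed.

(** The lower bound of [fraclap] far from a bump is a multiple of this constant; if it were 0, no
    decay of the solution could be read off from it. *)
Lemma fraclap_const_neq0 (R : realType) (n : nat) (s : R) : 0 < s < 1 ->
  fraclap_const n s != 0.
Proof.
move=> s01; have /andP[s0 s1] := s01.
have g1 : Gamma (n%:R / 2 + s) != 0 by rewrite gt_eqF// Gamma_gt0// ltr_wpDl.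
have g2 : Gamma (- s) != 0.
  rewrite GammaN// lt_eqF// pmulr_rlt0; last by apply: Gamma_gt0; rewrite subr_gt0.
  by rewrite invr_lt0 oppr_lt0.
have g3 (a b : R) : 0 < a -> a `^ b != 0 by move=> a0; rewrite gt_eqF// powR_gt0.
rewrite /fraclap_const; apply: mulf_neq0; first by apply: mulf_neq0 => //; exact: g3.
apply: invr_neq0; apply: mulf_neq0; last by rewrite normr_eq0.
by apply: g3; exact: pi_gt0.
Qed.

Lemma riesz_const_gt0 (R : realType) (n : nat) (alpha : R) :
  0 < alpha -> alpha < n%:R -> 0 < riesz_const n alpha.
Proof.
move=> a0 an; have g1 : 0 < Gamma ((n%:R - alpha) / 2) by apply: Gamma_gt0; rewrite divr_gt0// subr_gt0.
have g2 : 0 < Gamma (alpha / 2) by apply: Gamma_gt0; rewrite divr_gt0.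
rewrite /riesz_const; apply: divr_gt0 => //.
apply: mulr_gt0; last exact: powR_gt0.
by apply: mulr_gt0 => //; apply: powR_gt0; exact: pi_gt0.
Qed.

(** No cancellation occurs at x: the quotient is nonpositive by [hN], so the absolute value of its
    integral is the integral of its absolute value. *)
Lemma fraclap_bump_far_ge (R : realType) (n : nat) (beta a rho : R) (x : 'rV[R]_n) :
  0 < beta -> beta < 2 -> (0 < n)%N -> 0 <= a -> 0 < rho -> 4 * rho < enorm x ->
  `|fraclap_const n (beta / 2) : R| *
    (a * ((3 / 4) ^+ 4 * (rho / n%:R) ^+ n * (2 * enorm x) `^ (- (n%:R + beta)))) <=
  `|fraclap beta (fun y => a * qbump rho y) x|.
Proof.
move=> b0 b2 n0 a0 rho0 rx.
have kE : n%:R + 2 * (beta / 2) = n%:R + beta by rewrite mulrCA divff// mulr1.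
set L : R := (X in a * X).
pose h := diff2_quot beta (qbump rho) x.
have x0 : rho <= enorm x by lra.
have hN y : h y = - `|h y|.
  have E : 2 * qbump rho x - qbump rho y - qbump rho (x + x - y) =
           - (qbump rho y + qbump rho (x + x - y)).
    by rewrite (bump_far rho0 x0); ring.
  rewrite /h /diff2_quot E mulNr normrN; congr (- _); apply/esym; apply: ger0_norm.
  by apply: divr_ge0; [apply: addr_ge0; exact: bump_ge0|exact: powR_ge0].
have [C C0 bC] := bump_diff2_integral (n := n) b0 b2.
have [hC _] := bC rho x rho0; rewrite -/h in hC.
have mh : measurable_fun setT h by apply: measurable_diff2_quot; exact: measurable_bump.
have ih : (lebesgue_rV R n).-integrable setT (EFin \o h).
  apply/integrableP; split; first exact/measurable_EFinP.
  by apply: le_lt_trans hC _; rewrite ltry.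
have dE y : diff2_quot beta (fun y => a * qbump rho y) x y = a * h y.
  by rewrite /h /diff2_quot; ring.
have mb : measurable_fun setT (fun y : 'rV[R]_n => a * qbump rho y).
  by apply: measurable_funM => //; exact: measurable_bump.
rewrite (@fraclapE _ _ _ b0 b2 _ a)//; last 2 first.
- move=> y; have y0 := bump_ge0 rho y; rewrite ger0_norm; last by rewrite mulr_ge0.
  by rewrite ler_piMr ?bump_le1.
- under eq_integral do rewrite dE normrM ger0_norm// EFinM.
  rewrite ge0_integralZl//; last first.
    by apply/measurable_EFinP; exact: measurableT_comp.
  apply: (le_lt_trans (lee_wpmul2l _ hC)); first by rewrite lee_fin.
  by rewrite -EFinM ltry.
rewrite [leRHS]normrM; apply: ler_wpM2l => //.
have -> : \int[lebesgue_rV R n]_y diff2_quot beta (fun y0 => a * qbump rho y0) x y =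
   - (a * \int[lebesgue_rV R n]_y `|h y|).
  under eq_Rintegral do rewrite dE.
  rewrite RintegralZl// -mulrN; congr (_ * _).
  rewrite -mulN1r -RintegralZl//.
    by apply: eq_Rintegral => y _; rewrite mulN1r -hN.
  exact: integrable_abse ih.
rewrite mulrN normrN ger0_norm; last first.
  by rewrite !mulr_ge0// Rintegral_ge0.
rewrite [leRHS]mulrCA; apply: ler_wpM2l => //; rewrite ler_pdivlMl// -lee_fin.
rewrite /Rintegral fineK; last first.
  rewrite ge0_fin_numE; first by apply: le_lt_trans hC _; rewrite ltry.
  by apply: integral_ge0 => y _; rewrite lee_fin.
rewrite diff2_quot_far// EFinM lee_wpmul2l//.
by have := bump_kernel_ge b0 n0 rho0 rx; rewrite kE.
Qed.

(** * Smoothness of the test functions *)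

Section derivatives.
Context {R : realType}.

Lemma is_derive_cvg (V W : normedModType R) (f : V -> W) (x v : V) (d : W) :
  h^-1 *: (f (h *: v + x) - f x) @[h --> 0^'] --> d -> is_derive x v f d.
Proof.
move=> H; apply: DeriveDef; first by apply/cvg_ex; exists d.
exact: (cvg_lim (@norm_hausdorff _ _) H).
Qed.

Lemma is_derive_lineP (V W : normedModType R) (f : V -> W) (x v : V) (d : W) :
  is_derive x v f d <-> is_derive (0 : R) (1 : R) (fun h => f (h *: v + x)) d.
Proof.
have E' : (fun h : R => h^-1 *: (f ((h *: (1 : R) + 0) *: v + x) - f (0 *: v + x))) =
  (fun h : R => h^-1 *: (f (h *: v + x) - f x)).
  by apply/funext => h; rewrite !scale0r !add0r addr0 (_ : h%:A = h)//; exact: mulr1.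
split=> [[/cvg_ex[l fl] fd]|[/cvg_ex[l fl] fd]].
  apply: is_derive_cvg; rewrite E' -fd.
  by have := fl; rewrite /derive => /(cvg_lim (@norm_hausdorff _ _)) ->.
rewrite /= in fl fd.
apply: is_derive_cvg; rewrite -E' -fd.
by have := fl; rewrite /derive => /(cvg_lim (@norm_hausdorff _ _)) ->.
Qed.

(** Restriction to a line reduces this to the one-variable chain rule, so the inner function needs
    only a directional derivative. *)
Lemma is_derive_comp1 (V : normedModType R) (f : R -> R) (g : V -> R) (x v : V) (a b : R) :
  is_derive (g x) 1 f a -> is_derive x v g b -> is_derive x v (f \o g) (a * b).
Proof.
move=> fa /is_derive_lineP gb; apply/is_derive_lineP.
by apply: (is_derive1_comp (g := fun h => g (h *: v + x))) => //; rewrite scale0r add0r.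
Qed.

(** Away from 0 the function is locally zero or a power. At 0 its difference quotient is at most
    |h|^(k+1), which is why the exponent is at least 2. *)
Lemma is_derive_posX (k : nat) (a : R) :
  is_derive a 1 (fun s => Num.max 0 s ^+ k.+2) (k.+2%:R * Num.max 0 a ^+ k.+1).
Proof.
have [a0|a0|->] := ltgtP a 0.
- rewrite expr0n/= mulr0; apply: (@near_eq_is_derive _ _ _ (cst 0)).
    near=> s; rewrite /cst max_l ?expr0n//.
    by apply: ltW; near: s; exact: lt_nbhsl.
- apply: (@near_eq_is_derive _ _ _ (fun s : R => s ^+ k.+2)).
    near=> s; rewrite max_r//; apply: ltW; near: s; exact: lt_nbhsr.
  have := is_deriveX k.+2 (is_derive_id a (1 : R)).
  rewrite (_ : id ^+ k.+2 = (fun s : R => s ^+ k.+2)); last by rewrite exprfctE.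
  by move=> h; apply: is_derive_eq h _; exact: mulr1.
rewrite expr0n/= mulr0; apply: is_derive_cvg.
rewrite maxxx expr0n/=; apply/cvgr0Pnorm_le => e e0.
near=> h; rewrite addr0 /GRing.scale/= mulr1 subr0 normrM normfV.
have h0 : h != 0 by near: h; exact: nbhs_dnbhs_neq.
rewrite ler_pdivrMl ?normr_gt0//.
have he : `|h| <= e by near: h; apply: dnbhs0_le.
have h1 : `|h| <= 1 by near: h; apply: dnbhs0_le.
apply: (@le_trans _ _ (`|h| ^+ k.+2)).
  rewrite normrX; apply: lerXn2r; rewrite ?nnegrE//.
  by case: (leP 0 h) => // _; rewrite normr0.
rewrite exprS ler_wpM2l// exprS; apply: le_trans he.
by rewrite ler_piMr// exprn_ile1.
Unshelve. all: by end_near. Qed.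

End derivatives.

Section bump_derivatives.
Context {R : realType} {n : nat}.
Implicit Types (x y : 'rV[R]_n) (rho : R).

Lemma is_derive_coord x v (i : 'I_n) :
  is_derive x v (fun y : 'rV[R]_n => y 0 i) (v 0 i).
Proof.
apply: is_derive_cvg; apply: cvg_near_cst; near=> h.
rewrite !mxE addrK /GRing.scale/= mulKf//.
by near: h; exact: nbhs_dnbhs_neq.
Unshelve. all: by end_near. Qed.

Lemma is_derive_enorm_sqr x (i : 'I_n) :
  is_derive x (basis_vec R i) (fun y => enorm y ^+ 2) (2 * x 0 i).
Proof.
apply: is_derive_cvg.
have dotE h : \sum_j x 0 j * (h *: basis_vec R i) 0 j = h * x 0 i.
  rewrite (bigD1 i)//= big1 ?addr0; last first.
    by move=> j ji; rewrite !mxE eqxx (negbTE ji) !mulr0.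
  by rewrite !mxE !eqxx mulr1 mulrC.
have normE h : enorm (h *: basis_vec R i) ^+ 2 = h ^+ 2.
  rewrite enorm_sqr (bigD1 i)//= big1 ?addr0; last first.
    by move=> j ji; rewrite !mxE eqxx (negbTE ji) mulr0 expr0n.
  by rewrite !mxE !eqxx mulr1.
have E : {near (0 : R)^', (fun h => 2 * x 0 i + h) =1
   (fun h => h^-1 *: (enorm (h *: basis_vec R i + x) ^+ 2 - enorm x ^+ 2))}.
  near=> h; have h0 : h != 0 by near: h; exact: nbhs_dnbhs_neq.
  rewrite addrC (addrC (h *: _)) enormD_sqr dotE normE /GRing.scale/=.
  by field.
apply: cvg_trans (near_eq_cvg E) _.
rewrite -[X in _ `=>` nbhs X]addr0.
by apply: cvgD; [exact: cvg_cst|exact: cvg_within].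
Unshelve. all: by end_near. Qed.

Lemma is_derive_bump_pow (k : nat) rho x (i : 'I_n) :
  is_derive x (basis_vec R i) (fun y => bump_base rho y ^+ k.+2)
    (k.+2%:R * bump_base rho x ^+ k.+1 * (- (2 * x 0 i / rho ^+ 2))).
Proof.
pose g (y : 'rV[R]_n) := 1 - enorm y ^+ 2 / rho ^+ 2.
apply: (@is_derive_comp1 _ _ (fun s => Num.max 0 s ^+ k.+2) g).
  exact: is_derive_posX.
rewrite (_ : g = cst 1 - (rho ^+ 2)^-1 \*: (fun y => enorm y ^+ 2)); last first.
  by apply/funext => y; rewrite !fctE /g mulrC.
have := is_deriveB (is_derive_cst (1 : R) x (basis_vec R i))
  (is_deriveZ (rho ^+ 2)^-1 (is_derive_enorm_sqr x i)).
by move=> h; apply: is_derive_eq h _; rewrite sub0r; congr (- _); exact: mulrC.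
Qed.

Lemma is_derive_qbump rho x (i : 'I_n) :
  is_derive x (basis_vec R i) (qbump rho)
    (- (8 / rho ^+ 2) * (x 0 i * bump_base rho x ^+ 3)).
Proof.
have h := is_derive_bump_pow 2 rho x i; apply: is_derive_eq h _; ring.
Qed.

Definition diff2_qbump rho (i j : 'I_n) x :=
  - (8 / rho ^+ 2) * ((i == j)%:R * bump_base rho x ^+ 3
     - 6 / rho ^+ 2 * (x 0 i * x 0 j * bump_base rho x ^+ 2)).

Lemma is_derive2_qbump rho x (i j : 'I_n) :
  is_derive x (basis_vec R j)
    (fun y => - (8 / rho ^+ 2) * (y 0 i * bump_base rho y ^+ 3))
    (diff2_qbump rho i j x).
Proof.
have h := is_deriveZ (- (8 / rho ^+ 2))
  (is_deriveM (is_derive_coord x (basis_vec R j) i) (is_derive_bump_pow 1 rho x j)).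
apply: is_derive_eq h _; rewrite /diff2_qbump /GRing.scale/= !mxE eqxx/=; ring.
Qed.

Lemma is_derive_lincomb (V : normedModType R) (N : nat) (c : nat -> R)
    (f : nat -> V -> R) (df : nat -> R) (x v : V) :
  (forall k, is_derive x v (f k) (df k)) ->
  is_derive x v (fun y : V => \sum_(k < N) c k * f k y) (\sum_(k < N) c k * df k).
Proof.
move=> fdf; have h := is_derive_sum (fun k : 'I_N => is_deriveZ (c k) (fdf k)).
rewrite (_ : (fun y : V => _) = \sum_(k < N) (c k \*: f k)); first exact: h.
by apply/funext => y; rewrite fct_sumE.
Qed.

End bump_derivatives.

Lemma derive_is_derive (R : realType) (V W : normedModType R) (v : V) (f g : V -> W) :
  (forall x, is_derive x v f (g x)) -> 'D_v f = g.
Proof. by move=> fg; apply/funext => x; rewrite (derive_val (is_derive := fg x)). Qed.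

Section bump_sum.
Context {R : realType} {n : nat}.
Variables (N : nat) (c rho : nat -> R).

Definition bump_sum (x : 'rV[R]_n) : R := \sum_(k < N) c k * qbump (rho k) x.

Lemma is_derive_bump_sum x i : is_derive x (basis_vec R i) bump_sum
  (\sum_(k < N) c k * (- (8 / rho k ^+ 2) * (x 0 i * bump_base (rho k) x ^+ 3))).
Proof.
apply: (@is_derive_lincomb _ _ N c (fun k => qbump (rho k)) (fun k =>
  - (8 / rho k ^+ 2) * (x 0 i * bump_base (rho k) x ^+ 3))) => k.
exact: is_derive_qbump.
Qed.

Lemma derive_bump_sum i : 'D_(basis_vec R i) bump_sum =
  fun x => \sum_(k < N) c k * (- (8 / rho k ^+ 2) * (x 0 i * bump_base (rho k) x ^+ 3)).
Proof. by apply: derive_is_derive => x; exact: is_derive_bump_sum. Qed.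

Lemma is_derive2_bump_sum x i j :
  is_derive x (basis_vec R j) ('D_(basis_vec R i) bump_sum)
    (\sum_(k < N) c k * diff2_qbump (rho k) i j x).
Proof.
rewrite derive_bump_sum.
apply: (@is_derive_lincomb _ 'rV[R]_n N c (fun k (y : 'rV[R]_n) =>
  - (8 / rho k ^+ 2) * (y 0 i * bump_base (rho k) y ^+ 3))
  (fun k => diff2_qbump (rho k) i j x)) => k.
exact: is_derive2_qbump.
Qed.

Lemma derive2_bump_sum i j :
  'D_(basis_vec R j) ('D_(basis_vec R i) bump_sum) =
  fun x => \sum_(k < N) c k * diff2_qbump (rho k) i j x.
Proof. by apply: derive_is_derive => x; exact: is_derive2_bump_sum. Qed.

End bump_sum.

Section continuity.
Context {R : realType}.

Lemma continuous_sumR (T : topologicalType) (N : nat) (F : 'I_N -> T -> R) :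
  (forall i, continuous (F i)) -> continuous (fun z => \sum_(i < N) F i z).
Proof.
move=> cF; rewrite (_ : (fun z => _) = \sum_(i < N) F i); last first.
  by apply/funext => z; rewrite fct_sumE.
apply: (big_ind (fun f : T -> R => continuous f)) => //.
- by move=> z; exact: cvg_cst.
- by move=> f g cf cg z; apply: cvgD; [exact: cf|exact: cg].
Qed.

Lemma continuous_mulR (T : topologicalType) (f g : T -> R) :
  continuous f -> continuous g -> continuous (fun z => f z * g z).
Proof. by move=> cf cg z; apply: cvgM; [exact: cf|exact: cg]. Qed.

Lemma continuous_exprR (T : topologicalType) (f : T -> R) (k : nat) :
  continuous f -> continuous (fun z => f z ^+ k).
Proof.
move=> cf; elim: k => [|k IH]; first by move=> z; exact: cvg_cst.
rewrite (_ : (fun z => _) = fun z => f z * f z ^+ k); last by apply/funext => z; rewrite exprS.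
exact: continuous_mulR.
Qed.

Lemma continuous_posR (T : topologicalType) (f : T -> R) :
  continuous f -> continuous (fun z => Num.max 0 (f z)).
Proof.
move=> cf; rewrite (_ : (fun z => _) = fun z => 2^-1 * (f z + `|f z|)); last first.
  apply/funext => z; case: (leP 0 (f z)) => fz.
    by rewrite ger0_norm//; lra.
  by rewrite ltr0_norm//; lra.
apply: continuous_mulR; first by move=> z; exact: cvg_cst.
by move=> z; apply: cvgD; [exact: cf|apply: cvg_norm; exact: cf].
Qed.

Lemma continuous_space_coord (n : nat) (i : 'I_n) :
  continuous (fun z : R * 'rV[R]_n => z.2 0 i).
Proof.
move=> z; apply: (@continuous_comp _ _ _ snd (fun y : 'rV[R]_n => y 0 i)).
  exact: cvg_snd.
exact: coord_continuous.
Qed.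

Lemma continuous_bump_base (n : nat) (rho : R) :
  continuous (fun z : R * 'rV[R]_n => bump_base rho z.2).
Proof.
apply: continuous_posR => z; apply: cvgB; first exact: cvg_cst.
apply: cvgM; last exact: cvg_cst.
rewrite (_ : (fun z => _) = fun z : R * 'rV[R]_n => \sum_i z.2 0 i ^+ 2); last first.
  by apply/funext => y; rewrite enorm_sqr.
rewrite [X in _ --> X]enorm_sqr; apply: continuous_sumR => i.
exact/continuous_exprR/continuous_space_coord.
Qed.

End continuity.

Section time_cutoff.
Context {R : realType}.
Variables (tau : R) (tau0 : 0 < tau).

(** The fourth power serves as in [qbump]: the derivative is a multiple of the cube of the base,
    hence bounded by a multiple of [cutoff]^(1/r) for r > 2 and t >= 0. Vanishing at [tau] removes
    the final-time term of the weak identity. *)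
Definition cutoff (t : R) : R := Num.max 0 (1 - t / tau) ^+ 4.

Definition cutoff' (t : R) : R := - (4 / tau) * Num.max 0 (1 - t / tau) ^+ 3.

Lemma is_derive_cutoff (t : R) : is_derive t (1 : R) cutoff (cutoff' t).
Proof.
pose g (s : R) := 1 - s / tau.
have dg : is_derive t 1 g (- tau^-1).
  rewrite (_ : g = cst 1 - tau^-1 \*: id); last first.
    by apply/funext => s; rewrite !fctE /g mulrC.
  have h := is_deriveB (is_derive_cst (1 : R) t (1 : R)) (is_deriveZ tau^-1 (is_derive_id t (1 : R))).
  by apply: is_derive_eq h _; rewrite sub0r; congr (- _); exact: mulr1.
have h := is_derive_comp1 (is_derive_posX 2 (g t)) dg.
by apply: is_derive_eq h _; rewrite /cutoff' /g; ring.
Qed.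

Lemma cutoff_ge0 t : 0 <= cutoff t.
Proof. by rewrite exprn_ge0// le_max lexx. Qed.

Lemma cutoff_base_le1 t : 0 <= t -> Num.max 0 (1 - t / tau) <= 1.
Proof. by move=> t0; rewrite ge_max ler01/= gerBl divr_ge0// ltW. Qed.

Lemma cutoff_le1 t : 0 <= t -> cutoff t <= 1.
Proof. by move=> t0; rewrite exprn_ile1 ?cutoff_base_le1// le_max lexx. Qed.

Lemma cutoff0 : cutoff 0 = 1.
Proof. by rewrite /cutoff mul0r subr0 max_r// expr1n. Qed.

Lemma cutoff_late t : tau <= t -> cutoff t = 0.
Proof.
move=> t1; rewrite /cutoff max_l ?expr0n//.
by rewrite subr_le0 ler_pdivlMr// mul1r.
Qed.

Lemma cutoff_early t : t <= tau / 2 -> (1 / 2) ^+ 4 <= cutoff t.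
Proof.
move=> t1; rewrite /cutoff lerXn2r ?nnegrE ?le_max ?lexx//.
by apply/orP; right; rewrite lerBrDl -lerBrDr ler_pdivrMr//; lra.
Qed.

Lemma continuous_cutoff (T : topologicalType) (f : T -> R) :
  continuous f -> continuous (cutoff \o f).
Proof.
move=> cf; apply/continuous_exprR/continuous_posR => z.
apply: cvgB; first exact: cvg_cst.
by apply: cvgM; [exact: cf|exact: cvg_cst].
Qed.

Lemma continuous_cutoff' (T : topologicalType) (f : T -> R) :
  continuous f -> continuous (cutoff' \o f).
Proof.
move=> cf; apply: continuous_mulR; first by move=> z; exact: cvg_cst.
apply/continuous_exprR/continuous_posR => z.
apply: cvgB; first exact: cvg_cst.
by apply: cvgM; [exact: cf|exact: cvg_cst].
Qed.

End time_cutoff.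

(** Without properness the limit in [time_deriv] would not be unique; for t = 0 only positive
    increments remain. *)
Lemma time_nbhs_proper (R : realType) (t : R) : 0 <= t -> ProperFilter (time_nbhs t).
Proof.
move=> t0; apply: Build_ProperFilter_ex => A; rewrite /time_nbhs /within/= => nA.
have /nbhs_ballP[e /= e0 eA] : nbhs (0 : R) (fun h => h != 0 -> 0 <= t + h -> A h) by exact: nA.
exists (e / 2); apply: eA.
- by rewrite /ball/= sub0r normrN ger0_norm ?divr_ge0 ?(ltW e0)// ltr_pdivrMr// ltr_pMr// ltr1n.
- by rewrite gt_eqF// divr_gt0.
- by rewrite addr_ge0// divr_ge0// ltW.
Qed.

Section test_functions.
Context {R : realType} {n : nat}.
Variables (tau : R) (tau0 : 0 < tau) (N : nat) (c rho : nat -> R) (rhomax : R).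
Hypothesis rho0 : forall k, 0 < rho k.
Hypothesis rhoP : forall k, (k < N)%N -> rho k <= rhomax.

(** The time factor sits in the coefficients so that each time slice is itself a [bump_sum], to
    which the spatial derivatives and the bounds on [fraclap] apply directly. *)
Definition test_fun (t : R) : 'rV[R]_n -> R :=
  bump_sum N (fun k => cutoff tau t * c k) rho.

Lemma test_funE t x : test_fun t x = cutoff tau t * bump_sum N c rho x.
Proof. by rewrite /test_fun /bump_sum mulr_sumr; apply: eq_bigr => k _; rewrite mulrA. Qed.

Lemma time_quot_cvg t x :
  time_quot test_fun t x h @[h --> time_nbhs t] --> cutoff' tau t * bump_sum N c rho x.
Proof.
apply: cvg_within_filter.
have [dt <-] := is_derive_cutoff tau t.
have E : time_quot test_fun t x = (fun h =>
    h^-1 *: (cutoff tau (h *: (1 : R) + t) - cutoff tau t) * bump_sum N c rho x).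
  apply/funext => h; rewrite /time_quot !test_funE -mulrBl mulrA.
  by rewrite [h *: 1]mulr1 (addrC h).
rewrite E; apply: cvgM; last exact: cvg_cst.
exact: dt.
Qed.

Lemma time_deriv_test_fun t x : 0 <= t ->
  time_deriv test_fun t x = cutoff' tau t * bump_sum N c rho x.
Proof.
move=> t0; have ? := time_nbhs_proper t0.
exact: (cvg_lim (@norm_hausdorff _ _) (time_quot_cvg (x := x))).
Qed.

Lemma test_funP : test_function +oo test_fun.
Proof.
have cX k : continuous (fun z : R * 'rV[R]_n => bump_base (rho k) z.2).
  exact: continuous_bump_base.
have cT : continuous (fun z : R * 'rV[R]_n => cutoff tau z.1).
  by apply: continuous_cutoff => z; exact: cvg_fst.
have cc k : continuous (fun z : R * 'rV[R]_n => cutoff tau z.1 * c k).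
  by apply: continuous_mulR => // z; exact: cvg_cst.
have cB : continuous (fun z : R * 'rV[R]_n => bump_sum N c rho z.2).
  apply: continuous_sumR => k; apply: continuous_mulR; first by move=> z; exact: cvg_cst.
  exact: continuous_exprR.
split.
  split.
  - apply: continuous_subspaceT; apply: continuous_sumR => k.
    by apply: continuous_mulR => //; exact: continuous_exprR.
  - by move=> z _; apply/cvg_ex; eexists; exact: time_quot_cvg.
  - apply: (@subspace_eq_continuous _ _ _ (fun z => cutoff' tau z.1 * bump_sum N c rho z.2)).
      by move=> z; rewrite inE => -[z0 _]; exact/esym/time_deriv_test_fun.
    apply: continuous_subspaceT; apply: continuous_mulR => //.
    by apply: continuous_cutoff' => z; exact: cvg_fst.
  - move=> i z _; have [h _] := is_derive_bump_sum N (fun k => cutoff tau z.1 * c k) rho z.2 i.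
    exact: h.
  - move=> i; apply: continuous_subspaceT.
    have E (z : R * 'rV[R]_n) := congr1 (fun f => f z.2)
      (derive_bump_sum N (fun k => cutoff tau z.1 * c k) rho i).
    rewrite (funext E) => {E}.
    apply: continuous_sumR => k; apply: continuous_mulR => //.
    apply: continuous_mulR; first by move=> z; exact: cvg_cst.
    apply: continuous_mulR; first exact: continuous_space_coord.
    exact: continuous_exprR.
  - move=> i j z _; have [h _] := is_derive2_bump_sum N (fun k => cutoff tau z.1 * c k) rho z.2 i j.
    exact: h.
  - move=> i j; apply: continuous_subspaceT.
    have E (z : R * 'rV[R]_n) := congr1 (fun f => f z.2)
      (derive2_bump_sum N (fun k => cutoff tau z.1 * c k) rho i j).
    rewrite (funext E) => {E}.
    apply: continuous_sumR => k; apply: continuous_mulR => //.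
    apply: continuous_mulR; first by move=> z; exact: cvg_cst.
    move=> z; apply: cvgB.
      apply: cvgM; first exact: cvg_cst.
      exact: (continuous_exprR (k := 3) (cX k)).
    apply: cvgM; first exact: cvg_cst.
    apply: cvgM; last exact: (continuous_exprR (k := 2) (cX k)).
    by apply: cvgM; exact: continuous_space_coord.
exists (`[0, tau]%classic `*` [set x : 'rV[R]_n | forall i, `[- rhomax, rhomax]%classic (x ord0 i)]).
split.
- apply: compact_setX; first exact: segment_compact.
  by apply: (rV_compact (A := fun=> `[- rhomax, rhomax]%classic)) => i; exact: segment_compact.
- by move=> z [/= + _]; rewrite in_itv/= => /andP[z0 _]; split => //; rewrite ltry.
- move=> z [z0 _] nK; rewrite test_funE.
  have [zt|tz] := leP tau z.1; first by rewrite cutoff_late// mul0r.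
  rewrite /bump_sum big1 ?mulr0// => k _.
  rewrite bump_far ?mulr0//; apply: contrapT => /negP; rewrite -ltNge => zr.
  apply: nK; split => /=; first by rewrite in_itv/= z0 ltW.
  move=> i; rewrite in_itv/= -ler_norml.
  by rewrite (le_trans (coord_le_enorm _ _))// (le_trans (ltW zr))// rhoP.
Qed.

End test_functions.

Section laplacian_bump.
Context {R : realType} {n : nat}.

Lemma laplacian_bump_sum N (c rho : nat -> R) (x : 'rV[R]_n) :
  laplacian (bump_sum N c rho) x = \sum_(i < n) \sum_(k < N) c k * diff2_qbump (rho k) i i x.
Proof.
apply: eq_bigr => i _.
exact: (congr1 (fun f => f x) (derive2_bump_sum N c rho i i)).
Qed.

(** The right-hand side is w^(4/r) with 4/r < 2. Here the fourth power of the bumps meets the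
    hypothesis r > 2. *)
Lemma sqr_le_powR_quartic (w r : R) : 2 < r -> 0 <= w <= 1 ->
  w ^+ 2 <= (w ^+ 4) `^ r^-1.
Proof.
move=> r2 /andP[]; rewrite le_eqVlt => /predU1P[<- _|w0 w1].
  by rewrite expr0n/= powR_ge0.
rewrite -(powR_mulrn 4 (ltW w0)) -powRrM -(powR_mulrn 2 (ltW w0)).
apply: ger_powR; first by rewrite w0.
by rewrite ler_pdivrMr//; lra.
Qed.

Lemma cube_le_powR_quartic (w r : R) : 2 < r -> 0 <= w <= 1 ->
  w ^+ 3 <= (w ^+ 4) `^ r^-1.
Proof.
move=> r2 w01; have /andP[w0 w1] := w01.
by apply: le_trans (sqr_le_powR_quartic r2 w01); rewrite exprS ler_piMl// sqr_ge0.
Qed.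

Lemma laplacian_bump_le (c rho r : R) (x : 'rV[R]_n) : 0 <= c -> 0 < rho -> 2 < r ->
  `|laplacian (bump_sum 1 (fun=> c) (fun=> rho)) x| <=
  c * (n%:R * 56 / rho ^+ 2) * qbump rho x `^ r^-1.
Proof.
move=> c0 rho0 r2; rewrite laplacian_bump_sum.
set w := bump_base rho x.
have w01 : 0 <= w <= 1 by rewrite bump_base_ge0 bump_base_le1.
have /andP[w0 w1] := w01.
have rho2 : 0 < rho ^+ 2 by rewrite exprn_gt0.
(* The factor 56 is 8 times 7: inside the ball u = x_i^2/rho^2 is at most 1, so |6 u w^2 - w^3| <= 7
   w^2. *)
apply: (@le_trans _ _ (\sum_(i < n) c * (56 / rho ^+ 2 * w ^+ 2))).
  apply: le_trans (ler_norm_sum _ _ _) _; apply: ler_sum => i _.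
  rewrite big_ord1 normrM (ger0_norm c0) ler_wpM2l//.
  rewrite /diff2_qbump eqxx mul1r -/w.
  have [rx|xr] := leP rho (enorm x).
    rewrite /w bump_base_far// !expr0n/= !mulr0 subr0 mulr0 normr0.
    by [].
  have xi2 : x 0 i * x 0 i <= rho ^+ 2.
    have := coord_le_enorm x i; rewrite -expr2 -(real_normK (num_real (x 0 i))) => h.
    by rewrite lerXn2r ?nnegrE ?(ltW rho0)// (le_trans h)// ltW.
  have xi0 : 0 <= x 0 i * x 0 i by rewrite -expr2 sqr_ge0.
  pose u := x 0 i * x 0 i / rho ^+ 2.
  have u0 : 0 <= u by rewrite divr_ge0 ?(ltW rho2).
  have u1 : u <= 1 by rewrite ler_pdivrMr// mul1r.
  have -> : - (8 / rho ^+ 2) * (w ^+ 3 - 6 / rho ^+ 2 * (x 0 i * x 0 i * w ^+ 2)) =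
      8 / rho ^+ 2 * (6 * u * w ^+ 2 - w ^+ 3).
    by rewrite /u; field; rewrite gt_eqF.
  rewrite normrM (ger0_norm (x := 8 / _)) ?divr_ge0 ?(ltW rho2)//.
  have -> : 56 / rho ^+ 2 * w ^+ 2 = 8 / rho ^+ 2 * (7 * w ^+ 2).
    by field; rewrite gt_eqF.
  rewrite ler_wpM2l ?divr_ge0 ?(ltW rho2)//.
  have w2 : 0 <= w ^+ 2 by rewrite sqr_ge0.
  have w3 : w ^+ 3 <= w ^+ 2 by rewrite exprS ler_piMl.
  have w30 : 0 <= w ^+ 3 by rewrite exprn_ge0.
  have uw : u * w ^+ 2 <= w ^+ 2 by rewrite ler_piMl.
  have uw0 : 0 <= u * w ^+ 2 by rewrite mulr_ge0.
  by rewrite ler_norml -mulrA; lra.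
rewrite sumr_const card_ord -[leLHS]mulr_natl.
have -> : n%:R * (c * (56 / rho ^+ 2 * w ^+ 2)) = c * (n%:R * 56 / rho ^+ 2) * w ^+ 2.
  by ring.
apply: ler_wpM2l; last exact: sqr_le_powR_quartic.
by rewrite mulr_ge0// divr_ge0 ?(ltW rho2)// mulr_ge0.
Qed.

End laplacian_bump.

(** * The weak formulation *)

Section ae_product.
Context d1 d2 (T1 : measurableType d1) (T2 : measurableType d2) (R : realType).
Variables (m1 : {sigma_finite_measure set T1 -> \bar R})
          (m2 : {sigma_finite_measure set T2 -> \bar R}).

Lemma ae_product_section (P : T1 * T2 -> Prop) :
  (\forall z \ae (m1 \x m2)%E, P z) ->
  \forall x \ae m1, \forall y \ae m2, P (x, y).
Proof.
move=> [A [mA A0 PA]].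
have mx : measurable_fun setT (m2 \o xsection A) by exact: measurable_fun_xsection.
have : (\int[m1]_x `|(m2 \o xsection A) x| = 0)%E.
  rewrite -[RHS]A0; apply: eq_integral => x _; rewrite gee0_abs//.
move/(ae_eq_integral_abs m1 measurableT mx); apply: filterS => x /(_ Logic.I) /= Ax0.
exists (xsection A x); split => //; first exact: measurable_xsection.
by move=> y /= nP; rewrite /xsection/= inE; exact: PA.
Qed.

Lemma ae_product_fst (P : T1 -> Prop) :
  (\forall x \ae m1, P x) -> \forall z \ae (m1 \x m2)%E, P z.1.
Proof.
move=> [A [mA A0 PA]]; exists (A `*` setT); split.
- exact: measurableX.
- rewrite product_measure1E// [X in (X * _)%E](_ : _ = 0%E) ?mul0e//.
- by move=> z /= nP; split => //; exact: PA.
Qed.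

End ae_product.

Section borel_representative.
Context {R : realType} {n : nat}.

Let cyl (m : nat) : set (R * 'rV[R]_n) :=
  `[m.+1%:R^-1, m.+1%:R]%classic `*`
  [set x : 'rV[R]_n | forall i, `[- m.+1%:R, m.+1%:R]%classic (x ord0 i)].

Let compact_cyl m : compact (cyl m).
Proof.
apply: compact_setX; first exact: segment_compact.
move: (m.+1%:R : R) => M.
by apply: (rV_compact (A := fun=> `[- M, M]%classic)) => i; exact: segment_compact.
Qed.

Let cyl_strip m : cyl m `<=` strip_open +oo.
Proof.
move=> z [/= + _]; rewrite in_itv/= => /andP[z0 _]; split; last by rewrite ltry.
by rewrite (lt_le_trans _ z0).
Qed.

Let measurable_cyl m : measurable (cyl m : set (measurableTypeR R * 'rV[R]_n)).
Proof.
apply: measurableX => //.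
rewrite (_ : [set x | _] = [set y : 'rV[R]_n | forall i,
   (const_mx (- m.+1%:R) : 'rV[R]_n) 0 i <= y 0 i <= (const_mx m.+1%:R : 'rV[R]_n) 0 i]).
  exact: measurable_box.
by apply/seteqP; split => y /= H i; have := H i; rewrite !mxE in_itv.
Qed.

(* The a.e. representatives given on an exhaustion by compact sets are glued by a
   limsup. *)
Lemma exists_borel_rep (u : R -> 'rV[R]_n -> R) :
  L1loc_strip +oo (fun z => (u z.1 z.2)%:E) ->
  exists2 v : measurableTypeR R * 'rV[R]_n -> R, measurable_fun setT v &
  \forall z \ae lebesgue_tx R n, 0 < z.1 -> u z.1 z.2 = v z.
Proof.
move=> uL.
have [g gP] : {g : nat -> measurableTypeR R * 'rV[R]_n -> \bar R & forall m,
    (lebesgue_tx R n).-integrable (cyl m) (g m) /\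
    ((fun z => (u z.1 z.2)%:E) = g m %[ae lebesgue_tx R n in cyl m])}.
  apply: (@choice _ _ (fun m (g : measurableTypeR R * 'rV[R]_n -> \bar R) =>
    (lebesgue_tx R n).-integrable (cyl m) g /\
    ((fun z => (u z.1 z.2)%:E) = g %[ae lebesgue_tx R n in cyl m]))) => m.
  by have [g ? ?] := uL _ (@compact_cyl m) (@cyl_strip m); exists g.
pose v z := fine (limn_esup (fun m => (g m \_ (cyl m)) z)).
exists v.
  apply: (measurableT_comp (fine_measurable measurableT)).
  apply: measurable_fun_limn_esup => m.
  apply/(measurable_restrict _ (measurable_cyl m) measurableT).
  by rewrite setTI; have [/measurable_int] := gP m.
have : \forall z \ae lebesgue_tx R n, forall m, cyl m z -> (u z.1 z.2)%:E = g m z.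
  by apply: ae_foralln => m; have [] := gP m.
have ? := ae_filter_ringOfSetsType (lebesgue_tx R n).
apply: filterS => z zg z0; rewrite /v.
suff -> : limn_esup (fun m => (g m \_ (cyl m)) z) = (u z.1 z.2)%:E by [].
suff /cvg_limn_einf_sup[_ ->] : (fun m => (g m \_ (cyl m)) z) @ \oo --> (u z.1 z.2)%:E by [].
apply: cvg_near_cst.
(* This sum bounds all three quantities that decide membership in [cyl m], so z lies in every late
   cylinder and the sequence is eventually constant. *)
pose M := Num.bound (z.1^-1 + z.1 + enorm z.2).
have MP : z.1^-1 + z.1 + enorm z.2 < M%:R.
  by apply: archi_boundP; rewrite !addr_ge0 ?invr_ge0 ?enorm_ge0 ?ltW.
near=> m.
have Mm : (M <= m)%N by near: m; exact: nbhs_infty_ge.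
have MR : z.1^-1 + z.1 + enorm z.2 < m.+1%:R.
  by rewrite (lt_le_trans MP)// ler_nat (leq_trans Mm).
have zi : 0 < z.1^-1 by rewrite invr_gt0.
have e0 := enorm_ge0 z.2.
have zc : cyl m z.
  split => /=.
    rewrite in_itv/=; apply/andP; split; last by lra.
    by rewrite -[leRHS]invrK lef_pV2 ?posrE ?ltr0n//; lra.
  move=> i; rewrite in_itv/= -ler_norml.
  by apply: le_trans (coord_le_enorm z.2 i) _; lra.
by rewrite patchE mem_set//; exact/esym/zg.
Unshelve. all: by end_near. Qed.

End borel_representative.

Section source_measurability.
Context {R : realType} {n : nat}.
Variables (p q alpha : R).

Lemma measurable_riesz_potential (v : measurableTypeR R * 'rV[R]_n -> R) :
  measurable_fun setT v ->
  measurable_fun setT (fun z : measurableTypeR R * 'rV[R]_n =>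
    riesz_potential alpha (fun y => `|v (z.1, y)| `^ p) z.2).
Proof.
move=> mv; apply: emeasurable_funM; first exact: measurable_cst.
pose h (w : (measurableTypeR R * 'rV[R]_n) * 'rV[R]_n) : \bar R :=
  (`|v (w.1.1, w.2)| `^ p / enorm (w.1.2 - w.2) `^ (n%:R - alpha))%:E.
apply: (@measurable_fun_fubini_tonelli_F _ _ _ _ _ (lebesgue_rV R n) h); last first.
  by move=> w; rewrite lee_fin divr_ge0 ?powR_ge0.
apply/measurable_EFinP; apply: measurable_funM.
  apply: (measurableT_comp (measurable_powR p)); apply: measurableT_comp => //.
  apply: (measurableT_comp mv); apply: measurable_fun_pair => //.
  exact: (measurableT_comp measurable_fst).
rewrite (_ : (fun w => _) = fun w : (measurableTypeR R * 'rV[R]_n) * 'rV[R]_n =>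
    enorm (w.1.2 - w.2) `^ (- (n%:R - alpha))); last first.
  by apply/funext => w; rewrite powRN.
apply: (measurableT_comp (measurable_powR _)); apply: measurable_fun_enorm.
apply: measurable_fun_rVB => //.
exact: (measurableT_comp measurable_snd).
Qed.

Lemma measurable_source (v : measurableTypeR R * 'rV[R]_n -> R) :
  measurable_fun setT v ->
  measurable_fun setT (source p q alpha (fun t x => v (t, x))).
Proof.
move=> mv; apply: emeasurable_funM; first exact: measurable_riesz_potential.
apply/measurable_EFinP; apply: (measurableT_comp (measurable_powR q)).
apply: measurableT_comp => //.
by rewrite (_ : (fun z => _) = v)//; apply/funext => -[].
Qed.

(** The potential at (t, x) depends on the whole slice at time t. By Fubini, for almost every t the
    slices of [u] and [v] agree almost everywhere, so their potentials agree at every x. *)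
Lemma source_ae_eq (u : R -> 'rV[R]_n -> R) (v : measurableTypeR R * 'rV[R]_n -> R) :
  (\forall z \ae lebesgue_tx R n, 0 < z.1 -> u z.1 z.2 = v z) ->
  \forall z \ae lebesgue_tx R n, 0 < z.1 ->
    source p q alpha u z = source p q alpha (fun t x => v (t, x)) z.
Proof.
move=> uv; have F := ae_filter_ringOfSetsType (lebesgue_tx R n).
have ae_t : \forall z \ae lebesgue_tx R n, \forall y \ae lebesgue_rV R n,
    0 < z.1 -> u z.1 y = v (z.1, y).
  have := ae_product_section uv.
  exact: (@ae_product_fst _ _ _ _ _ (@lebesgue_measure R) (lebesgue_rV R n)
    (fun t => \forall y \ae lebesgue_rV R n, 0 < t -> u t y = v (t, y))).
apply: filterS2 uv ae_t.
move=> [t x] uvz uvt t0.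
have F2 := ae_filter_ringOfSetsType (lebesgue_rV R n).
have H : (fun y => (`|u t y| `^ p / enorm (x - y) `^ (n%:R - alpha))%:E) =
    (fun y => (`|v (t, y)| `^ p / enorm (x - y) `^ (n%:R - alpha))%:E)
    %[ae lebesgue_rV R n in setT].
  by apply: filterS uvt => y /(_ t0) uvy _; rewrite /= in uvy; rewrite uvy.
rewrite /source (uvz t0) /riesz_potential.
by rewrite (Defs.integral_ae_eq H).
Qed.

End source_measurability.

Lemma ge0_integral_setX d1 d2 (T1 : measurableType d1) (T2 : measurableType d2)
    (R : realType) (m1 : {sigma_finite_measure set T1 -> \bar R})
    (m2 : {sigma_finite_measure set T2 -> \bar R}) (A : set T1) (B : set T2)
    (f : T1 * T2 -> \bar R) :
  measurable A -> measurable B -> measurable_fun setT f ->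
  (forall z, (0 <= f z)%E) ->
  (\int[m1 \x m2]_(z in A `*` B) f z =
   \int[m1]_(x in A) \int[m2]_(y in B) f (x, y))%E.
Proof.
move=> mA mB mf f0; have mAB := measurableX mA mB.
rewrite integral_mkcond fubini_tonelli1; last 2 first.
- by apply/(measurable_restrict _ mAB measurableT); exact: measurable_funTS.
- by move=> z; rewrite patchE; case: ifP.
rewrite [RHS]integral_mkcond; apply: eq_integral => x _.
rewrite /fubini_F patchE; case: ifPn => [|nA].
  rewrite inE => Ax; rewrite [RHS]integral_mkcond; apply: eq_integral => y _.
  rewrite !patchE; case: ifPn => [|nAB]; case: ifPn => [|nB] //.
  - by move: nB => /[swap]; rewrite inE => -[_ /= By]; rewrite notin_setE.
  - by rewrite inE => By; move: nAB; rewrite notin_setE; case.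
rewrite integral0_eq// => y _; rewrite patchE ifF//.
by apply/negbTE; move: nA; rewrite !notin_setE => nA [].
Qed.

(** * Lower bounds for the Riesz potential and the source term *)

Section riesz_lower_bound.
Context {R : realType} {n : nat}.
Variables (p q alpha : R) (alpha_gt0 : 0 < alpha) (alpha_ltn : alpha < n%:R).

Lemma measurable_riesz_potential_slice (v : 'rV[R]_n -> R) :
  measurable_fun setT v ->
  measurable_fun setT (riesz_potential alpha (fun y => `|v y| `^ p)).
Proof.
move=> mv.
have mvs : measurable_fun setT (fun z : measurableTypeR R * 'rV[R]_n => v z.2).
  exact: (measurableT_comp mv).
have := @measurable_riesz_potential R n p alpha (fun z => v z.2) mvs.
have mp : measurable_fun setT (fun x : 'rV[R]_n => (0 : measurableTypeR R, x)).
  exact: measurable_fun_pair.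
by move=> h; exact: (measurableT_comp h mp).
Qed.

Lemma riesz_potential_ge0 (v : 'rV[R]_n -> R) x :
  (forall y, 0 <= v y) -> (0 <= riesz_potential alpha v x)%E.
Proof.
move=> v0; apply: mule_ge0; first by rewrite lee_fin ltW// riesz_const_gt0.
by apply: integral_ge0 => y _; rewrite lee_fin divr_ge0 ?powR_ge0.
Qed.

Definition riesz_local_const (d : R) : R := riesz_const n alpha * d `^ (alpha - n%:R).

Lemma riesz_potential_local_ge (A : set 'rV[R]_n) (v : 'rV[R]_n -> R) (d : R) x :
  measurable A -> measurable_fun setT v -> 0 < d ->
  A x -> (forall y, A y -> enorm (x - y) <= d) ->
  ((riesz_local_const d)%:E * \int[lebesgue_rV R n]_(y in A) (`|v y| `^ p)%:E <=
   riesz_potential alpha (fun y => `|v y| `^ p)%R x)%E.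
Proof.
move=> mA mv d0 Ax Ad.
have n0 : (0 < n)%N by rewrite -(ltr0n R) (lt_trans alpha_gt0).
have C0 := riesz_const_gt0 alpha_gt0 alpha_ltn.
have mvp : measurable_fun setT (fun y => `|v y| `^ p).
  by apply: (measurableT_comp (measurable_powR p)); exact: measurableT_comp.
rewrite /riesz_local_const EFinM -muleA /riesz_potential.
apply: lee_wpmul2l; first by rewrite lee_fin ltW.
rewrite -ge0_integralZl//; last 2 first.
- by apply/measurable_EFinP; exact: measurable_funTS.
- by rewrite lee_fin powR_ge0.
have mk : measurable_fun setT (fun y => (`|v y| `^ p / enorm (x - y) `^ (n%:R - alpha))%:E).
  by apply/measurable_EFinP; apply: measurable_funM => //; exact: measurable_inv_enorm_kernel.
apply: (@le_trans _ _ (\int[lebesgue_rV R n]_(y in A)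
    (`|v y| `^ p / enorm (x - y) `^ (n%:R - alpha))%:E)%E); last first.
  by apply: ge0_subset_integral => // y _; rewrite lee_fin divr_ge0 ?powR_ge0.
apply: ae_ge0_le_integral => //.
- by move=> y _; rewrite -EFinM lee_fin mulr_ge0 ?powR_ge0.
- by apply: emeasurable_funM => //; apply/measurable_EFinP; exact: measurable_funTS.
- by move=> y _; rewrite lee_fin divr_ge0 ?powR_ge0.
- exact: measurable_funTS.
(* The point y = x must be discarded: there the kernel takes the value 0 instead of being large. *)
exists [set x]; split.
- rewrite (_ : [set x] = [set y : 'rV[R]_n | forall i, x 0 i <= y 0 i <= x 0 i]).
    exact: measurable_box.
  apply/seteqP; split => y /= => [-> i|H]; first by rewrite lexx.
  by apply/rowP => i; apply/esym/eqP; rewrite eq_le.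
- exact: lebesgue_rV_set1.
- move=> y /= nP; apply: contrapT => yx; apply: nP => Ay.
  rewrite -EFinM lee_fin mulrC ler_wpM2l ?powR_ge0//.
  have xy0 : 0 < enorm (x - y).
    by apply: enorm_gt0; rewrite subr_eq0; apply/eqP => xy; apply: yx; rewrite xy.
  rewrite -(opprB n%:R alpha) powRN lef_pV2 ?posrE ?powR_gt0//.
  apply: ge0_ler_powR; rewrite ?nnegrE ?enorm_ge0 ?(ltW d0) ?Ad//.
  by rewrite subr_ge0 ltW.
Qed.

(** On [A] the potential is at least a constant, which comes out of the integral. The resulting
    product of two integrals over the same set is what Cauchy-Schwarz needs. *)
Lemma source_local_ge (A : set 'rV[R]_n) (v W : 'rV[R]_n -> R) (d : R) :
  measurable A -> measurable_fun setT v -> measurable_fun setT W ->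
  (forall x, 0 <= W x) -> 0 < d ->
  (forall x y, A x -> A y -> enorm (x - y) <= d) ->
  ((riesz_local_const d)%:E *
   (\int[lebesgue_rV R n]_(y in A) (`|v y| `^ p)%:E *
    \int[lebesgue_rV R n]_(x in A) (`|v x| `^ q * W x)%:E) <=
   \int[lebesgue_rV R n]_(x in A)
     (riesz_potential alpha (fun y => `|v y| `^ p)%R x * (`|v x| `^ q)%:E * (W x)%:E))%E.
Proof.
move=> mA mv mW W0 d0 Ad.
have C0 := riesz_const_gt0 alpha_gt0 alpha_ltn.
have mvq : measurable_fun setT (fun y => `|v y| `^ q).
  by apply: (measurableT_comp (measurable_powR q)); exact: measurableT_comp.
have mqW : measurable_fun A (fun x => (`|v x| `^ q * W x)%:E).
  by apply/measurable_EFinP; apply: measurable_funTS; exact: measurable_funM.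
have c0 : (0 <= (riesz_local_const d)%:E)%E.
  by rewrite lee_fin mulr_ge0 ?powR_ge0 ?ltW.
have P0 : (0 <= \int[lebesgue_rV R n]_(y in A) (`|v y| `^ p)%:E)%E.
  by apply: integral_ge0 => y _; rewrite lee_fin powR_ge0.
rewrite muleA -ge0_integralZl//; last 2 first.
- by move=> x _; rewrite lee_fin mulr_ge0 ?powR_ge0.
- exact: mule_ge0.
apply: ge0_le_integral => //.
- by move=> x _; rewrite mule_ge0 ?mule_ge0// lee_fin mulr_ge0 ?powR_ge0.
- exact: emeasurable_funM.
- apply: measurable_funTS; apply: emeasurable_funM; last exact/measurable_EFinP.
  apply: emeasurable_funM; last exact/measurable_EFinP.
  exact: measurable_riesz_potential_slice.
- move=> x Ax; rewrite [X in (_ * X <= _)%E]EFinM [leLHS]muleA.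
  apply: lee_wpmul2r; first by rewrite lee_fin.
  apply: lee_wpmul2r; first by rewrite lee_fin powR_ge0.
  by apply: riesz_potential_local_ge => // y Ay; exact: Ad.
Qed.

End riesz_lower_bound.

Lemma measurable_integral_section d1 d2 (T1 : measurableType d1) (T2 : measurableType d2)
    (R : realType) (m2 : {sigma_finite_measure set T2 -> \bar R}) (B : set T2)
    (f : T1 * T2 -> \bar R) :
  measurable B -> measurable_fun setT f -> (forall z, (0 <= f z)%E) ->
  measurable_fun setT (fun x => \int[m2]_(y in B) f (x, y))%E.
Proof.
move=> mB mf f0; have mTB : measurable ([set: T1] `*` B) by exact: measurableX.
rewrite (_ : (fun x => _) = fubini_F m2 (f \_ ([set: T1] `*` B))).
  apply: measurable_fun_fubini_tonelli_F; last by move=> z; rewrite patchE; case: ifP.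
  by apply/(measurable_restrict _ mTB measurableT); exact: measurable_funTS.
apply/funext => x; rewrite /fubini_F [LHS]integral_mkcond; apply: eq_integral => y _.
rewrite !patchE; case: ifPn => [|nB]; case: ifPn => [|nAB] //.
- by move: nAB => /[swap]; rewrite inE => By; rewrite notin_setE => -[].
- by rewrite inE => -[_ /= By]; move: nB; rewrite notin_setE.
Qed.

Section shells_space_time.
Context {R : realType} {n : nat}.
Variables (p q alpha : R) (p_gt0 : 0 < p) (q_gt0 : 0 < q) (pq : 2 < p + q).
Variables (alpha_gt0 : 0 < alpha) (alpha_ltn : alpha < n%:R).
Variables (v psi M : measurableTypeR R * 'rV[R]_n -> R).
Variables (mv : measurable_fun setT v) (mpsi : measurable_fun setT psi)
  (mM : measurable_fun setT M).
Variables (psi0 : forall z, 0 <= psi z) (M0 : forall z, 0 <= M z).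
Variables (tau : R) (tau0 : 0 < tau).
Variables (N : nat) (A : nat -> set 'rV[R]_n) (b d m : nat -> R).
Variables (mA : forall j, measurable (A j)) (tA : trivIset setT A).
Variables (b0 : forall j, 0 < b j) (d0 : forall j, 0 < d j) (m0 : forall j, 0 < m j).
Hypothesis Am : forall j, (lebesgue_rV R n (A j) <= (m j)%:E)%E.
Hypothesis Ad : forall j x y, A j x -> A j y -> enorm (x - y) <= d j.
Hypothesis MA : forall j t x, (j < N)%N -> 0 < t < tau -> A j x ->
  M (t, x) <= b j * psi (t, x) `^ (p + q)^-1.

Let F z := (source p q alpha (fun t x => v (t, x)) z * (psi z)%:E)%E.

Let K := \sum_(0 <= j < N)
  shell_const p q (b j) (riesz_local_const (n := n) alpha (d j)) (m j).

Let U := \big[setU/set0]_(j <- index_iota 0 N) A j.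

Let F0 z : (0 <= F z)%E.
Proof.
apply: mule_ge0; last by rewrite lee_fin.
apply: mule_ge0; last by rewrite lee_fin powR_ge0.
by apply: riesz_potential_ge0 => // y; exact: powR_ge0.
Qed.

Let mF : measurable_fun setT F.
Proof. by apply: emeasurable_funM; [exact: measurable_source|exact/measurable_EFinP]. Qed.

Let slice_ineq t : 0 < t < tau ->
  (\int[lebesgue_rV R n]_(x in U) (`|v (t, x)| * M (t, x))%:E <=
   K%:E + (2^-1 : R)%:E * \int[lebesgue_rV R n]_x F (t, x))%E.
Proof.
move=> tt.
have mvt : measurable_fun setT (fun x => v (t, x)).
  by apply: (measurableT_comp mv); exact: measurable_fun_pair.
have mpt : measurable_fun setT (fun x => psi (t, x)).
  by apply: (measurableT_comp mpsi); exact: measurable_fun_pair.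
have mMt : measurable_fun setT (fun x => M (t, x)).
  by apply: (measurableT_comp mM); exact: measurable_fun_pair.
have mFt : measurable_fun setT (fun x => F (t, x)).
  by apply: (measurableT_comp mF); exact: measurable_fun_pair.
have C0 := riesz_const_gt0 alpha_gt0 alpha_ltn.
have triv : trivIset [set` index_iota 0 N] A by exact: sub_trivIset tA.
have mU : measurable U by apply: bigsetU_measurable.
rewrite /U ge0_integral_bigsetU//=; last 3 first.
- exact: iota_uniq.
- by apply/measurable_EFinP; apply: measurable_funTS; apply: measurable_funM => //; exact: measurableT_comp.
- by move=> x _; rewrite lee_fin mulr_ge0.
apply: (@le_trans _ _ (\sum_(0 <= j < N)
  ((shell_const p q (b j) (riesz_local_const (n := n) alpha (d j)) (m j))%:E +
   (2^-1 : R)%:E * \int[lebesgue_rV R n]_(x in A j) F (t, x)))%E).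
  rewrite [leLHS]big_nat [leRHS]big_nat; apply: lee_sum => j /andP[_ jN].
  apply: le_trans (@shell_inequality _ _ _ (lebesgue_rV R n) p q p_gt0 q_gt0 pq (A j)
    (fun x => v (t, x)) (fun x => psi (t, x)) (fun x => M (t, x)) (b j)
    (riesz_local_const (n := n) alpha (d j)) (m j) _ _ _ _ _ _ _ _ _ _ _) _ => //.
  - exact: measurable_funTS.
  - exact: measurable_funTS.
  - exact: measurable_funTS.
  - by rewrite mulr_gt0// powR_gt0.
  - exact: Am.
  - by move=> x Ax; exact: MA.
  - rewrite leeD2l// lee_wpmul2l ?lee_fin//.
    by apply: source_local_ge => // x y; exact: Ad.
rewrite big_split/= -sumEFin leeD2l//.
rewrite -ge0_sume_distrr; last by move=> j _; exact: integral_ge0.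
rewrite lee_wpmul2l ?lee_fin//.
rewrite -ge0_integral_bigsetU//=; last 2 first.
- exact: iota_uniq.
- exact: measurable_funTS.
by apply: ge0_subset_integral => //; exact: measurable_funTS.
Qed.

(** The product of spatial integrals exists only at fixed time, so [shell_inequality] is summed over
    the shells on each slice and only then integrated in time. The shells being disjoint, the halves
    add up to at most half of the full source integral. *)
Lemma shells_space_time :
  (\int[lebesgue_tx R n]_(z in `]0%R, tau[%classic `*` \big[setU/set0]_(0 <= j < N) A j)
     (`|v z| * M z)%:E <=
   (tau * \sum_(0 <= j < N)
      shell_const p q (b j) (riesz_local_const (n := n) alpha (d j)) (m j))%:E +
   (2^-1 : R)%:E * \int[lebesgue_tx R n]_(z in `]0%R, tau[%classic `*` setT)
      (source p q alpha (fun t x => v (t, x)) z * (psi z)%:E))%E.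
Proof.
rewrite -/U -/K -/F.
have mU : measurable U by apply: bigsetU_measurable.
have mT : measurable (`]0, tau[%classic : set (measurableTypeR R)) by [].
have mG : measurable_fun setT (fun t => (\int[lebesgue_rV R n]_x F (t, x))%E).
  exact: (measurable_integral_section (lebesgue_rV R n) measurableT mF F0).
have G0 t : (0 <= \int[lebesgue_rV R n]_x F (t, x))%E by exact: integral_ge0.
have K0 : 0 <= K.
  apply: sumr_ge0 => j _; rewrite /shell_const !mulr_ge0 ?powR_ge0//.
  - exact: ltW.
  - exact: ltW.
have mvM : measurable_fun setT (fun z => (`|v z| * M z)%:E).
  by apply/measurable_EFinP; apply: measurable_funM => //; exact: measurableT_comp.
have vM0 z : (0 <= (`|v z| * M z)%:E)%E by rewrite lee_fin mulr_ge0.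
have mI := measurable_integral_section (lebesgue_rV R n) mU mvM vM0.
rewrite ge0_integral_setX//.
rewrite ge0_integral_setX//.
apply: (@le_trans _ _ (\int[lebesgue_measure]_(t in `]0%R, tau[)
   (K%:E + (2^-1 : R)%:E * \int[lebesgue_rV R n]_x F (t, x)))%E).
  apply: ge0_le_integral => //.
  - by move=> t _; apply: integral_ge0 => x _; rewrite lee_fin mulr_ge0.
  - exact: measurable_funTS.
  - apply: measurable_funTS; apply: emeasurable_funD; first exact: measurable_cst.
    by apply: emeasurable_funM => //; exact: measurable_cst.
rewrite ge0_integralD//; last 2 first.
- by move=> t _; rewrite mule_ge0// lee_fin.
- by apply: measurable_funTS; apply: emeasurable_funM.
rewrite integral_cst// ge0_integralZl//; last exact: measurable_funTS.
apply: leeD => //.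
rewrite [X in (_ * X <= _)%E](_ : _ = tau%:E); last first.
  by have := lebesgue_measure_itv `]0%R, tau[; rewrite /= lte_fin tau0 sube0.
by rewrite -EFinM lee_fin mulrC.
Qed.

End shells_space_time.

Section Lintegrable_facts.
Context d (T : measurableType d) (R : realType) (mu : {measure set T -> \bar R}).
Local Open Scope ereal_scope.

Lemma Lintegrable_fin_num (D : set T) (f : T -> \bar R) : measurable D ->
  Lintegrable mu D f -> \int[mu]_(x in D) f x \is a fin_num.
Proof.
move=> mD [g ig fg]; rewrite (Defs.integral_ae_eq fg).
exact: integrable_fin_num.
Qed.

Lemma Lintegrable_abse_le (D : set T) (f h : T -> \bar R) : measurable D ->
  Lintegrable mu D f -> measurable_fun D h -> (forall x, D x -> 0 <= h x) ->
  (\forall x \ae mu, D x -> `|f x| <= h x) ->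
  `|\int[mu]_(x in D) f x| <= \int[mu]_(x in D) h x.
Proof.
move=> mD [g ig fg] mh h0 fh; rewrite (Defs.integral_ae_eq fg).
have mg := measurable_int mu ig.
apply: le_trans (le_abse_integral mu mD mg) _.
apply: ae_ge0_le_integral => //.
  exact: measurableT_comp.
by apply: filterS2 fg fh => x fgx + Dx => /(_ Dx); rewrite fgx.
Qed.

Lemma Lintegrable_minorant_lty (D E : set T) (f h : T -> \bar R) :
  measurable D -> measurable E -> E `<=` D ->
  Lintegrable mu D f -> measurable_fun E h -> (forall x, E x -> 0 <= h x) ->
  (\forall x \ae mu, E x -> h x <= `|f x|) ->
  \int[mu]_(x in E) h x < +oo.
Proof.
move=> mD mE ED [g ig fg] mh h0 fh.
have [mg gfin] := integrableP _ _ _ ig.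
have mabs : measurable_fun D (fun x => `|g x|).
  exact: measurableT_comp.
apply: le_lt_trans gfin.
apply: (@le_trans _ _ (\int[mu]_(x in E) `|g x|)).
  apply: ae_ge0_le_integral => //.
    exact: measurable_funS mabs.
  by apply: filterS2 fg fh => x fgx + Ex => /(_ Ex); rewrite fgx//; exact: ED.
exact: ge0_subset_integral.
Qed.

End Lintegrable_facts.

(** * From the weak identity to an inequality for a Borel representative *)

Section weak_inequality.
Context {R : realType} {n : nat}.
Variables (p q alpha beta : R) (alpha_gt0 : 0 < alpha) (alpha_ltn : alpha < n%:R).
Variables (u0 : 'rV[R]_n -> R) (u : R -> 'rV[R]_n -> R).
Variable (v : measurableTypeR R * 'rV[R]_n -> R).
Hypothesis mv : measurable_fun setT v.
Hypothesis uv : \forall z \ae lebesgue_tx R n, 0 < z.1 -> u z.1 z.2 = v z.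
Local Open Scope ereal_scope.

Lemma slab_setX (tau : R) :
  [set z : R * 'rV[R]_n | (0 < z.1 < tau)%R] = `]0%R, tau[%classic `*` setT.
Proof. by apply/seteqP; split => z /=; rewrite in_itv/=; [|case]. Qed.

Let arith (a2 a3 a4 a5 : \bar R) : a2 \is a fin_num -> a3 \is a fin_num ->
  a4 \is a fin_num -> a5 \is a fin_num -> - a2 = a3 - a4 + a5 ->
  a2 + a3 <= `|a4| + `|a5|.
Proof.
case: a2 => // a2; case: a3 => // a3; case: a4 => // a4; case: a5 => // a5 _ _ _ _ [wid].
rewrite lee_fin.
have := ler_norm a4; have := ler_norm (- a5); rewrite normrN.
lra.
Qed.

Let term_le (L : R -> 'rV[R]_n -> R) (tau : R) (M : measurableTypeR R * 'rV[R]_n -> R) :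
  Lintegrable (lebesgue_tx R n) (`]0%R, tau[%classic `*` setT)
    (fun z => (u z.1 z.2 * L z.1 z.2)%:E) ->
  measurable_fun setT M -> (forall z, (0 <= M z)%R) ->
  (forall t x, (0 < t < tau)%R -> (`|L t x| <= M (t, x))%R) ->
  `|\int[lebesgue_tx R n]_(z in `]0%R, tau[%classic `*` setT)
      (u z.1 z.2 * L z.1 z.2)%:E| <=
    \int[lebesgue_tx R n]_(z in `]0%R, tau[%classic `*` setT) (`|v z| * M z)%:E.
Proof.
move=> Lf mM M0 LM.
have mQ : measurable (`]0%R, tau[%classic `*` setT : set (measurableTypeR R * 'rV[R]_n)).
  exact: measurableX.
have Fae := ae_filter_ringOfSetsType (lebesgue_tx R n).
apply: Lintegrable_abse_le mQ Lf _ _ _.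
- apply: measurable_funTS; apply/measurable_EFinP; apply: measurable_funM; last exact: mM.
  exact: (measurableT_comp (@normr_measurable R setT) mv).
- by move=> z _; rewrite lee_fin mulr_ge0.
- apply: filterS uv => -[t x] /= + [/= + _]; rewrite in_itv/= => uvz t0.
  have /andP[t00 _] := t0.
  by rewrite lee_fin normrM (uvz t00); apply: ler_wpM2l => //; exact: LM.
Qed.

Let source_term_eq (psi : R -> 'rV[R]_n -> R) (tau : R) :
  \int[lebesgue_tx R n]_(z in `]0%R, tau[%classic `*` setT)
    (source p q alpha u z * (psi z.1 z.2)%:E) =
  \int[lebesgue_tx R n]_(z in `]0%R, tau[%classic `*` setT)
    (source p q alpha (fun t x => v (t, x)) z * (psi z.1 z.2)%:E).
Proof.
have Fae := ae_filter_ringOfSetsType (lebesgue_tx R n).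
apply: Defs.integral_ae_eq.
apply: filterS (source_ae_eq p q alpha uv) => z sz [/= + _].
by rewrite in_itv/= => /andP[z0 _]; rewrite (sz z0).
Qed.

Let term_split (tau : R) (M1 M2 : measurableTypeR R * 'rV[R]_n -> R) :
  measurable_fun setT M1 -> measurable_fun setT M2 ->
  (forall z, (0 <= M1 z)%R) -> (forall z, (0 <= M2 z)%R) ->
  \int[lebesgue_tx R n]_(z in `]0%R, tau[%classic `*` setT) (`|v z| * (M1 z + M2 z))%:E =
  \int[lebesgue_tx R n]_(z in `]0%R, tau[%classic `*` setT) (`|v z| * M1 z)%:E +
  \int[lebesgue_tx R n]_(z in `]0%R, tau[%classic `*` setT) (`|v z| * M2 z)%:E.
Proof.
move=> mM1 mM2 M10 M20.
have mQ : measurable (`]0%R, tau[%classic `*` setT : set (measurableTypeR R * 'rV[R]_n)).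
  exact: measurableX.
have mvM (M : measurableTypeR R * 'rV[R]_n -> R) : measurable_fun setT M ->
    measurable_fun (`]0%R, tau[%classic `*` setT) (fun z => (`|v z| * M z)%:E).
  move=> mM; apply: measurable_funTS; apply/measurable_EFinP; apply: measurable_funM; last exact: mM.
  exact: (measurableT_comp (@normr_measurable R setT) mv).
rewrite -(ge0_integralD _ mQ _ (mvM _ mM1) _ (mvM _ mM2)); last 2 first.
- by move=> z _; rewrite lee_fin mulr_ge0.
- by move=> z _; rewrite lee_fin mulr_ge0.
by apply: eq_integral => z _; rewrite -EFinD mulrDr.
Qed.

(** Since psi vanishes at [tau], the identity expresses the initial and source terms through the two
    linear ones. The finiteness of the source integral is recorded because absorption subtracts
    it. *)
Lemma weak_inequality (psi : R -> 'rV[R]_n -> R) (tau : R)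
    (M1 M2 : measurableTypeR R * 'rV[R]_n -> R) :
  (0 < tau)%R -> weak_identity p q alpha beta u0 u psi tau ->
  measurable_fun setT (fun z : measurableTypeR R * 'rV[R]_n => psi z.1 z.2) ->
  (forall t x, (0 <= t)%R -> (0 <= psi t x)%R) -> (forall x, psi tau x = 0%R) ->
  measurable_fun setT M1 -> measurable_fun setT M2 ->
  (forall z, (0 <= M1 z)%R) -> (forall z, (0 <= M2 z)%R) ->
  (forall t x, (0 < t < tau)%R -> (`|fraclap beta (psi t) x| <= M1 (t, x))%R) ->
  (forall t x, (0 < t < tau)%R -> (`|time_deriv psi t x| <= M2 (t, x))%R) ->
  let I3 := \int[lebesgue_tx R n]_(z in `]0%R, tau[%classic `*` setT)
    (source p q alpha (fun t x => v (t, x)) z * (psi z.1 z.2)%:E) in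
  I3 < +oo /\
  \int[lebesgue_rV R n]_x (u0 x * psi 0%R x)%:E + I3 <=
  \int[lebesgue_tx R n]_(z in `]0%R, tau[%classic `*` setT)
    (`|v z| * (M1 z + M2 z))%:E.
Proof.
move=> tau0 [Lf1 Lf2 [Lf3 Lf4 Lf5]] wid mpsi psi0 psitau mM1 mM2 M10 M20 LM1 LM2 /=.
set Q := `]0%R, tau[%classic `*` setT.
rewrite slab_setX -/Q in Lf3 Lf4 Lf5 wid.
have mQ : measurable (Q : set (measurableTypeR R * 'rV[R]_n)) by exact: measurableX.
have I1 : \int[lebesgue_rV R n]_x (u tau x * psi tau x)%:E = 0.
  by apply: integral0_eq => x _; rewrite psitau mulr0.
have I4le := term_le Lf4 mM1 M10 LM1.
have I5le := term_le Lf5 mM2 M20 LM2.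
have fin2 := Lintegrable_fin_num measurableT Lf2.
have fin3 := Lintegrable_fin_num mQ Lf3.
have fin4 := Lintegrable_fin_num mQ Lf4.
have fin5 := Lintegrable_fin_num mQ Lf5.
rewrite -source_term_eq; split.
  by move: fin3; rewrite fin_numElt => /andP[_].
rewrite (term_split tau mM1 mM2 M10 M20).
apply: le_trans (leeD I4le I5le).
rewrite I1 sub0e in wid.
exact: arith fin2 fin3 fin4 fin5 wid.
Qed.

End weak_inequality.

(** Dominated convergence for the restrictions of [h]: every point eventually leaves the sets
    [E k]. *)
Lemma integral_tail_small d (T : measurableType d) (R : realType)
    (mu : {measure set T -> \bar R}) (D : set T) (E : nat -> set T)
    (h : T -> \bar R) (delta : R) :
  measurable D -> measurable_fun D h -> (forall x, (0 <= h x)%E) ->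
  (\int[mu]_(x in D) h x < +oo)%E ->
  (forall k, measurable (E k)) -> (forall k, E k `<=` D) ->
  (forall x, D x -> \forall k \near \oo, ~ E k x) -> 0 < delta ->
  \forall k \near \oo, (\int[mu]_(x in E k) h x < delta%:E)%E.
Proof.
move=> mD mh h0 hfin mE ED Eempty delta0.
have ih : mu.-integrable D h.
  apply/integrableP; split => //.
  by under eq_integral do rewrite gee0_abs//.
have mf k : measurable_fun D (h \_ (E k)).
  apply/(measurable_restrict _ (mE k) mD); apply: measurable_funS mh => //.
have [] := @dominated_convergence _ _ _ mu D mD (fun k => h \_ (E k)) (cst 0%E) h mf.
- exact: measurable_cst.
- apply: aeW => x Dx; apply: cvg_near_cst; apply: filterS (Eempty x Dx) => k nE.
  by rewrite patchE ifF//; apply/negbTE; rewrite notin_setE.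
- exact: ih.
- apply: aeW => x k Dx; rewrite patchE; case: ifP => _; first by rewrite gee0_abs.
  by rewrite abse0.
move=> _ _; rewrite integral_cst// mul0e => cv.
have := cv; move/fine_cvgP => [fnear fcv].
move: fcv => /cvgr_lt /(_ _ delta0); apply: filterS2 fnear => k.
have -> : (\int[mu]_(x in E k) h x = \int[mu]_(x in D) (h \_ (E k)) x)%E.
  by rewrite -integral_mkcondr setIidr.
by rewrite /= => finE lt; rewrite -(fineK finE) lte_fin.
Qed.

Section far_integrability.
Context {R : realType} {n : nat}.
Variables (p q alpha beta : R) (beta0 : 0 < beta) (beta2 : beta < 2) (n0 : (0 < n)%N).
Variables (u0 : 'rV[R]_n -> R) (u : R -> 'rV[R]_n -> R).
Variable (v : measurableTypeR R * 'rV[R]_n -> R).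
Hypothesis mv : measurable_fun setT v.
Hypothesis uv : \forall z \ae lebesgue_tx R n, 0 < z.1 -> u z.1 z.2 = v z.

(* Away from the support of the bump, [fraclap] of the test function is of the
   order of [|x|^-(n+beta)], so the integrability demanded of [u * fraclap psi] by
   the weak formulation is an integrability property of [u] at infinity. *)
Lemma far_integrable (rho tau : R) : 0 < rho -> 0 < tau ->
  weak_identity p q alpha beta u0 u (test_fun (2 * tau) 1 (fun=> 1) (fun=> rho)) tau ->
  (\int[lebesgue_tx R n]_(z in `]0%R, tau[%classic `*` [set x | (4 * rho < enorm (0 - x))%R])
     (`|v z| * enorm z.2 `^ (- (n%:R + beta)))%:E < +oo)%E.
Proof.
move=> rho0 tau0 [_ _ [_ Lf4 _] _].
rewrite slab_setX in Lf4.
set E := _ `*` _.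
have mB : measurable [set x : 'rV[R]_n | (4 * rho < enorm (0 - x))%R].
  exact: measurable_enorm_gt.
have mE : measurable (E : set (measurableTypeR R * 'rV[R]_n)) by exact: measurableX.
have mQ : measurable (`]0%R, tau[%classic `*` setT : set (measurableTypeR R * 'rV[R]_n)).
  exact: measurableX.
have EQ : E `<=` `]0%R, tau[%classic `*` setT by move=> z [].
(* The constants of [fraclap_bump_far_ge], with (1/2)^4 bounding the cutoff from below: its lifetime
   is 2 tau, and only times below tau are considered. *)
pose k0 : R := `|fraclap_const n (beta / 2)| * ((1 / 2) ^+ 4 *
  ((3 / 4) ^+ 4 * (rho / n%:R) ^+ n * 2 `^ (- (n%:R + beta)))).
have b0 := beta0; have b2 := beta2.
have C0 : 0 < `|fraclap_const n (beta / 2) : R|.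
  by rewrite normr_gt0 fraclap_const_neq0//; apply/andP; split; lra.
have nR : 0 < n%:R :> R by rewrite ltr0n.
have k00 : 0 < k0.
  apply: mulr_gt0 => //; apply: mulr_gt0; first by rewrite exprn_gt0.
  apply: mulr_gt0; last exact: powR_gt0.
  by apply: mulr_gt0; rewrite exprn_gt0// divr_gt0.
pose h (z : measurableTypeR R * 'rV[R]_n) := (`|v z| * enorm z.2 `^ (- (n%:R + beta)))%:E.
have mh : measurable_fun setT h.
  apply/measurable_EFinP; apply: measurable_funM.
    exact: (measurableT_comp (@normr_measurable R setT) mv).
  apply: (measurableT_comp (measurable_powR _)).
  exact: (measurable_fun_enorm measurable_snd).
have h0 z : (0 <= h z)%E by rewrite lee_fin mulr_ge0 ?powR_ge0.
have mkh : measurable_fun E (fun z => k0%:E * h z)%E.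
  by apply: emeasurable_funM; [exact: measurable_cst|exact: measurable_funTS].
have Fae := ae_filter_ringOfSetsType (lebesgue_tx R n).
have fin : (\int[lebesgue_tx R n]_(z in E) (k0%:E * h z) < +oo)%E.
  apply: (Lintegrable_minorant_lty mQ mE EQ Lf4 mkh).
    by move=> z _; rewrite mule_ge0// lee_fin ltW.
  apply: filterS uv => -[t x] uvz [tt xr].
  move: tt xr; rewrite /= in_itv/= sub0r enormN => tt xr.
  have /andP[t0 t1] := tt.
  have uvE := uvz t0; rewrite /= in uvE.
  rewrite uvE /h /= -EFinM lee_fin normrM [leLHS]mulrCA.
  apply: ler_wpM2l => //.
  have -> : test_fun (2 * tau) 1 (fun=> 1) (fun=> rho) t =
      (fun y : 'rV[R]_n => cutoff (2 * tau) t * qbump rho y).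
    by apply/funext => y; rewrite test_funE /bump_sum big_ord1 mul1r.
  apply: le_trans (fraclap_bump_far_ge beta0 beta2 n0 (cutoff_ge0 _ _) rho0 xr).
  rewrite /k0 -[leLHS]mulrA; apply: ler_wpM2l => //.
  rewrite -[leLHS]mulrA; apply: ler_pM.
  - by rewrite exprn_ge0.
  - by rewrite !mulr_ge0 ?powR_ge0 ?exprn_ge0// divr_ge0// ltW.
  - by apply: cutoff_early; lra.
  - rewrite -[leLHS]mulrA; apply: ler_wpM2l.
      by rewrite mulr_ge0 ?exprn_ge0// divr_ge0// ltW.
    by rewrite powRM ?enorm_ge0.
rewrite ge0_integralZl// in fin; last 2 first.
- exact: measurable_funTS.
- by rewrite lee_fin ltW.
move: fin; rewrite -/h ltey => fin; rewrite ltey; apply: contra fin => /eqP ->.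
by rewrite gt0_muley ?lte_fin.
Qed.

End far_integrability.

Section absorption.
Context {R : realType} {n : nat}.
Variables (p q alpha beta : R) (p_gt0 : 0 < p) (q_gt0 : 0 < q) (pq : 2 < p + q).
Variables (alpha_gt0 : 0 < alpha) (alpha_ltn : alpha < n%:R).
Variables (u0 : 'rV[R]_n -> R) (u : R -> 'rV[R]_n -> R).
Variable (v : measurableTypeR R * 'rV[R]_n -> R).
Hypothesis mv : measurable_fun setT v.
Hypothesis uv : \forall z \ae lebesgue_tx R n, 0 < z.1 -> u z.1 z.2 = v z.
Variables (psi : R -> 'rV[R]_n -> R) (tau : R) (tau0 : 0 < tau).
Variables (M1 M2 : measurableTypeR R * 'rV[R]_n -> R).
Hypothesis wid : weak_identity p q alpha beta u0 u psi tau.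
Hypothesis mpsi :
  measurable_fun setT (fun z : measurableTypeR R * 'rV[R]_n => psi z.1 z.2).
Hypothesis psi0 : forall t x, 0 <= psi t x.
Hypothesis psitau : forall x, psi tau x = 0.
Hypotheses (mM1 : measurable_fun setT M1) (mM2 : measurable_fun setT M2).
Hypotheses (M10 : forall z, 0 <= M1 z) (M20 : forall z, 0 <= M2 z).
Hypothesis LM1 : forall t x, 0 < t < tau -> `|fraclap beta (psi t) x| <= M1 (t, x).
Hypothesis LM2 : forall t x, 0 < t < tau -> `|time_deriv psi t x| <= M2 (t, x).
Variables (N : nat) (A : nat -> set 'rV[R]_n) (b d m : nat -> R).
Variables (mA : forall j, measurable (A j)) (tA : trivIset setT A).
Variables (b0 : forall j, 0 < b j) (d0 : forall j, 0 < d j) (m0 : forall j, 0 < m j).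
Hypothesis Am : forall j, (lebesgue_rV R n (A j) <= (m j)%:E)%E.
Hypothesis Ad : forall j x y, A j x -> A j y -> enorm (x - y) <= d j.
Hypothesis MA : forall j t x, (j < N)%N -> 0 < t < tau -> A j x ->
  M1 (t, x) + M2 (t, x) <= b j * psi t x `^ (p + q)^-1.
Variable tail : R.
Hypothesis tailP :
  (\int[lebesgue_tx R n]_(z in `]0%R, tau[%classic `*` ~` \big[setU/set0]_(0 <= j < N) A j)
     (`|v z| * (M1 z + M2 z))%:E <= tail%:E)%E.

Let ereal_absorb (a i h k : \bar R) : (0 <= i)%E -> (i < +oo)%E ->
  (a + i <= h)%E -> (h <= k + (2^-1)%:E * i)%E -> (a <= k)%E.
Proof.
move=> i0 ioo aih hk; have ifin : i \is a fin_num by rewrite ge0_fin_numE.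
have := le_trans aih hk; rewrite -leeBrDr// => /le_trans; apply.
rewrite -addeA geeDl// -(fineK ifin) -EFinM -EFinB lee_fin.
by have := i0; rewrite -(fineK ifin) lee_fin; lra.
Qed.

(** The right-hand side of [weak_inequality] is split into shells and remainder. The shells produce
    half of the source integral, which is finite and is subtracted; the other half is nonnegative
    and dropped. *)
Lemma absorbed_inequality :
  (\int[lebesgue_rV R n]_x (u0 x * psi 0%R x)%:E <=
   (tau * (\sum_(0 <= j < N)
     shell_const p q (b j) (riesz_local_const (n := n) alpha (d j)) (m j)) + tail)%:E)%E.
Proof.
have [I3fin wi] := weak_inequality mv uv tau0 wid mpsi (fun t x _ => psi0 t x) psitau
  mM1 mM2 M10 M20 LM1 LM2.
have mM : measurable_fun setT (fun z => M1 z + M2 z) by exact: measurable_funD.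
have M0 z : 0 <= M1 z + M2 z by rewrite addr_ge0.
have st := shells_space_time p_gt0 q_gt0 pq alpha_gt0 alpha_ltn mv mpsi mM
  (fun z => psi0 z.1 z.2) M0 tau0 mA tA b0 d0 m0 Am Ad MA.
apply: (ereal_absorb _ I3fin wi).
  apply: integral_ge0 => z _; apply: mule_ge0; last by rewrite lee_fin.
  apply: mule_ge0; last by rewrite lee_fin powR_ge0.
  by apply: riesz_potential_ge0 => // y; exact: powR_ge0.
have tl := tailP.
set U := \big[setU/set0]_(0 <= j < N) A j in tl st *.
have mU : measurable U by apply: bigsetU_measurable.
have mT : measurable (`]0, tau[%classic : set (measurableTypeR R)) by [].
have mTU : measurable (`]0, tau[%classic `*` U : set (measurableTypeR R * 'rV[R]_n)).
  exact: measurableX.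
have mTC : measurable (`]0, tau[%classic `*` ~` U : set (measurableTypeR R * 'rV[R]_n)).
  by apply: measurableX => //; exact: measurableC.
have slabE : `]0, tau[%classic `*` setT =
    (`]0, tau[%classic `*` U) `|` (`]0, tau[%classic `*` ~` U) :> set (R * 'rV[R]_n).
  apply/seteqP; split => [z [tz _]|z [[tz _]|[tz _]]] //.
  by have [zU|zU] := pselect (U z.2); [left|right].
rewrite {1}slabE ge0_integral_setU; last 5 first.
- exact: mTU.
- exact: mTC.
- apply: measurable_funTS; apply/measurable_EFinP; apply: measurable_funM; last exact: mM.
  exact: (measurableT_comp (@normr_measurable R setT) mv).
- by move=> z _; rewrite lee_fin mulr_ge0.
- by apply/disj_setPS => z [[_ /= zU] [_ /= nzU]].
rewrite EFinD [leRHS]addeAC.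
exact: leeD st tl.
Qed.

End absorption.

(** * Bounds on the initial datum *)

(** Separates the powers of rho and 2^j from the fixed constants, so that only exponents remain to
    be computed. *)
Lemma shell_constM (R : realType) (p q b c m x y z : R) :
  0 < b -> 0 < c -> 0 < m -> 0 < x -> 0 < y -> 0 < z ->
  shell_const p q (b * x) (c * y) (m * z) =
  shell_const p q b c m * (x * z * (x / (y * z)) `^ (p + q - 1)^-1).
Proof.
move=> b0 c0 m0 x0 y0 z0; rewrite /shell_const.
have -> : b * x / (c * y * (m * z)) = b / (c * m) * (x / (y * z)).
  by field; rewrite !gt_eqF.
have h1 : 0 <= b / (c * m) by rewrite divr_ge0 ?mulr_ge0 ?(ltW b0) ?(ltW c0) ?(ltW m0).
have h2 : 0 <= x / (y * z) by rewrite divr_ge0 ?mulr_ge0 ?(ltW x0) ?(ltW y0) ?(ltW z0).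
rewrite powRM//; ring.
Qed.

Section powR_scaling.
Context {R : realType}.
Variables (alpha beta nn r : R) (r2 : 2 < r).

(** The factors are those of a shell of radius s: time length s^beta, derivatives s^-beta, measure
    s^n, Riesz kernel s^(alpha-n). *)
Lemma scaling_exponent (s : R) : 0 < s ->
  s `^ beta * (s `^ (- beta) * s `^ nn *
   (s `^ (- beta) / (s `^ (alpha - nn) * s `^ nn)) `^ (r - 1)^-1) =
  s `^ (nn - (alpha + beta) / (r - 1)).
Proof.
move=> s0; have r20 := r2.
have D (a b : R) : s `^ a * s `^ b = s `^ (a + b).
  by rewrite -powRD// (gt_eqF s0) implybT.
rewrite !D -powRN !D -powRrM !D; congr (_ `^ _); field.
by rewrite gt_eqF//; lra.
Qed.

(** Here s = 2^j, and the derivative bound is the weight to the power 1 - 1/r. As (1 - 1/r) r/(r -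
    1) = 1, the dimension cancels and the exponent is negative: the shells sum geometrically. *)
Lemma shell_exponent (s : R) : 0 < s ->
  (s `^ (- ((nn + beta) * (1 - r^-1))) * s `^ nn *
   (s `^ (- ((nn + beta) * (1 - r^-1))) / (s `^ (alpha - nn) * s `^ nn)) `^ (r - 1)^-1) =
  s `^ (- (beta + alpha / (r - 1))).
Proof.
move=> s0; have r20 := r2.
have D (a b : R) : s `^ a * s `^ b = s `^ (a + b).
  by rewrite -powRD// (gt_eqF s0) implybT.
rewrite !D -powRN !D -powRrM !D; congr (_ `^ _); field.
by apply/andP; split; rewrite gt_eqF//; lra.
Qed.

End powR_scaling.

(** * The case beta = 2 *)

Section laplacian_case.
Context {R : realType} {n : nat}.
Variables (p q alpha : R) (p_gt0 : 0 < p) (q_gt0 : 0 < q) (pq : 2 < p + q).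
Variables (n_ge1 : (1 <= n)%N) (alpha_gt0 : 0 < alpha) (alpha_ltn : alpha < n%:R).

Lemma measurable_test_fun (tau : R) (N : nat) (c rho : nat -> R) :
  measurable_fun setT (fun z : measurableTypeR R * 'rV[R]_n => test_fun tau N c rho z.1 z.2).
Proof.
rewrite (_ : (fun z => _) = fun z : measurableTypeR R * 'rV[R]_n =>
    cutoff tau z.1 * bump_sum N c rho z.2); last first.
  by apply/funext => z; rewrite test_funE.
apply: measurable_funM.
  apply: measurable_funX; apply: measurable_maxr => //.
  by apply: measurable_funB => //; apply: measurable_funM.
exact: (measurableT_comp (measurable_bump_sum N c rho) measurable_snd).
Qed.

Lemma le_powR_inv (r a : R) : 1 < r -> 0 <= a <= 1 -> a <= a `^ r^-1.
Proof.
move=> r1 /andP[]; rewrite le_eqVlt => /predU1P[<- _|a0 a1]; first exact: powR_ge0.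
by apply: ger1_powR; rewrite ?a0// invf_le1//; lra.
Qed.

(* For [beta = 2] the test function is local, so one shell suffices. *)
Lemma laplacian_bound (u0 : 'rV[R]_n -> R) (u : R -> 'rV[R]_n -> R) :
  global_weak_solution p q alpha 2 u0 u ->
  exists2 C : R, 0 < C & forall rho, 0 < rho ->
    Lintegrable (lebesgue_rV R n) setT (fun x => (u0 x * qbump rho x)%:E) /\
    (\int[lebesgue_rV R n]_x (u0 x * qbump rho x)%:E <=
      (C * rho `^ (n%:R - (alpha + 2) / (p + q - 1)))%:E)%E.
Proof.
move=> [uL _ wid].
have r2 := pq; have [v mv uv] := exists_borel_rep uL.
have C0 := riesz_const_gt0 alpha_gt0 alpha_ltn.
(* The summand 56 n comes from the Laplacian of the bump, 4 from the derivative of the cutoff; with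
   tau = rho^2 both carry the factor rho^-2. *)
pose B : R := 56 * n%:R + 4.
have B0 : 0 < B by rewrite ltr_wpDl// mulr_ge0.
pose c1 : R := riesz_const n alpha * 2 `^ (alpha - n%:R).
have c10 : 0 < c1 by rewrite mulr_gt0// powR_gt0.
have m10 : 0 < 2 ^+ n :> R by rewrite exprn_gt0.
exists (shell_const p q B c1 (2 ^+ n)).
  by rewrite /shell_const !mulr_gt0// powR_gt0// divr_gt0// mulr_gt0.
move=> rho rho0; pose tau := rho ^+ 2.
have tau0 : 0 < tau by rewrite exprn_gt0.
pose psi := test_fun tau 1 (fun=> 1) (fun=> rho) : R -> 'rV[R]_n -> R.
have psiE t x : psi t x = cutoff tau t * qbump rho x.
  by rewrite /psi test_funE /bump_sum big_ord1 mul1r.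
have tf : test_function +oo psi.
  exact: (@test_funP R n tau tau0 1 (fun=> 1) (fun=> rho) rho).
have widp := wid psi tau tf (ltW tau0) (ltry _).
have psi00 x : psi 0 x = qbump rho x by rewrite psiE cutoff0 mul1r.
have [_ Lf2 _ _] := widp.
have E0 : (fun x => (u0 x * psi 0 x)%:E) = (fun x => (u0 x * qbump rho x)%:E).
  by apply/funext => x; rewrite psi00.
rewrite E0 in Lf2.
split; first exact: Lf2.
pose M1 (z : measurableTypeR R * 'rV[R]_n) := 56 * n%:R / rho ^+ 2 * psi z.1 z.2 `^ (p + q)^-1.
pose M2 (z : measurableTypeR R * 'rV[R]_n) := 4 / rho ^+ 2 * psi z.1 z.2 `^ (p + q)^-1.
have mpsi : measurable_fun setT (fun z : measurableTypeR R * 'rV[R]_n => psi z.1 z.2).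
  exact: measurable_test_fun.
have mpow : measurable_fun setT
    (fun z : measurableTypeR R * 'rV[R]_n => psi z.1 z.2 `^ (p + q)^-1).
  exact: (measurableT_comp (measurable_powR _) mpsi).
have psi0 t x : 0 <= psi t x by rewrite psiE; apply: mulr_ge0; [exact: cutoff_ge0|exact: bump_ge0].
have ri : 0 < (p + q)^-1 by rewrite invr_gt0; lra.
(* Only [A 0] is used. Outside this ball the bump and both majorants vanish, so the tail is 0. *)
pose A (j : nat) : set 'rV[R]_n :=
  if j is 0%N then [set x | enorm (0 - x) <= rho] else set0.
have mA j : measurable (A j).
  by case: j => [|j]; [exact: (measurable_enorm_le 0 rho)|exact: measurable0].
have tA : trivIset setT A.
  by apply/trivIsetP => -[|i] [|j] // _ _ _; rewrite ?setI0 ?set0I.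
have Am j : (lebesgue_rV R n (A j) <= (2 ^+ n * rho `^ n%:R)%:E)%E.
  case: j => [|j]; first exact: lebesgue_rV_ball_le.
  by rewrite measure0 lee_fin mulr_ge0 ?powR_ge0// ltW.
have Ad j x y : A j x -> A j y -> enorm (x - y) <= 2 * rho.
  by case: j => // /=; rewrite !sub0r !enormN; exact: enormB_le2.
have rho2E : rho `^ (- 2) = (rho ^+ 2)^-1 by rewrite powRN powR_mulrn ?(ltW rho0).
have rho20 : 0 < rho ^+ 2 by rewrite exprn_gt0.
have MA j t x : (j < 1)%N -> 0 < t < tau -> A j x ->
    M1 (t, x) + M2 (t, x) <= B * rho `^ (- 2) * psi t x `^ (p + q)^-1.
  by move=> _ _ _; rewrite rho2E /M1 /M2/= -mulrDl -mulrDl.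
have w01 x : 0 <= bump_base rho x <= 1 by rewrite bump_base_ge0 bump_base_le1.
have LM1 t x : 0 < t < tau -> `|fraclap 2 (psi t) x| <= M1 (t, x).
  move=> /andP[t0 _]; rewrite /fraclap eqxx normrN.
  have cut0 := cutoff_ge0 tau t; have cut1 := cutoff_le1 tau0 (ltW t0).
  have E : psi t = bump_sum 1 (fun=> cutoff tau t) (fun=> rho).
    by apply/funext => y; rewrite psiE /bump_sum big_ord1.
  rewrite {1}E; apply: le_trans (laplacian_bump_le x cut0 rho0 pq) _.
  rewrite /M1/= psiE powRM//; last exact: bump_ge0.
  have cutp : cutoff tau t <= cutoff tau t `^ (p + q)^-1.
    by apply: le_powR_inv; [lra|rewrite cut0 cut1].
  have -> : cutoff tau t * (n%:R * 56 / rho ^+ 2) * qbump rho x `^ (p + q)^-1 =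
      56 * n%:R / rho ^+ 2 * (cutoff tau t * qbump rho x `^ (p + q)^-1) by ring.
  apply: ler_wpM2l; first by apply: divr_ge0 (ltW rho20); rewrite mulr_ge0.
  by apply: ler_wpM2r => //; exact: powR_ge0.
have LM2 t x : 0 < t < tau -> `|time_deriv psi t x| <= M2 (t, x).
  move=> /andP[t0 _]; have cut0 := cutoff_ge0 tau t.
  have q0 := bump_ge0 rho x; have q1 := bump_le1 rho x.
  rewrite /M2/= psiE powRM// /psi time_deriv_test_fun ?(ltW t0)//.
  rewrite /bump_sum big_ord1 mul1r /cutoff' -/tau.
  set w := Num.max 0 (1 - t / tau).
  have w01' : 0 <= w <= 1 by rewrite le_max lexx cutoff_base_le1// ltW.
  have w3 : 0 <= w ^+ 3 by rewrite exprn_ge0//; case/andP: w01'.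
  rewrite normrM normrM normrN (ger0_norm q0) (ger0_norm w3) (ger0_norm (x := 4 / tau)); last first.
    by rewrite divr_ge0// ltW.
  rewrite -mulrA; apply: ler_wpM2l; first by rewrite divr_ge0// ltW.
  apply: ler_pM => //; first exact: cube_le_powR_quartic.
  by apply: le_powR_inv; [lra|rewrite q0 q1].
have Mnn (k : R) : 0 <= k -> forall z : measurableTypeR R * 'rV[R]_n,
    0 <= k / rho ^+ 2 * psi z.1 z.2 `^ (p + q)^-1.
  by move=> k0 z; apply: mulr_ge0; [exact: divr_ge0 (ltW rho20)|exact: powR_ge0].
have mMk (k : R) : measurable_fun setT (fun z : measurableTypeR R * 'rV[R]_n =>
    k / rho ^+ 2 * psi z.1 z.2 `^ (p + q)^-1).
  by apply: measurable_funM.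
have tailP : (\int[lebesgue_tx R n]_(z in `]0%R, tau[%classic `*` ~` \big[setU/set0]_(0 <= j < 1) A j)
     (`|v z| * (M1 z + M2 z))%:E <= (0 : R)%:E)%E.
  rewrite integral0_eq// => z [_]; rewrite big_nat1 /= sub0r enormN => /negP.
  rewrite -ltNge => rz; rewrite /M1 /M2 psiE bump_far ?(ltW rz)// mulr0.
  by rewrite powR0 ?gt_eqF// !mulr0 addr0 mulr0.
have := absorbed_inequality p_gt0 q_gt0 pq alpha_gt0 alpha_ltn mv uv tau0 widp mpsi psi0
  (fun x => _) (mMk (56 * n%:R)) (mMk 4) (Mnn _ _) (Mnn _ _) LM1 LM2 (N := 1%N) mA tA
  (fun=> _) (fun=> _) (fun=> _) Am Ad MA tailP.
rewrite E0 => /(_ _ _ _ _ _ _)/le_trans; apply => //.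
- by move=> x; rewrite psiE cutoff_late ?mul0r.
- by move=> _; rewrite mulr_gt0// powR_gt0.
- by move=> _; rewrite mulr_gt0.
- by move=> _; rewrite mulr_gt0// powR_gt0.
rewrite lee_fin big_nat1 addr0 /riesz_local_const powRM ?(ltW rho0)// [X in shell_const _ _ _ X _]mulrA -/c1.
rewrite shell_constM ?powR_gt0//.
rewrite -(scaling_exponent alpha 2 n%:R pq rho0) /tau -(powR_mulrn 2 (ltW rho0)).
by rewrite [leLHS]mulrCA.
Qed.

End laplacian_case.

(** * Dyadic sums of bumps for beta < 2 *)

Section dyadic_weights.
Context {R : realType} {n : nat}.
Variables (beta rho : R) (beta0 : 0 < beta) (n_ge1 : (1 <= n)%N) (rho0 : 0 < rho).
Implicit Types (x : 'rV[R]_n) (j k N : nat).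

(* [dyadic_bump N] imitates [(1 + |x|/rho)^-(n+beta)] on the ball of radius
   [2^N rho] while keeping a compact support. This profile has the decay of its own
   fractional Laplacian. *)
Definition dyadic_weight k : R := (2 ^+ k) `^ (- (n%:R + beta)).

Definition dyadic_radius k : R := 2 ^+ k * rho.

Let lam : R := 2 `^ (- (n%:R + beta)).

Lemma pow2_powR (k : nat) (e : R) : (2 ^+ k) `^ e = (2 `^ e) ^+ k :> R.
Proof.
by rewrite -powR_mulrn// -powRrM -powR_mulrn ?powR_ge0// -powRrM mulrC.
Qed.

Lemma dyadic_weightE k : dyadic_weight k = lam ^+ k.
Proof. exact: pow2_powR. Qed.

Let lam_gt0 : 0 < lam. Proof. exact: powR_gt0. Qed.

Let lam_le : lam <= 2^-1.
Proof.
have b0 := beta0; rewrite -(powR_inv1 (ler0n R 2)) /lam ler_powR// ?ler1n//.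
have : 1 <= n%:R :> R by rewrite ler1n.
lra.
Qed.

Lemma dyadic_weight_gt0 k : 0 < dyadic_weight k.
Proof. by rewrite /dyadic_weight powR_gt0// exprn_gt0. Qed.

Lemma dyadic_radius_gt0 k : 0 < dyadic_radius k.
Proof. by rewrite mulr_gt0// exprn_gt0. Qed.

Lemma le_dyadic_radius j k : (j <= k)%N -> dyadic_radius j <= dyadic_radius k.
Proof. by move=> jk; rewrite ler_pM2r// ler_eXn2l// ltr1n. Qed.

Lemma geometric_sum_le (N : nat) (z : R) : 0 < z < 1 ->
  \sum_(k < N) z ^+ k <= (1 - z)^-1.
Proof.
move=> /andP[z0 z1].
have := @geometric_le_lim R N 1 z ler01 z0; rewrite ger0_norm ?(ltW z0)// => /(_ z1).
rewrite mul1r; apply: le_trans; rewrite /series/= /geometric/= big_mkord.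
by under [leRHS]eq_bigr do rewrite mul1r.
Qed.

Lemma dyadic_weight_sum_le j N :
  \sum_(k < N) (if (k < j)%N then 0 else dyadic_weight k) <= 2 * dyadic_weight j.
Proof.
(* The subtracted term makes the induction work: consecutive weights shrink at least by half, so
   adding the N-th weight is paid for by its decrease. *)
apply: (@le_trans _ _ (2 * dyadic_weight j - 2 * dyadic_weight (maxn j N))); last first.
  by rewrite gerBl mulr_ge0// ltW// dyadic_weight_gt0.
elim: N => [|N IH]; first by rewrite big_ord0 maxn0 subrr.
rewrite big_ord_recr/=; have [Nj|jN] := ltnP N j.
  rewrite addr0; apply: le_trans IH _.
  by rewrite (maxn_idPl (ltnW Nj)) (maxn_idPl Nj).
rewrite (maxn_idPr jN) in IH; rewrite (maxn_idPr (leqW jN)).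
have := dyadic_weight_gt0 N; rewrite !dyadic_weightE exprS => l0.
have : lam * lam ^+ N <= 2^-1 * lam ^+ N by rewrite ler_wpM2r// ltW.
rewrite !dyadic_weightE in IH; lra.
Qed.

Definition dyadic_total N : R := \sum_(k < N.+1) dyadic_weight k.

Lemma dyadic_total_ge1 N : 1 <= dyadic_total N.
Proof.
rewrite /dyadic_total big_ord_recl dyadic_weightE expr0 lerDl.
by apply: sumr_ge0 => k _; exact/ltW/dyadic_weight_gt0.
Qed.

Lemma dyadic_total_le2 N : dyadic_total N <= 2.
Proof.
have := dyadic_weight_sum_le 0 N.+1.
by rewrite dyadic_weightE expr0 mulr1.
Qed.

(** Normalised to sum to 1 over k <= N. The sum of bumps is then a convex combination, at most 1,
    and at least the bump of radius rho because all radii are at least rho. *)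
Definition dyadic_coef N k : R := dyadic_weight k / dyadic_total N.

Lemma dyadic_total_gt0 N : 0 < dyadic_total N.
Proof. by rewrite (lt_le_trans ltr01)// dyadic_total_ge1. Qed.

Lemma dyadic_coef_ge0 N k : 0 <= dyadic_coef N k.
Proof. by rewrite divr_ge0// ltW// ?dyadic_weight_gt0// dyadic_total_gt0. Qed.

Lemma dyadic_coef_le N k : dyadic_coef N k <= dyadic_weight k.
Proof.
rewrite ler_pdivrMr ?dyadic_total_gt0// ler_peMr ?dyadic_total_ge1//.
exact/ltW/dyadic_weight_gt0.
Qed.

Definition dyadic_bump N x : R := bump_sum N.+1 (dyadic_coef N) dyadic_radius x.

Lemma dyadic_bump_ge0 N x : 0 <= dyadic_bump N x.
Proof.
apply: sumr_ge0 => k _; apply: mulr_ge0; [exact: dyadic_coef_ge0|exact: bump_ge0].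
Qed.

Lemma dyadic_bump_le1 N x : dyadic_bump N x <= 1.
Proof.
apply: (@le_trans _ _ (\sum_(k < N.+1) dyadic_coef N k)).
  apply: ler_sum => k _; apply: ler_piMr; [exact: dyadic_coef_ge0|exact: bump_le1].
by rewrite -mulr_suml -/(dyadic_total N) divff// gt_eqF// dyadic_total_gt0.
Qed.

Lemma qbump_le_dyadic_bump N x : qbump rho x <= dyadic_bump N x.
Proof.
rewrite (_ : qbump rho x = \sum_(k < N.+1) dyadic_coef N k * qbump rho x); last first.
  by rewrite -mulr_suml -mulr_suml -/(dyadic_total N) divff ?mul1r// gt_eqF// dyadic_total_gt0.
apply: ler_sum => k _; apply: ler_wpM2l; first exact: dyadic_coef_ge0.
apply: le_bump => //; rewrite /dyadic_radius ler_peMl ?(ltW rho0)//.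
by rewrite exprn_ege1// ler1n.
Qed.

(** The bumps of index at most j vanish at x; what is left is a geometric tail of weights. *)
Lemma dyadic_bump_far N j x : (j <= N)%N -> dyadic_radius j <= enorm x ->
  dyadic_bump N x <= 2 * dyadic_weight j.+1.
Proof.
move=> jN xj; apply: le_trans (dyadic_weight_sum_le j.+1 N.+1).
apply: ler_sum => k _; case: ifPn => [kj|_].
  rewrite bump_far ?mulr0//; first exact: dyadic_radius_gt0.
  by apply: le_trans xj; apply: le_dyadic_radius.
apply: le_trans (ler_piMr (dyadic_coef_ge0 _ _) (bump_le1 _ _)) _.
exact: dyadic_coef_le.
Qed.

(** Here only the last bump survives. It may be arbitrarily small at x, so it is compared with the
    power |x|^-(n+beta) and treated as part of the tail. *)
Lemma dyadic_bump_last N x : dyadic_radius N.-1 < enorm x -> (0 < N)%N ->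
  dyadic_bump N x <= rho `^ (n%:R + beta) * enorm x `^ (- (n%:R + beta)).
Proof.
move=> Nx N0; rewrite /dyadic_bump /bump_sum big_ord_recr/= big1 ?add0r; last first.
  move=> k _; rewrite bump_far ?mulr0//; first exact: dyadic_radius_gt0.
  by apply: le_trans (ltW Nx); apply: le_dyadic_radius; rewrite -ltnS prednK.
have x0 : 0 < enorm x by rewrite (lt_trans _ Nx)// dyadic_radius_gt0.
have [xN|xN] := leP (dyadic_radius N) (enorm x).
  by rewrite bump_far ?mulr0 ?mulr_ge0 ?powR_ge0//; exact: dyadic_radius_gt0.
apply: le_trans (ler_piMr (dyadic_coef_ge0 _ _) (bump_le1 _ _)) _.
apply: le_trans (dyadic_coef_le _ _) _; rewrite /dyadic_weight !powRN.
rewrite ler_pdivlMr ?powR_gt0// ler_pdivrMl ?powR_gt0 ?exprn_gt0// -powRM ?exprn_ge0 ?(ltW rho0)//.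
apply: ge0_ler_powR; rewrite ?nnegrE ?enorm_ge0 ?mulr_ge0 ?exprn_ge0 ?(ltW rho0) ?(ltW xN)//.
by rewrite addr_ge0// ltW.
Qed.

(** Keeps only the bump of index j + 1: x lies in the ball of half its radius, where it is at least
    (3/4)^4. The factor 1/2 accounts for the normalisation. *)
Lemma dyadic_bump_near N j x : (j < N)%N -> enorm x <= dyadic_radius j ->
  (3 / 4) ^+ 4 * 2^-1 * dyadic_weight j.+1 <= dyadic_bump N x.
Proof.
move=> jN xj; have jN' : (j.+1 < N.+1)%N by [].
rewrite /dyadic_bump /bump_sum (bigD1 (Ordinal jN'))//=.
apply: (@le_trans _ _ (dyadic_coef N j.+1 * qbump (dyadic_radius j.+1) x)); last first.
  rewrite lerDl; apply: sumr_ge0 => k _.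
  by apply: mulr_ge0; [exact: dyadic_coef_ge0|exact: bump_ge0].
rewrite -mulrA mulrC; apply: ler_pM.
- by rewrite mulr_ge0 ?invr_ge0// ltW// dyadic_weight_gt0.
- by rewrite exprn_ge0.
- rewrite /dyadic_coef mulrC ler_wpM2l ?(ltW (dyadic_weight_gt0 _))//.
  by rewrite lef_pV2 ?posrE ?dyadic_total_gt0 ?dyadic_total_le2.
- apply: bump_near; first exact: dyadic_radius_gt0.
  by rewrite (_ : dyadic_radius j.+1 / 2 = dyadic_radius j)// /dyadic_radius exprS; field.
Qed.

End dyadic_weights.

Section dyadic_estimates.
Context {R : realType} {n : nat}.
Variables (beta : R) (beta0 : 0 < beta) (n_ge1 : (1 <= n)%N).
Implicit Types (rho : R) (x : 'rV[R]_n) (j k N : nat).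

Let weight k := @dyadic_weight R n beta k.

Lemma powRN_lt1 (e : R) : 0 < e -> 0 < (2 : R) `^ (- e) < 1.
Proof.
move=> e0; rewrite powR_gt0//= powRN invf_lt1 ?powR_gt0//.
have := @gt0_ltr_powR R e e0 1 2; rewrite powR1; by apply; rewrite ?nnegrE ?ler01 ?ltr1n.
Qed.

(** For |x| <= rho each bump contributes at most rho^-beta times its weight, and the weights sum to
    at most 2. For |x| > rho the decaying bound yields weight times (2^k rho)^n, that is 2^(-k beta)
    rho^n, a geometric series. Hence the constant in [B], uniform in [N]. *)
Lemma fraclap_dyadic_bump_le : beta < 2 ->
  exists2 B : R, 0 < B & forall rho (a : R) N x, 0 < rho -> 0 <= a ->
    `|fraclap beta (bump_sum N.+1 (fun k => a * @dyadic_coef R n beta N k) (dyadic_radius rho)) x| <=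
    a * (B * (rho `^ n%:R * Num.max rho (enorm x) `^ (- (n%:R + beta)))).
Proof.
move=> beta2; have [C C0 fC] := @fraclap_bump_sum R n beta beta0 beta2.
have th01 := powRN_lt1 beta0; have /andP[th0 th1] := th01.
have D0 : 0 < (1 - 2 `^ (- beta))^-1 :> R by rewrite invr_gt0 subr_gt0.
exists (C * (2 + (1 - 2 `^ (- beta))^-1)); first by rewrite mulr_gt0// addr_gt0.
move=> rho a N x rho0 a0.
have [f1 f2] := fC N.+1 (fun k => a * @dyadic_coef R n beta N k) (dyadic_radius rho) x
  (fun k => mulr_ge0 a0 (dyadic_coef_ge0 _ N k)) (dyadic_radius_gt0 rho0).
set P := Num.max _ _ `^ _.
have P0 : 0 <= P by exact: powR_ge0.
have rn : 0 <= rho `^ n%:R by exact: powR_ge0.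
have [xr|rx] := leP (enorm x) rho.
- apply: le_trans f1 _; rewrite /P max_l//.
  have -> : a * (C * (2 + (1 - 2 `^ (- beta))^-1) * (rho `^ n%:R * rho `^ (- (n%:R + beta)))) =
     C * (a * ((2 + (1 - 2 `^ (- beta))^-1) * rho `^ (- beta))).
    rewrite -powRD ?(gt_eqF rho0) ?implybT// (_ : n%:R + - (n%:R + beta) = - beta); [ring|ring].
  rewrite ler_pM2l//; under eq_bigr do rewrite -mulrA.
  rewrite -mulr_sumr ler_wpM2l//.
  apply: (@le_trans _ _ (2 * rho `^ (- beta))); last first.
    by rewrite ler_wpM2r ?powR_ge0// lerDl ltW.
  apply: (@le_trans _ _ (\sum_(k < N.+1) weight k * rho `^ (- beta))).
    apply: ler_sum => k _; apply: ler_pM; rewrite ?powR_ge0 ?dyadic_coef_ge0 ?dyadic_coef_le//.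
    rewrite !powRN lef_pV2 ?posrE ?powR_gt0 ?dyadic_radius_gt0//.
    apply: ge0_ler_powR; rewrite ?nnegrE ?(ltW beta0) ?(ltW rho0) ?(ltW (dyadic_radius_gt0 rho0 _))//.
    by rewrite /dyadic_radius ler_peMl ?(ltW rho0)// exprn_ege1// ler1n.
  by rewrite -mulr_suml ler_wpM2r ?powR_ge0//; exact: dyadic_total_le2.
- have x0 : x != 0.
    apply/eqP => x0; have := enorm_sqr x; rewrite big1; last by move=> i _; rewrite x0 mxE expr0n.
    by move/eqP; rewrite sqrf_eq0 gt_eqF// (lt_trans rho0).
  apply: le_trans (f2 x0) _; rewrite /P max_r ?(ltW rx)//.
  have -> : a * (C * (2 + (1 - 2 `^ (- beta))^-1) * (rho `^ n%:R * enorm x `^ (- (n%:R + beta)))) =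
     C * (a * ((2 + (1 - 2 `^ (- beta))^-1) * rho `^ n%:R * enorm x `^ (- (n%:R + beta)))) by ring.
  rewrite ler_pM2l//; under eq_bigr do rewrite -mulrA.
  rewrite -mulr_sumr ler_wpM2l//; under eq_bigr do rewrite mulrA.
  rewrite -mulr_suml ler_wpM2r ?powR_ge0//.
  apply: (@le_trans _ _ (\sum_(k < N.+1) (2 `^ (- beta)) ^+ k * rho `^ n%:R)).
    apply: ler_sum => k _.
    apply: le_trans (ler_wpM2r (powR_ge0 _ _) (dyadic_coef_le _ _ _)) _.
    rewrite /dyadic_radius powRM ?exprn_ge0 ?(ltW rho0)// mulrA ler_wpM2r//.
    rewrite /dyadic_weight -powRD; last by apply/implyP => _; rewrite gt_eqF ?exprn_gt0.
    by rewrite -pow2_powR (_ : - (n%:R + beta) + n%:R = - beta)//; ring.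
  rewrite -mulr_suml ler_wpM2r//; apply: le_trans (geometric_sum_le _ th01) _.
  by rewrite lerDr.
Qed.

End dyadic_estimates.

Section dyadic_shells.
Context {R : realType} {n : nat}.
Variables (rho : R) (rho0 : 0 < rho).
Implicit Types (x y : 'rV[R]_n) (j N : nat).

Definition dyadic_shell j : set 'rV[R]_n :=
  [set x | enorm (0 - x) <= dyadic_radius rho j] `&`
  (if j is i.+1 then [set x | dyadic_radius rho i < enorm (0 - x)] else setT).

Lemma measurable_dyadic_shell j : measurable (dyadic_shell j).
Proof.
by apply: measurableI; [exact: measurable_enorm_le|case: j => // i; exact: measurable_enorm_gt].
Qed.

Lemma dyadic_shell_le j x : dyadic_shell j x -> enorm x <= dyadic_radius rho j.
Proof. by case=> /=; rewrite sub0r enormN. Qed.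

Lemma dyadic_shell_gt j x : dyadic_shell j.+1 x -> dyadic_radius rho j < enorm x.
Proof. by case=> _ /=; rewrite sub0r enormN. Qed.

Lemma trivIset_dyadic_shell : trivIset setT dyadic_shell.
Proof.
apply: ltn_trivIset => -[|i] j // ji; apply/seteqP; split => // x [/dyadic_shell_le xj].
by move=> /dyadic_shell_gt; rewrite ltNge (le_trans xj)// le_dyadic_radius.
Qed.

Lemma bigcup_dyadic_shell N :
  \big[setU/set0]_(0 <= j < N.+1) dyadic_shell j =
  [set x | enorm (0 - x) <= dyadic_radius rho N].
Proof.
elim: N => [|N IH]; first by rewrite big_nat1 /dyadic_shell setIT.
rewrite big_nat_recr//= IH; apply/seteqP; split => x /=.
  move=> [xN|[]//]; apply: le_trans xN _; exact: le_dyadic_radius.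
move=> xN; have [le|lt] := leP (enorm (0 - x)) (dyadic_radius rho N); first by left.
by right.
Qed.

Lemma lebesgue_dyadic_shell_le j :
  (lebesgue_rV R n (dyadic_shell j) <= (2 ^+ n * (rho `^ n%:R * (2 ^+ j) `^ n%:R))%:E)%E.
Proof.
apply: (@le_trans _ _ (2 ^+ n * dyadic_radius rho j `^ n%:R)%:E).
  apply: le_trans (lebesgue_rV_ball_le 0 (dyadic_radius_gt0 rho0 j)).
  apply: le_measure; rewrite ?inE; [exact: measurable_dyadic_shell|exact: measurable_enorm_le|].
  by move=> x [].
by rewrite /dyadic_radius powRM ?exprn_ge0 ?(ltW rho0)// [X in _ * X]mulrC.
Qed.

Lemma dyadic_shell_diam j x y : dyadic_shell j x -> dyadic_shell j y ->
  enorm (x - y) <= 2 * dyadic_radius rho j.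
Proof. by move=> /dyadic_shell_le xj /dyadic_shell_le yj; exact: enormB_le2. Qed.

Lemma dyadic_shell_max j x : dyadic_shell j x ->
  dyadic_radius rho j / 2 <= Num.max rho (enorm x).
Proof.
rewrite le_max; case: j => [_|j /dyadic_shell_gt xj]; apply/orP.
  by left; rewrite /dyadic_radius expr0 mul1r ler_pdivrMr// ler_peMr ?(ltW rho0)// ler1n.
right; apply: le_trans (ltW xj); rewrite /dyadic_radius exprS le_eqVlt.
by apply/orP; left; apply/eqP; field.
Qed.

Variables (beta : R) (beta0 : 0 < beta) (n_ge1 : (1 <= n)%N).

Let weight k := @dyadic_weight R n beta k.

Lemma dyadic_weightS k : weight k.+1 = 2 `^ (- (n%:R + beta)) * weight k.
Proof. by rewrite /weight !dyadic_weightE exprS. Qed.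

Lemma dyadic_shell_kernel j x : dyadic_shell j x ->
  rho `^ n%:R * Num.max rho (enorm x) `^ (- (n%:R + beta)) <=
  2 `^ (n%:R + beta) * (rho `^ (- beta) * weight j).
Proof.
move=> /dyadic_shell_max xj.
have k0 : 0 <= n%:R + beta by rewrite addr_ge0// ltW.
have h0 : 0 < dyadic_radius rho j / 2 by rewrite divr_gt0 ?dyadic_radius_gt0.
apply: (@le_trans _ _ (rho `^ n%:R * (dyadic_radius rho j / 2) `^ (- (n%:R + beta)))).
  rewrite ler_wpM2l ?powR_ge0// !powRN lef_pV2 ?posrE ?powR_gt0 ?(lt_le_trans h0)//.
  by apply: ge0_ler_powR; rewrite ?nnegrE// ?(ltW h0) ?(le_trans (ltW h0)).
rewrite /dyadic_radius !powRM ?mulr_ge0 ?exprn_ge0 ?invr_ge0 ?(ltW rho0)//.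
rewrite [X in _ * (_ * X)](_ : _ = 2 `^ (n%:R + beta)); last first.
  by rewrite -powR_inv1// -powRrM mulN1r opprK.
rewrite (_ : rho `^ (- beta) = rho `^ n%:R * rho `^ (- (n%:R + beta))); last first.
  by rewrite -powRD ?(gt_eqF rho0) ?implybT//; congr (_ `^ _); ring.
by rewrite /weight /dyadic_weight le_eqVlt; apply/orP; left; apply/eqP; ring.
Qed.

Lemma dyadic_shell_bump_le N j x : (j <= N.+1)%N -> dyadic_shell j x ->
  dyadic_bump beta rho N x <= 2 * weight j.
Proof.
case: j => [_ _|j jN /dyadic_shell_gt/ltW xj].
  by rewrite /weight dyadic_weightE expr0 mulr1 (le_trans (dyadic_bump_le1 _ _ _ _))// ler1n.
exact: dyadic_bump_far.
Qed.

Lemma dyadic_shell_bump_ge N j x : (j < N)%N -> dyadic_shell j x ->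
  (3 / 4) ^+ 4 / 2 * 2 `^ (- (n%:R + beta)) * weight j <= dyadic_bump beta rho N x.
Proof.
move=> jN /dyadic_shell_le xj; rewrite -mulrA -dyadic_weightS.
exact: dyadic_bump_near.
Qed.

End dyadic_shells.

Section powR_interpolation.
Context {R : realType}.
Variables (r : R) (r1 : 1 < r).

(** Turns a bound by the weight [w] into a multiple of y^(1/r), where y is the test function:
    w^(1/r) <= c^(-1/r) y^(1/r). This and the next lemma produce the form that [shell_inequality]
    requires. *)
Lemma le_powR_interpolation_ge (c w y : R) : 0 < c -> 0 < w -> c * w <= y ->
  w <= c `^ (- r^-1) * (w `^ (1 - r^-1) * y `^ r^-1).
Proof.
move=> c0 w0 cwy; have r10 := r1.
apply: (@le_trans _ _ (c `^ (- r^-1) * (w `^ (1 - r^-1) * (c * w) `^ r^-1))); last first.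
  rewrite ler_wpM2l ?powR_ge0// ler_wpM2l ?powR_ge0//.
  have cw0 : 0 < c * w by rewrite mulr_gt0.
  apply: ge0_ler_powR; rewrite ?nnegrE ?invr_ge0 ?(ltW cw0) ?(le_trans (ltW cw0) cwy)//.
  lra.
rewrite powRM ?(ltW c0) ?(ltW w0)//.
rewrite (_ : _ * _ = c `^ (- r^-1) * c `^ r^-1 * (w `^ (1 - r^-1) * w `^ r^-1)); last by ring.
rewrite -!powRD ?(gt_eqF c0) ?(gt_eqF w0) ?implybT//.
by rewrite addNr powRr0 subrK powRr1 ?mul1r// ltW.
Qed.

Lemma le_powR_interpolation_le (w y : R) : 0 <= w -> 0 <= y <= 2 * w ->
  y <= 2 * (w `^ (1 - r^-1) * y `^ r^-1).
Proof.
move=> w0 /andP[]; rewrite le_eqVlt => /predU1P[<- _|y0 yw].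
  by rewrite mulr_ge0// mulr_ge0 ?powR_ge0.
have r10 := r1; have ri : 0 < r^-1 < 1 by rewrite invr_gt0 invf_lt1//; lra.
rewrite mulrA; apply: (@le_trans _ _ (y `^ (1 - r^-1) * y `^ r^-1)).
  by rewrite -powRD ?(gt_eqF y0) ?implybT// subrK powRr1// ltW.
rewrite ler_wpM2r ?powR_ge0//.
apply: (@le_trans _ _ ((2 * w) `^ (1 - r^-1))).
  by apply: ge0_ler_powR; rewrite ?nnegrE ?(ltW y0) ?mulr_ge0//; lra.
rewrite powRM// ler_wpM2r ?powR_ge0//.
rewrite -[leRHS]powRr1// ler_powR ?ler1n//; lra.
Qed.

End powR_interpolation.

(** * The case beta < 2 *)

Section fractional_case.
Context {R : realType} {n : nat}.
Variables (p q alpha beta : R) (p_gt0 : 0 < p) (q_gt0 : 0 < q) (pq : 2 < p + q).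
Variables (n_ge1 : (1 <= n)%N) (alpha_gt0 : 0 < alpha) (alpha_ltn : alpha < n%:R).
Variables (beta0 : 0 < beta) (beta2 : beta < 2).
Implicit Types (x : 'rV[R]_n) (rho B : R).

Let r := p + q.
Let kappa : R := n%:R + beta.
Let weight k := @dyadic_weight R n beta k.
Let Z := (measurableTypeR R * 'rV[R]_n)%type.

Definition frac_majorant B rho (z : Z) : R :=
  cutoff (rho `^ beta) z.1 * (B * (rho `^ n%:R * Num.max rho (enorm z.2) `^ (- kappa))).

Definition time_majorant rho N (z : Z) : R :=
  4 / rho `^ beta * Num.max 0 (1 - z.1 / rho `^ beta) ^+ 3 * dyadic_bump beta rho N z.2.

Lemma measurable_frac_majorant B rho : measurable_fun setT (frac_majorant B rho).
Proof.
apply: measurable_funM.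
  apply: measurable_funX; apply: measurable_maxr => //.
  by apply: measurable_funB => //; apply: measurable_funM.
do 2! apply: measurable_funM => //.
apply: (measurableT_comp (measurable_powR _)); apply: measurable_maxr => //.
exact: (measurableT_comp (measurable_enorm (n := n)) measurable_snd).
Qed.

Lemma measurable_time_majorant rho N : measurable_fun setT (time_majorant rho N).
Proof.
apply: measurable_funM; last exact: (measurableT_comp (measurable_bump_sum _ _ _) measurable_snd).
apply: measurable_funM => //; apply: measurable_funX; apply: measurable_maxr => //.
by apply: measurable_funB => //; apply: measurable_funM.
Qed.

Lemma frac_majorant_ge0 B rho z : 0 <= B -> 0 <= frac_majorant B rho z.
Proof.
move=> B0; apply: mulr_ge0; first exact: cutoff_ge0.
by apply: mulr_ge0 => //; apply: mulr_ge0; exact: powR_ge0.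
Qed.

Lemma time_majorant_ge0 rho N z : 0 <= time_majorant rho N z.
Proof.
apply: mulr_ge0; last exact: dyadic_bump_ge0.
apply: mulr_ge0; first by rewrite divr_ge0 ?powR_ge0.
by rewrite exprn_ge0// le_max lexx.
Qed.

(** The first summand comes from the fractional Laplacian: 2^kappa from [dyadic_shell_kernel], the
    rest from the lower bound [dyadic_shell_bump_ge] raised to the power -1/r. The 8 is the 4 of the
    cutoff derivative times the 2 of [le_powR_interpolation_le]. *)
Definition shell_factor B : R :=
  B * (2 `^ kappa * ((3 / 4) ^+ 4 / 2 * 2 `^ (- kappa)) `^ (- r^-1)) + 8.

(** The restriction to j < N is essential: on the last shell the bump falls to 0 at the outer edge,
    whereas the majorant of its fractional Laplacian does not. *)
Lemma majorants_on_shell B rho N j t x : 0 <= B -> 0 < rho -> (j < N)%N ->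
  0 < t < rho `^ beta -> dyadic_shell rho j x ->
  frac_majorant B rho (t, x) + time_majorant rho N (t, x) <=
  shell_factor B * (rho `^ (- beta) * (2 ^+ j) `^ (- (kappa * (1 - r^-1)))) *
  test_fun (rho `^ beta) N.+1 (@dyadic_coef R n beta N) (dyadic_radius rho) t x `^ r^-1.
Proof.
move=> B0 rho0 jN /andP[t0 t1] xj.
have tau0 : 0 < rho `^ beta by rewrite powR_gt0.
have r2 := pq; have r1 : 1 < r by rewrite /r; lra.
have cut0 := cutoff_ge0 (rho `^ beta) t; have cut1 := cutoff_le1 tau0 (ltW t0).
rewrite test_funE -/(dyadic_bump beta rho N x) powRM ?dyadic_bump_ge0//.
have w0 : 0 < weight j by exact: dyadic_weight_gt0.
have wE : (2 ^+ j) `^ (- (kappa * (1 - r^-1))) = weight j `^ (1 - r^-1).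
  by rewrite /weight /dyadic_weight -powRrM mulNr.
have rb0 : 0 <= rho `^ (- beta) by exact: powR_ge0.
rewrite wE /shell_factor.
set y := dyadic_bump beta rho N x; set c := (3 / 4) ^+ 4 / 2 * _.
set cut := cutoff _ _ in cut0 cut1 *.
have c0 : 0 < c by rewrite /c mulr_gt0 ?powR_gt0.
have cutp : cut <= cut `^ r^-1 by apply: le_powR_inv; rewrite ?cut0.
have I1 := le_powR_interpolation_ge r1 c0 w0 (dyadic_shell_bump_ge rho0 beta0 n_ge1 jN xj).
have y02 : 0 <= y <= 2 * weight j.
  by rewrite dyadic_bump_ge0 (dyadic_shell_bump_le rho0 beta0 n_ge1 (leqW (ltnW jN)) xj).
have I2 := le_powR_interpolation_le r1 (ltW w0) y02.
rewrite -/y in I1.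
set X := weight j `^ _ in I1 I2 *; set Y := y `^ _ in I1 I2 *.
have X0 : 0 <= X by exact: powR_ge0.
have Y0 : 0 <= Y by exact: powR_ge0.
have -> : (B * (2 `^ kappa * c `^ (- r^-1)) + 8) * (rho `^ (- beta) * X) * (cut `^ r^-1 * Y) =
   cut `^ r^-1 * (B * (2 `^ kappa * (rho `^ (- beta) * (c `^ (- r^-1) * (X * Y))))) +
   rho `^ (- beta) * 4 * (cut `^ r^-1 * (2 * (X * Y))) by ring.
apply: lerD.
- rewrite /frac_majorant /=; apply: ler_pM => //.
    by apply: mulr_ge0 => //; apply: mulr_ge0; exact: powR_ge0.
  rewrite ler_wpM2l//; apply: le_trans (dyadic_shell_kernel rho0 beta0 xj) _.
  by rewrite ler_wpM2l ?powR_ge0// ler_wpM2l.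
- rewrite /time_majorant/= powRN -/y [4 / _]mulrC -mulrA; apply: ler_wpM2l.
    by rewrite mulr_ge0// invr_ge0 powR_ge0.
  apply: ler_pM => //; [|by case/andP: y02|].
    by rewrite exprn_ge0// le_max lexx.
  apply: cube_le_powR_quartic => //.
  by rewrite le_max lexx cutoff_base_le1// ltW.
Qed.

(** Each term is a fixed constant times a power of rho times the j-th power of a ratio below 1, so
    the bound does not see the number of shells. *)
Lemma shell_const_sum_le rho B N : 0 < B -> 0 < rho ->
  rho `^ beta * (\sum_(0 <= j < N) shell_const p q
    (B * (rho `^ (- beta) * (2 ^+ j) `^ (- (kappa * (1 - r^-1)))))
    (riesz_local_const (n := n) alpha (2 * dyadic_radius rho j))
    (2 ^+ n * (rho `^ n%:R * (2 ^+ j) `^ n%:R))) <=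
  shell_const p q B (riesz_const n alpha * 2 `^ (alpha - n%:R)) (2 ^+ n) *
    (1 - 2 `^ (- (beta + alpha / (r - 1))))^-1 *
    rho `^ (n%:R - (alpha + beta) / (r - 1)).
Proof.
move=> B0 rho0; have r2 := pq; have r1 : 0 < r - 1 by rewrite /r; lra.
have C0 := riesz_const_gt0 alpha_gt0 alpha_ltn.
have c0 : 0 < riesz_const n alpha * 2 `^ (alpha - n%:R) by rewrite mulr_gt0// powR_gt0.
set c1 := riesz_const n alpha * _ in c0 *.
have m0 : 0 < 2 ^+ n :> R by rewrite exprn_gt0.
have K0 : 0 <= shell_const p q B c1 (2 ^+ n).
  by rewrite /shell_const mulr_ge0 ?powR_ge0// !mulr_ge0// ltW.
have e0 : 0 < beta + alpha / (r - 1) by rewrite addr_gt0// divr_gt0.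
have th := powRN_lt1 e0.
have E (j : nat) : shell_const p q
    (B * (rho `^ (- beta) * (2 ^+ j) `^ (- (kappa * (1 - r^-1)))))
    (riesz_local_const (n := n) alpha (2 * dyadic_radius rho j))
    (2 ^+ n * (rho `^ n%:R * (2 ^+ j) `^ n%:R)) =
    shell_const p q B c1 (2 ^+ n) *
    (rho `^ (- beta) * rho `^ n%:R *
      (rho `^ (- beta) / (rho `^ (alpha - n%:R) * rho `^ n%:R)) `^ (r - 1)^-1) *
    (2 `^ (- (beta + alpha / (r - 1)))) ^+ j.
  have j0 : 0 < 2 ^+ j :> R by rewrite exprn_gt0.
  rewrite /riesz_local_const /dyadic_radius.
  rewrite (powRM (x := 2)) ?mulr_ge0 ?(ltW j0) ?(ltW rho0)// (powRM (x := 2 ^+ j)) ?(ltW j0) ?(ltW rho0)//.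
  rewrite (_ : riesz_const n alpha * _ = c1 * rho `^ (alpha - n%:R) * (2 ^+ j) `^ (alpha - n%:R)); last first.
    by rewrite /c1; ring.
  have h1 : 0 < B * rho `^ (- beta) by rewrite mulr_gt0// powR_gt0.
  have h2 : 0 < c1 * rho `^ (alpha - n%:R) by exact: mulr_gt0 c0 (powR_gt0 _ rho0).
  have h3 : 0 < 2 ^+ n * rho `^ n%:R by rewrite mulr_gt0// powR_gt0.
  rewrite (mulrA B) (mulrA (2 ^+ n)) shell_constM ?powR_gt0//.
  rewrite shell_constM ?powR_gt0// (shell_exponent alpha beta n%:R pq j0).
  by rewrite pow2_powR.
under eq_bigr do rewrite E.
rewrite -mulr_sumr big_mkord.
rewrite -(scaling_exponent alpha beta n%:R pq rho0) -/r.
set S := rho `^ (- beta) * _ * _; set T := \sum_(_ < _) _.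
have S0 : 0 <= S by rewrite mulr_ge0 ?powR_ge0// mulr_ge0 ?powR_ge0.
have -> : rho `^ beta * (shell_const p q B c1 (2 ^+ n) * S * T) =
  shell_const p q B c1 (2 ^+ n) * T * (rho `^ beta * S) by ring.
apply: ler_wpM2r; first by rewrite mulr_ge0 ?powR_ge0.
apply: ler_wpM2l => //; exact: geometric_sum_le.
Qed.

(** Beyond the last but one radius both majorants are compared with |x|^-(n+beta), the weight for
    which [far_integrable] provides integrability of the solution. *)
Lemma majorants_far B rho N t x : 0 <= B -> 0 < rho -> 0 < t ->
  dyadic_radius rho N < enorm x ->
  frac_majorant B rho (t, x) + time_majorant rho N.+1 (t, x) <=
  (B + 4) * rho `^ n%:R * enorm x `^ (- kappa).
Proof.
move=> B0 rho0 t0 Nx; have tau0 : 0 < rho `^ beta by rewrite powR_gt0.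
have P0 : 0 <= enorm x `^ (- kappa) by exact: powR_ge0.
have rx : rho <= enorm x.
  apply: le_trans (ltW Nx); rewrite /dyadic_radius ler_peMl ?(ltW rho0)//.
  by rewrite exprn_ege1// ler1n.
have cut0 := cutoff_ge0 (rho `^ beta) t; have cut1 := cutoff_le1 tau0 (ltW t0).
have -> : (B + 4) * rho `^ n%:R * enorm x `^ (- kappa) =
   B * (rho `^ n%:R * enorm x `^ (- kappa)) + 4 * (rho `^ n%:R * enorm x `^ (- kappa)) by ring.
apply: lerD.
  rewrite /frac_majorant/= max_r//; apply: ler_piMl => //.
  by rewrite mulr_ge0// mulr_ge0// powR_ge0.
rewrite /time_majorant/=.
have last := dyadic_bump_last beta0 rho0 (Nx : dyadic_radius rho N.+1.-1 < _) (ltn0Sn N).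
apply: (@le_trans _ _ (4 / rho `^ beta * (rho `^ (n%:R + beta) * enorm x `^ (- kappa)))).
  apply: ler_pM => //; first by rewrite mulr_ge0 ?divr_ge0 ?powR_ge0// exprn_ge0// le_max lexx.
    exact: dyadic_bump_ge0.
  apply: ler_piMr; first by rewrite divr_ge0 ?powR_ge0.
  by rewrite exprn_ile1 ?cutoff_base_le1 ?le_max ?lexx// ltW.
rewrite powRD ?(gt_eqF rho0) ?implybT// le_eqVlt; apply/orP; left; apply/eqP.
by field; rewrite gt_eqF.
Qed.

(** The number of bumps is chosen after rho and delta, to make the tail less than delta; [C] is
    unaffected because all shell estimates are uniform in that number. *)
Lemma fractional_bound (u0 : 'rV[R]_n -> R) (u : R -> 'rV[R]_n -> R) :
  global_weak_solution p q alpha beta u0 u ->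
  exists2 C : R, 0 < C & forall rho delta, 0 < rho -> 0 < delta ->
    exists phi : 'rV[R]_n -> R, [/\ measurable_fun setT phi,
      forall x, qbump rho x <= phi x <= 1,
      Lintegrable (lebesgue_rV R n) setT (fun x => (u0 x * phi x)%:E) &
      (\int[lebesgue_rV R n]_x (u0 x * phi x)%:E <=
        (C * rho `^ (n%:R - (alpha + beta) / (p + q - 1)) + delta)%:E)%E].
Proof.
move=> [uL _ wid].
have r2 := pq; have r1 : 0 < r - 1 by rewrite /r; lra.
have [v mv uv] := exists_borel_rep uL.
have C0 := riesz_const_gt0 alpha_gt0 alpha_ltn.
have [B1 B10 fB1] := fraclap_dyadic_bump_le beta0 n_ge1 beta2.
pose B := shell_factor B1.
have B0 : 0 < B.
  by rewrite ltr_wpDl// mulr_ge0 ?(ltW B10)// mulr_ge0 ?powR_ge0.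
have c10 : 0 < riesz_const n alpha * 2 `^ (alpha - n%:R) by rewrite mulr_gt0// powR_gt0.
have m10 : 0 < 2 ^+ n :> R by rewrite exprn_gt0.
have /andP[_ th1] : 0 < (2 : R) `^ (- (beta + alpha / (r - 1))) < 1.
  by apply: powRN_lt1; rewrite addr_gt0// divr_gt0.
exists (shell_const p q B (riesz_const n alpha * 2 `^ (alpha - n%:R)) (2 ^+ n) *
    (1 - 2 `^ (- (beta + alpha / (r - 1))))^-1).
  apply: mulr_gt0; last by rewrite invr_gt0 subr_gt0.
  apply: mulr_gt0; last by apply: powR_gt0; apply: divr_gt0 => //; exact: mulr_gt0.
  by apply: mulr_gt0 => //; apply: mulr_gt0.
move=> rho delta rho0 delta0; pose tau := rho `^ beta.
have tau0 : 0 < tau by rewrite powR_gt0.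
have mT : measurable (`]0, tau[%classic : set (measurableTypeR R)) by [].
pose farE (s : R) : set Z := `]0%R, tau[%classic `*` [set x | (s < enorm (0 - x))%R].
have mfar s : measurable (farE s) by apply: measurableX => //; exact: measurable_enorm_gt.
pose h (z : Z) := (`|v z| * enorm z.2 `^ (- kappa))%:E.
have mh D : measurable_fun D h.
  apply: measurable_funTS; apply/measurable_EFinP; apply: measurable_funM.
    exact: measurableT_comp.
  exact: (measurableT_comp (measurableT_comp (measurable_powR _) (measurable_enorm (n := n))) measurable_snd).
have h0 z : (0 <= h z)%E by rewrite lee_fin mulr_ge0// powR_ge0.
have hfin : (\int[lebesgue_tx R n]_(z in farE (4 * rho)%R) h z < +oo)%E.
  have wid4 := wid _ tau (@test_funP R n (2 * tau) (mulr_gt0 (ltr0Sn R 1) tau0) 1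
    (fun=> 1) (fun=> rho) rho (fun=> rho0) (fun _ _ => lexx rho)) (ltW tau0) (ltry _).
  exact: (far_integrable beta0 beta2 n_ge1 mv uv rho0 tau0 wid4).
pose K := (B1 + 4) * rho `^ n%:R.
have K0 : 0 < K by rewrite mulr_gt0 ?powR_gt0// addr_gt0.
(* [K] is the constant of [majorants_far]. The shift by 2 makes the radius at least 4 rho, where
   [hfin] applies. *)
have [k tailk] : exists k : nat,
    (\int[lebesgue_tx R n]_(z in farE (dyadic_radius rho k.+2)) h z < (delta / K)%:E)%E.
  have far4 j : 4 * rho <= dyadic_radius rho j.+2.
    rewrite /dyadic_radius ler_pM2r// (_ : 4 = 2 ^+ 2 :> R); last by rewrite expr2; ring.
    by rewrite ler_eXn2l// ltr1n.
  have dK0 : 0 < delta / K by rewrite divr_gt0.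
  have sub j : farE (dyadic_radius rho j.+2) `<=` farE (4 * rho).
    by move=> z [zt /= zj]; split => //=; exact: le_lt_trans (far4 j) zj.
  have empty z : \forall j \near \oo, ~ farE (dyadic_radius rho j.+2) z.
    exists (Num.bound (enorm (0 - z.2) / rho)) => // j /= mj [_ /=].
    apply/negP; rewrite -leNgt /dyadic_radius -ler_pdivrMr//.
    have zr : 0 <= enorm (0 - z.2) / rho by rewrite divr_ge0 ?enorm_ge0// ltW.
    apply: le_trans (ltW (archi_boundP zr)) _.
    rewrite -natrX ler_nat (leq_trans mj)// (leq_trans _ (ltnW (ltn_expl j.+2 (ltnSn 1))))//.
    by rewrite leqW.
  have [k _ kP] := integral_tail_small (mu := lebesgue_tx R n) (h := h)
    (mfar _) (mh _) h0 hfin (fun j => mfar (dyadic_radius rho j.+2)) sub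
    (fun z _ => empty z) dK0.
  by exists k; apply: kP => /=.
(* The [k.+4] bumps have indices up to k + 3, so [majorants_on_shell] covers the shells below k + 3,
   which fill the ball of radius index k + 2. Outside that ball only the last bump is left. *)
pose psi := test_fun tau k.+4 (@dyadic_coef R n beta k.+3) (dyadic_radius rho) : R -> 'rV[R]_n -> R.
have psiE t x : psi t x = cutoff tau t * dyadic_bump beta rho k.+3 x by exact: test_funE.
have tf : test_function +oo psi.
  apply: (@test_funP R n tau tau0 k.+4 _ _ (dyadic_radius rho k.+4)).
    exact: dyadic_radius_gt0.
  by move=> j jk; apply: le_dyadic_radius => //; exact: ltnW.
have widp := wid psi tau tf (ltW tau0) (ltry _).
have psi00 x : psi 0 x = dyadic_bump beta rho k.+3 x by rewrite psiE cutoff0 mul1r.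
have [_ Lf2 _ _] := widp.
have E0 : (fun x => (u0 x * psi 0 x)%:E) = (fun x => (u0 x * dyadic_bump beta rho k.+3 x)%:E).
  by apply/funext => x; rewrite psi00.
rewrite E0 in Lf2.
exists (dyadic_bump beta rho k.+3); split => //.
- exact: measurable_bump_sum.
- by move=> x; rewrite qbump_le_dyadic_bump// dyadic_bump_le1.
have psi0 t x : 0 <= psi t x.
  by rewrite psiE; apply: mulr_ge0; [exact: cutoff_ge0|exact: dyadic_bump_ge0].
have LM1 t x : 0 < t < tau -> `|fraclap beta (psi t) x| <= frac_majorant B1 rho (t, x).
  move=> /andP[t0 _]; exact: fB1 (cutoff_ge0 _ _).
have LM2 t x : 0 < t < tau -> `|time_deriv psi t x| <= time_majorant rho k.+3 (t, x).
  move=> /andP[t0 _]; rewrite /psi time_deriv_test_fun ?(ltW t0)// /cutoff' /time_majorant/= -/tau.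
  rewrite normrM (ger0_norm (dyadic_bump_ge0 _ _ _ _)) normrM normrN.
  by rewrite !ger0_norm ?divr_ge0 ?(ltW tau0)// exprn_ge0// le_max lexx.
have Ubig := @bigcup_dyadic_shell R n rho rho0 k.+2.
have tailP : (\int[lebesgue_tx R n]_(z in `]0%R, tau[%classic `*`
      ~` \big[setU/set0]_(0 <= j < k.+3) @dyadic_shell R n rho j)
     (`|v z| * (frac_majorant B1 rho z + time_majorant rho k.+3 z))%:E <= delta%:E)%E.
  rewrite Ubig (_ : ~` _ = [set x | dyadic_radius rho k.+2 < enorm (0 - x)]); last first.
    by apply/seteqP; split => x /=; rewrite ltNge => /negP.
  rewrite -/(farE _).
  apply: (@le_trans _ _ (\int[lebesgue_tx R n]_(z in farE (dyadic_radius rho k.+2)) (K%:E * h z))%E).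
    apply: ge0_le_integral => //.
    - move=> z _; rewrite lee_fin mulr_ge0// addr_ge0 ?time_majorant_ge0//.
      exact: frac_majorant_ge0 (ltW B10).
    - apply/measurable_EFinP; apply: measurable_funTS; apply: measurable_funM.
        exact: measurableT_comp.
      by apply: measurable_funD; [exact: measurable_frac_majorant|exact: measurable_time_majorant].
    - by apply: emeasurable_funM.
    - move=> -[t x] [/= zt]; rewrite sub0r enormN => xfar.
      have t0 : 0 < t by move: zt; rewrite in_itv/= => /andP[].
      rewrite /h -EFinM lee_fin/= mulrCA; apply: ler_wpM2l => //.
      exact: majorants_far (ltW B10) rho0 t0 xfar.
  rewrite ge0_integralZl//; last by rewrite lee_fin ltW.
  apply: (@le_trans _ _ (K%:E * (delta / K)%:E)%E).
    by rewrite lee_wpmul2l ?lee_fin ?(ltW K0)// ltW.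
  by rewrite -EFinM lee_fin mulrC divfK// gt_eqF.
have MA j t x : (j < k.+3)%N -> 0 < t < tau -> dyadic_shell rho j x ->
    frac_majorant B1 rho (t, x) + time_majorant rho k.+3 (t, x) <=
    B * (rho `^ (- beta) * (2 ^+ j) `^ (- (kappa * (1 - r^-1)))) * psi t x `^ (p + q)^-1.
  by move=> jk t0 xj; exact: majorants_on_shell (ltW B10) rho0 jk t0 xj.
have psitau x : psi tau x = 0 by rewrite psiE cutoff_late ?mul0r.
have two0 j : 0 < 2 ^+ j :> R by rewrite exprn_gt0.
have b0 j : 0 < B * (rho `^ (- beta) * (2 ^+ j) `^ (- (kappa * (1 - r^-1)))).
  by rewrite !mulr_gt0 ?powR_gt0.
have d0 j : 0 < 2 * dyadic_radius rho j by rewrite mulr_gt0// dyadic_radius_gt0.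
have m0 j : 0 < 2 ^+ n * (rho `^ n%:R * (2 ^+ j) `^ n%:R) by rewrite !mulr_gt0 ?powR_gt0.
have := absorbed_inequality p_gt0 q_gt0 pq alpha_gt0 alpha_ltn mv uv tau0 widp
  (measurable_test_fun tau _ _ _) psi0 psitau (measurable_frac_majorant B1 rho)
  (measurable_time_majorant rho k.+3) (fun z => frac_majorant_ge0 rho z (ltW B10))
  (time_majorant_ge0 rho k.+3) LM1 LM2 (measurable_dyadic_shell rho)
  (trivIset_dyadic_shell rho0) b0 d0 m0 (lebesgue_dyadic_shell_le rho0)
  (@dyadic_shell_diam R n rho) MA tailP.
rewrite E0 => /le_trans; apply.
by rewrite lee_fin lerD2r; exact: shell_const_sum_le.
Qed.

End fractional_case.

(** * Nonexistence *)

Section blow_up.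
Context {R : realType} {n : nat}.
Variables (p q alpha beta : R) (p_gt0 : 0 < p) (q_gt0 : 0 < q) (pq : 2 < p + q).
Variables (n_ge1 : (1 <= n)%N) (alpha_gt0 : 0 < alpha) (alpha_ltn : alpha < n%:R).
Variables (beta_gt0 : 0 < beta) (beta_le2 : beta <= 2).

(** The upper bound p + q < 1 + (beta + alpha)/g, for g > 0, says exactly that g < [s]; the theorem
    uses it for g = n and g = gamma. *)
Let s : R := (alpha + beta) / (p + q - 1).

(* [delta] is the contribution of the far region, which is only known to be small
   for [phi] of large support, without any rate. *)
Lemma initial_data_bound (u0 : 'rV[R]_n -> R) (u : R -> 'rV[R]_n -> R) :
  global_weak_solution p q alpha beta u0 u ->
  exists2 C : R, 0 < C & forall rho delta, 0 < rho -> 0 < delta ->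
    exists phi : 'rV[R]_n -> R, [/\ measurable_fun setT phi,
      forall x, qbump rho x <= phi x <= 1,
      Lintegrable (lebesgue_rV R n) setT (fun x => (u0 x * phi x)%:E) &
      (\int[lebesgue_rV R n]_x (u0 x * phi x)%:E <=
        (C * rho `^ (n%:R - s) + delta)%:E)%E].
Proof.
move: beta_le2; rewrite le_eqVlt => /predU1P[b2 sol|]; last first.
  by move=> b2; exact: (fractional_bound p_gt0 q_gt0 pq n_ge1 alpha_gt0 alpha_ltn beta_gt0 b2).
rewrite b2 in sol; have [C C0 CP] := laplacian_bound p_gt0 q_gt0 pq alpha_gt0 alpha_ltn sol.
exists C => // rho delta rho0 delta0; have [Lu bu] := CP rho rho0.
exists (qbump rho); split => //.
- exact: measurable_bump.
- by move=> x; rewrite lexx bump_le1.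
- by apply: le_trans bu _; rewrite lee_fin /s b2 lerDl ltW.
Qed.

Lemma blow_up_slow_decay (gamma eps : R) (u0 : 'rV[R]_n -> R) (u : R -> 'rV[R]_n -> R) :
  0 < gamma < s -> 0 < eps ->
  (forall x, eps * (1 + enorm x ^+ 2) `^ (- gamma / 2) <= u0 x) ->
  ~ global_weak_solution p q alpha beta u0 u.
Proof.
move=> /andP[gamma0 gs] eps0 u0ge /initial_data_bound[C C0 CP].
have u00 x : 0 <= u0 x by apply: le_trans (u0ge x); rewrite mulr_ge0 ?powR_ge0// ltW.
have nR0 : 0 < n%:R :> R by rewrite ltr0n.
(* On the ball of radius rho/2 with rho >= 1 one has 1 + |x|^2 <= 2 rho^2, the bump is at least
   (3/4)^4, and the ball has measure at least (rho/n)^n. *)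
pose a : R := eps * 2 `^ (- gamma / 2) * (3 / 4) ^+ 4 / n%:R ^+ n.
have a0 : 0 < a by rewrite divr_gt0 ?exprn_gt0// !mulr_gt0 ?powR_gt0.
have lower rho delta : 1 <= rho -> 0 < delta ->
    a * rho `^ (n%:R - gamma) <= C * rho `^ (n%:R - s) + delta.
  move=> rho1 delta0; have rho0 : 0 < rho by rewrite (lt_le_trans ltr01).
  have [phi [mphi phile Lphi bphi]] := CP rho delta rho0 delta0.
  rewrite -lee_fin; apply: le_trans bphi.
  have up0 x : 0 <= u0 x * phi x.
    by rewrite mulr_ge0//; have /andP[h _] := phile x; rewrite (le_trans _ h) ?bump_ge0.
  pose B := [set y : 'rV[R]_n | enorm (0 - y) <= rho / 2].
  have mB : measurable B by exact: measurable_enorm_le.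
  pose k : R := eps * (2 * rho ^+ 2) `^ (- gamma / 2) * (3 / 4) ^+ 4.
  have k0 : 0 <= k by rewrite !mulr_ge0 ?powR_ge0// ltW.
  have kB x : B x -> k <= u0 x * phi x.
    rewrite /B/= sub0r enormN => xr; have /andP[bp _] := phile x.
    apply: ler_pM => //; first by rewrite mulr_ge0 ?powR_ge0// ltW.
      apply: le_trans (u0ge x); rewrite ler_wpM2l ?(ltW eps0)//.
      rewrite mulNr !powRN lef_pV2 ?posrE ?powR_gt0 ?mulr_gt0 ?exprn_gt0//; last first.
        by rewrite ltr_pwDl// sqr_ge0.
      apply: ge0_ler_powR; rewrite ?nnegrE ?addr_ge0 ?sqr_ge0 ?mulr_ge0 ?sqr_ge0 ?invr_ge0 ?(ltW gamma0) ?(ltW rho0)//.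
      have x2 : enorm x ^+ 2 <= rho ^+ 2.
        by rewrite lerXn2r ?nnegrE ?enorm_ge0 ?(ltW rho0)//; lra.
      have : 1 <= rho ^+ 2 by rewrite exprn_ege1.
      lra.
    by apply: le_trans bp; exact: bump_near.
  (* The product u0 phi need not be Borel, so monotonicity of the integral is applied to the
     representative [g]. *)
  have [g ig fg] := Lphi.
  have -> : (\int[lebesgue_rV R n]_x (u0 x * phi x)%:E = \int[lebesgue_rV R n]_x `|g x|)%E.
    transitivity (\int[lebesgue_rV R n]_x `|(u0 x * phi x)%:E|)%E.
      by apply: eq_integral => x _; rewrite gee0_abs ?lee_fin.
    apply: Defs.integral_ae_eq.
    have ? := ae_filter_ringOfSetsType (lebesgue_rV R n).
    by apply: filterS fg => x h xT; rewrite h.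
  apply: (@le_trans _ _ (\int[lebesgue_rV R n]_x (k%:E * (\1_B x)%:E))%E).
    rewrite ge0_integralZl//; last by apply/measurable_EFinP; exact: measurable_indic.
    rewrite integral_indic// setIT.
    rewrite [X in X%:E](_ : _ = k * (2 * (rho / 2) / n%:R) ^+ n); last first.
      rewrite /a /k powRM ?sqr_ge0// -(powR_mulrn 2 (ltW rho0)) -powRrM.
      rewrite (_ : 2 * (- gamma / 2) = - gamma); last by field.
      rewrite powRD ?(gt_eqF rho0) ?implybT// powR_mulrn ?(ltW rho0)//.
      rewrite (_ : 2 * (rho / 2) / n%:R = rho / n%:R); last by field; rewrite gt_eqF.
      by rewrite [(rho / _) ^+ _]expr_div_n; ring.
    by rewrite EFinM lee_wpmul2l// lebesgue_rV_ball_ge// divr_gt0.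
  apply: ae_ge0_le_integral => //.
  - by move=> y _; rewrite mule_ge0.
  - by apply: emeasurable_funM => //; apply/measurable_EFinP; exact: measurable_indic.
  - exact: (measurableT_comp (@abse_measurable R setT) (measurable_int _ ig)).
  have ? := ae_filter_ringOfSetsType (lebesgue_rV R n).
  apply: filterS fg => y h _; rewrite -(h Logic.I)/= ger0_norm// lee_fin indicE.
  case: (boolP (y \in B)) => [/set_mem yB|_]; first by rewrite mulr1; exact: kB.
  by rewrite mulr0.
have sg : 0 < s - gamma by rewrite subr_gt0.
(* With delta = C rho^(n-s), [lower] reads a rho^(s-gamma) <= 2 C; rho is chosen so that
   rho^(s-gamma) = M > 2 C / a. *)
pose M := 2 * C / a + 1.
have M1 : 1 <= M by rewrite lerDr divr_ge0 ?mulr_ge0// ltW.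
pose rho := M `^ (s - gamma)^-1.
have rho1 : 1 <= rho.
  by rewrite -(powRr0 M) ler_powR// invr_ge0 ltW.
have rho0 : 0 < rho by rewrite (lt_le_trans ltr01).
have rs0 : 0 < rho `^ (n%:R - s) by exact: powR_gt0.
have := lower rho (C * rho `^ (n%:R - s)) rho1 (mulr_gt0 C0 rs0).
have -> : n%:R - gamma = (s - gamma) + (n%:R - s) by ring.
rewrite powRD ?(gt_eqF rho0) ?implybT// {1}/rho -powRrM mulVf ?gt_eqF// powRr1; last exact: le_trans M1.
rewrite mulrA -mulrDl ler_pM2r// /M mulrDr mulrCA divff ?gt_eqF//; lra.
Qed.

Lemma cvg_qbump (x : 'rV[R]_n) : qbump k.+1%:R x @[k --> \oo] --> (1 : R).
Proof.
pose F (h : R) : R := Num.max 0 (1 - enorm x ^+ 2 * h ^+ 2) ^+ 4.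
have cF : continuous F.
  apply/continuous_exprR/continuous_posR => h; apply: cvgB; first exact: cvg_cst.
  by apply: cvgM; [exact: cvg_cst|apply: continuous_exprR => z; exact: cvg_id].
have F0 : F 0 = 1 by rewrite /F expr0n/= mulr0 subr0 max_r// expr1n.
rewrite (_ : (fun k => _) = F \o harmonic); last first.
  by apply/funext => k; rewrite /F /harmonic/= exprVn.
by rewrite -F0; apply: continuous_cvg; [exact: cF|exact: cvg_harmonic].
Qed.

Lemma cvg_powRN_succ (e : R) : 0 < e -> k.+1%:R `^ (- e) @[k --> \oo] --> (0 : R).
Proof.
move=> e0; have h := powR_cvg0 e0.
rewrite (_ : (fun k => _) = (fun a : R => a `^ e) \o harmonic); last first.
  by apply/funext => k; rewrite /harmonic/= -powR_inv1// -powRrM mulN1r.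
apply: cvg_comp h => A; rewrite /at_right /within /= => A0.
have [N _ NA] := cvg_harmonic A0.
by exists N => // k /NA; apply => /=; rewrite invr_gt0.
Qed.

(** Taken with rho = k + 1 and delta = 1/(k + 1). Squeezed between the bump and 1, phi tends to 1
    pointwise, so dominated convergence with majorant |u0| applies, while the bound tends to 0
    because n < s. *)
Lemma blow_up_integrable (u0 : 'rV[R]_n -> R) (u : R -> 'rV[R]_n -> R) :
  n%:R < s -> Lintegrable (lebesgue_rV R n) setT (fun x => (u0 x)%:E) ->
  (0 < \int[lebesgue_rV R n]_x (u0 x)%:E)%E ->
  ~ global_weak_solution p q alpha beta u0 u.
Proof.
move=> ns [g ig ug] I0 /initial_data_bound[C C0 CP].
have inv0 k : 0 < k.+1%:R^-1 :> R by rewrite invr_gt0.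
have [phi phiP] := @choice _ _ (fun (k : nat) (phi : 'rV[R]_n -> R) => [/\ measurable_fun setT phi,
      forall x, qbump k.+1%:R x <= phi x <= 1,
      Lintegrable (lebesgue_rV R n) setT (fun x => (u0 x * phi x)%:E) &
      (\int[lebesgue_rV R n]_x (u0 x * phi x)%:E <=
        (C * k.+1%:R `^ (n%:R - s) + k.+1%:R^-1)%:E)%E])
  (fun k => CP k.+1%:R k.+1%:R^-1 (ltr0Sn _ _) (inv0 k)).
have mg := measurable_int _ ig.
have ae := ae_filter_ringOfSetsType (lebesgue_rV R n).
have phi0 k x : 0 <= phi k x.
  by have [_ /(_ x)/andP[h _] _ _] := phiP k; rewrite (le_trans _ h) ?bump_ge0.
have cphi x : phi k x @[k --> \oo] --> (1 : R).
  apply: (squeeze_cvgr _ (f := fun k => qbump k.+1%:R x) (h := fun=> 1)).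
  - by apply: nearW => k; have [_ /(_ x) h _ _] := phiP k.
  - exact: cvg_qbump.
  - exact: cvg_cst.
have fE k : (\int[lebesgue_rV R n]_x (u0 x * phi k x)%:E =
    \int[lebesgue_rV R n]_x (g x * (phi k x)%:E))%E.
  by apply: Defs.integral_ae_eq; apply: filterS ug => x h xT; rewrite EFinM h.
have mf k : measurable_fun setT (fun x => g x * (phi k x)%:E)%E.
  by apply: emeasurable_funM => //; apply/measurable_EFinP; have [] := phiP k.
have fg : \forall x \ae lebesgue_rV R n, setT x ->
    (g x * (phi k x)%:E)%E @[k --> \oo] --> g x.
  apply: filterS ug => x h xT; rewrite -(h xT) -[X in _ --> X]mule1.
  apply: cvgeZl => //; apply: cvg_EFin; [exact: nearW|exact: cphi].
have dom : \forall x \ae lebesgue_rV R n, forall k, setT x ->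
    (`|g x * (phi k x)%:E| <= `|g x|)%E.
  apply: aeW => x k _; rewrite abseM -[leRHS]mule1; apply: lee_wpmul2l => //.
  have [_ /(_ x)/andP[_ h] _ _] := phiP k.
  by rewrite gee0_abs lee_fin.
have [_ _ lim_int] := dominated_convergence measurableT mf mg fg (integrable_abse ig) dom.
pose b (k : nat) : R := C * k.+1%:R `^ (- (s - n%:R)) + k.+1%:R^-1.
have cb : (b k)%:E @[k --> \oo] --> 0%:E.
  apply: cvg_EFin; first exact: nearW.
  rewrite (_ : 0 = C * 0 + 0); last by rewrite mulr0 addr0.
  apply: cvgD; last exact: cvg_harmonic.
  by apply: cvgM; [exact: cvg_cst|apply: cvg_powRN_succ; rewrite subr_gt0].
move: I0; rewrite (Defs.integral_ae_eq ug) ltNge => /negP; apply.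
rewrite -(cvg_lim (@ereal_hausdorff R) lim_int) -[leRHS](cvg_lim (@ereal_hausdorff R) cb).
apply: lee_lim; [by apply/cvg_ex; eexists; exact: lim_int|by apply/cvg_ex; eexists; exact: cb|].
apply: nearW => k; have [_ _ _ bk] := phiP k.
by move: bk; rewrite fE /b opprB.
Qed.

End blow_up.

Theorem theorem1p4 (R : realType) (n : nat) (p q alpha beta : R)
  (n_ge1 : (1 <= n)%N) (p_gt0 : 0 < p) (q_gt0 : 0 < q)
  (alpha_gt0 : 0 < alpha) (alpha_ltn : alpha < n%:R)
  (beta_gt0 : 0 < beta) (beta_le2 : beta <= 2) :
  (forall u0 : 'rV[R]_n -> R,
     alpha + beta > n%:R ->
     Lintegrable (lebesgue_rV R n) setT (fun x => (u0 x)%:E) ->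
     (0 < \int[lebesgue_rV R n]_x (u0 x)%:E)%E ->
     2 < p + q < 1 + (beta + alpha) / n%:R ->
     ~ exists u : R -> 'rV[R]_n -> R,
         global_weak_solution p q alpha beta u0 u) /\
  (forall (gamma : R) (u0 : 'rV[R]_n -> R),
     0 < gamma < alpha + beta ->
     L1loc_space u0 ->
     (exists2 eps : R, 0 < eps &
        forall x, u0 x >= eps * (1 + enorm x ^+ 2) `^ (- gamma / 2)) ->
     2 < p + q < 1 + (beta + alpha) / gamma ->
     ~ exists u : R -> 'rV[R]_n -> R,
         global_weak_solution p q alpha beta u0 u).
Proof.
split.
- move=> u0 ab iu0 I0 /andP[pq pqn] [u sol].
  have nR0 : 0 < n%:R :> R by rewrite ltr0n.
  apply: (blow_up_integrable p_gt0 q_gt0 pq n_ge1 alpha_gt0 alpha_ltn beta_gt0 beta_le2 _ iu0 I0 sol).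
  have r1 : 0 < p + q - 1 by lra.
  by rewrite ltr_pdivlMr// mulrC -ltr_pdivlMr//; lra.
- move=> gamma u0 /andP[gamma0 _] _ [eps eps0 u0ge] /andP[pq pqg] [u sol].
  apply: (blow_up_slow_decay p_gt0 q_gt0 pq n_ge1 alpha_gt0 alpha_ltn beta_gt0 beta_le2 _ eps0 u0ge sol).
  have r1 : 0 < p + q - 1 by lra.
  by rewrite gamma0/= ltr_pdivlMr// mulrC -ltr_pdivlMr//; lra.
Qed.
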